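(* Let $f:\mathbb{R}^m\rightarrow\mathbb{R}$ be a $C^3$ function, and consider New Q-Newton's method for $f$ (defined in the context) with hyperparameters $\alpha>0$ and $\delta_0,\ldots,\delta_m$. Let $\{x_n\}$ be a sequence constructed by New Q-Newton's method from an initial point $x_0\in\mathbb{R}^m$, and assume that $\{x_n\}$ converges to a point $x_\infty\in\mathbb{R}^m$. Then: 1) $\nabla f(x_\infty)=0$, that is, $x_\infty$ is a critical point of $f$. 2) If the hyperparameters $\delta_0,\ldots,\delta_m$ are chosen randomly (in the sense explained in the context), there is a set $\mathcal{A}\subset\mathbb{R}^m$ of Lebesgue measure $0$ (independent of $x_0$) so that if $x_0\notin\mathcal{A}$, then $x_\infty$ cannot be a saddle point of $f$. 3) If (with $\delta_0,\ldots,\delta_m$ and the set $\mathcal{A}$ as in part 2) $x_0\notin\mathcal{A}$ and $\nabla^2 f(x_\infty)$ is invertible, then $x_\infty$ is a local minimum of $f$ and the rate of convergence is quadratic, i.e. $\|x_{n+1}-x_\infty\|=O(\|x_n-x_\infty\|^2)$. 4) More generally, if $\nabla^2 f(x_\infty)$ is invertible (with no assumption on the randomness of $x_0$), then the rate of convergence is at least linear, i.e. $\|x_{n+1}-x_\infty\|=O(\|x_n-x_\infty\|)$. 5) If $x'_\infty$ is a non-degenerate local minimum of $f$, then for every initial point $x'_0$ close enough to $x'_\infty$, the sequence $\{x'_n\}$ constructed by New Q-Newton's method from $x'_0$ converges to $x'_\infty$.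
   Context: New Q-Newton's method. Fix $\alpha>0$ and pairwise distinct real numbers $\delta_0,\delta_1,\ldots,\delta_m$. For a symmetric invertible real $m\times m$ matrix $A$, let $pr_{A,+}$ and $pr_{A,-}$ be the orthogonal projections of $\mathbb{R}^m$ onto the span of the eigenvectors of $A$ with positive eigenvalues, respectively negative eigenvalues. For a $C^2$ function $f:\mathbb{R}^m\to\mathbb{R}$ and $x\in\mathbb{R}^m$ with $\nabla f(x)\neq 0$, let $\delta(x)=\delta_j$, where $j$ is the smallest index such that $\nabla^2 f(x)+\delta_j\|\nabla f(x)\|^{1+\alpha}\mathrm{Id}$ is invertible; if $\nabla f(x)=0$, put $\delta(x)=\delta_0$. Given an initial point $x_0$, define $$A_n=\nabla^2 f(x_n)+\delta(x_n)\|\nabla f(x_n)\|^{1+\alpha}\mathrm{Id},\quad v_n=A_n^{-1}\nabla f(x_n),\quad w_n=pr_{A_n,+}(v_n)-pr_{A_n,-}(v_n),\quad x_{n+1}=x_n-w_n.$$ If $\nabla f(x_n)=0$, then $v_n=w_n=0$ and $x_{n+1}=x_n$. Randomness of hyperparameters: ''$\delta_0,\ldots,\delta_m$ are chosen randomly'' means that they avoid a certain exceptional subset of $\mathbb{R}$ of Lebesgue measure $0$ depending only on $f$ and $\alpha$; i.e. the assertions made under this assumption are that there exists a set $E\subset\mathbb{R}$ of Lebesgue measure $0$, depending only on $f$ and $\alpha$, such that the assertions hold whenever $\delta_0,\ldots,\delta_m\notin E$. A critical point $x^*$ of $f$ is non-degenerate if $\nabla^2 f(x^* )$ is invertible. A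 saddle point of $f$ is a critical point $x^*$ at which $\nabla^2 f(x^* )$ is invertible and has both positive and negative eigenvalues. *)

(* Defs.v *)
(* MathComp / MathComp-Analysis. *)
From HB Require Import structures.
From mathcomp Require Import all_boot all_order all_algebra.
From mathcomp Require Import polyrcf.
From mathcomp Require Import all_classical all_reals all_analysis.

Set Implicit Arguments.
Unset Strict Implicit.
Unset Printing Implicit Defensive.

Import Order.TTheory GRing.Theory Num.Theory.
Import numFieldNormedType.Exports.

Local Open Scope classical_set_scope.
Local Open Scope ring_scope.

(* Points, gradients and eigenvectors are row vectors, on which matrices act
   from the right; all the matrices concerned are meant to be symmetric. *)

(* The library norm `|x| on 'rV[R]_m is the sup norm. *)
Definition enorm (R : realType) (m : nat) (x : 'rV[R]_m) : R :=
  Num.sqrt (\sum_(i < m) x ord0 i ^+ 2).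

Definition partial (R : realType) (m : nat) (f : 'rV[R]_m -> R) (i : 'I_m)
    (x : 'rV[R]_m) : R :=
  'D_(delta_mx ord0 i) f x.

Fixpoint Ck (R : realType) (m k : nat) (f : 'rV[R]_m -> R) : Prop :=
  if k is k'.+1 then
    (forall x, differentiable f x) /\ (forall i, Ck k' (partial f i))
  else continuous f.

Definition gradient (R : realType) (m : nat) (f : 'rV[R]_m -> R)
    (x : 'rV[R]_m) : 'rV[R]_m :=
  \row_i partial f i x.

Definition hessian (R : realType) (m : nat) (f : 'rV[R]_m -> R)
    (x : 'rV[R]_m) : 'M[R]_m :=
  \matrix_(i, j) partial (partial f i) j x.

(* The row space of each of the next two matrices is the span of the
   eigenvectors of A with positive, resp. negative, eigenvalue: rootsR lists
   all the real roots of a nonzero polynomial. *)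
Definition pos_eigenspan (R : realType) (m : nat) (A : 'M[R]_m) : 'M[R]_m :=
  (\sum_(a <- rootsR (char_poly A) | (0 < a)%R) eigenspace A a)%MS.

Definition neg_eigenspan (R : realType) (m : nat) (A : 'M[R]_m) : 'M[R]_m :=
  (\sum_(a <- rootsR (char_poly A) | (a < 0)%R) eigenspace A a)%MS.

(* The row space of kermx U^T is the Euclidean orthogonal complement of the
   row space of U. *)
Definition ortho_proj (R : realType) (m : nat) (U : 'M[R]_m) : 'M[R]_m :=
  proj_mx U (kermx U^T).

Definition pr_pos (R : realType) (m : nat) (A : 'M[R]_m) : 'M[R]_m :=
  ortho_proj (pos_eigenspan A).

Definition pr_neg (R : realType) (m : nat) (A : 'M[R]_m) : 'M[R]_m :=
  ortho_proj (neg_eigenspan A).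

Definition shifted_hessian (R : realType) (m : nat) (f : 'rV[R]_m -> R)
    (alpha d : R) (x : 'rV[R]_m) : 'M[R]_m :=
  hessian f x + (d * enorm (gradient f x) `^ (1 + alpha))%:M.

(* When gradient f x != 0 and the delta j are pairwise distinct, at least one
   of the m + 1 shifted Hessians is invertible, so the default of the arg min
   is never used. *)
Definition nqn_delta (R : realType) (m : nat) (f : 'rV[R]_m -> R) (alpha : R)
    (delta : 'I_m.+1 -> R) (x : 'rV[R]_m) : R :=
  if gradient f x == 0 then delta ord0
  else delta [arg min_(j < ord0 | shifted_hessian f alpha (delta j) x
                                    \in unitmx) (j : nat)]%N.

(* If gradient f x = 0 then v = w = 0, whatever invmx A is, so the step fixes
   x even when A is singular. *)
Definition nqn_step (R : realType) (m : nat) (f : 'rV[R]_m -> R) (alpha : R)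
    (delta : 'I_m.+1 -> R) (x : 'rV[R]_m) : 'rV[R]_m :=
  let A := shifted_hessian f alpha (nqn_delta f alpha delta x) x in
  let v := gradient f x *m invmx A in
  let w := v *m pr_pos A - v *m pr_neg A in
  x - w.

Definition nqn_seq (R : realType) (m : nat) (f : 'rV[R]_m -> R) (alpha : R)
    (delta : 'I_m.+1 -> R) (x0 : 'rV[R]_m) (n : nat) : 'rV[R]_m :=
  iter n (nqn_step f alpha delta) x0.

Definition nondegenerate_critical (R : realType) (m : nat) (f : 'rV[R]_m -> R)
    (x : 'rV[R]_m) : Prop :=
  gradient f x = 0 /\ hessian f x \in unitmx.

Definition saddle_point (R : realType) (m : nat) (f : 'rV[R]_m -> R)
    (x : 'rV[R]_m) : Prop :=
  [/\ gradient f x = 0, hessian f x \in unitmx,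
      exists2 a : R, 0 < a & eigenvalue (hessian f x) a
    & exists2 b : R, b < 0 & eigenvalue (hessian f x) b].

Definition local_min (R : realType) (m : nat) (f : 'rV[R]_m -> R)
    (x : 'rV[R]_m) : Prop :=
  \forall y \near x, f x <= f y.

Definition box (R : realType) (m : nat) (a b : 'rV[R]_m) : set 'rV[R]_m :=
  [set x | forall i, a ord0 i <= x ord0 i <= b ord0 i].

(* The library has Lebesgue measure on R only. This is Lebesgue outer measure
   on R^m, for 0 < m: for m = 0 there is no empty box, so that even set0 would
   get the value +oo. *)
Definition lebesgue_outer (R : realType) (m : nat) (A : set 'rV[R]_m) : \bar R :=
  ereal_inf [set s | exists a b : nat -> 'rV[R]_m,
    [/\ forall k i, a k ord0 i <= b k ord0 i,
        A `<=` \bigcup_k box (a k) (b k)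
      & s = (\sum_(0 <= k <oo)
               (\prod_(i < m) (b k ord0 i - a k ord0 i))%:E)%E]].

Definition lebesgue_null (R : realType) (m : nat) (A : set 'rV[R]_m) : Prop :=
  lebesgue_outer A = 0%E.

(* Main.v *)
Require Import Defs.
From mathcomp Require Import all_boot all_order all_algebra.
From mathcomp Require Import ring lra.
From mathcomp Require Import polyrcf.
From mathcomp Require Import all_classical all_reals all_analysis.
From mathcomp Require Import measurable_realfun.

Set Implicit Arguments.
Unset Strict Implicit.
Unset Printing Implicit Defensive.

Import Order.TTheory GRing.Theory Num.Theory.
Import numFieldNormedType.Exports.

Local Open Scope classical_set_scope.
Local Open Scope ring_scope.

(** Write g and H for the gradient and the Hessian of f, and S_A for the difference
    of the two projections attached to a symmetric matrix A: it is the sign of A,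
    hence symmetric, it commutes with A, and its square is 1 if A is invertible.
    With A = H(x) + d |g(x)|^(1 + alpha), the step is F(x) = x - g(x) A^-1 S_A.

    Limits are critical. The step determines the gradient, g(x) = (x - F(x)) S_A A
    ([nqn_step_gradient]). Along a convergent sequence x - F(x) tends to 0, while
    the matrices S_A, being orthogonal, and A are bounded; so g tends to 0
    ([limit_critical]).

    The step near a nondegenerate critical point z. The maps A |-> A^-1 and
    A |-> S_A are strictly differentiable at an invertible symmetric matrix; for
    the second one this comes from subtracting the identities S A = A S and S S = 1
    at two matrices ([sgnmx_diff]). Since alpha > 0, the power |g|^(1 + alpha) is
    strictly differentiable even where g = 0 ([norm_power_diff]). So the step with
    a fixed shift d is strictly differentiable wherever A is invertible
    ([nqn_fixed_diff]), and at z its derivative is 1 - S with S the sign of H(z)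
    ([critical_strict]). This gives the linear rate. If H(z) has no negative
    eigenvalue, then S = 1, the step is a contraction near z, Newton's classical
    computation gives the quadratic rate ([step_quadratic]), and z is a local
    minimum; conversely H has no negative eigenvalue at a local minimum.

    If H(z) has a negative eigenvalue, the derivative doubles the corresponding
    eigenvectors. Two orbits that stay near z for ever cannot then differ by a
    vector of a certain cone, which the step maps to itself and on which it
    expands; so the points whose whole orbit stays near z form a part of a
    Lipschitz graph over a hyperplane, a null set ([trapped_null], [null_cone]).

    Pulling back. An orbit that converges to such a z enters the null set after
    finitely many steps, so it remains to see that preimages of null sets under F
    are null, for almost every choice of the shifts. Critical points are fixed by
    F. At a given noncritical point x, the derivative of the step with shift d is,
    for each pattern of signs of the eigenvalues of A, a rational matrix function
    of 1/d which tends to the identity at 1/d = 0; hence it is invertible for all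
    but finitely many d ([generic_good]). An elementary form of Fubini's theorem
    exchanges the roles of x and d: for almost every d, the derivative is
    invertible for almost every x ([null_sections], [exceptional_parameters]).
    Near those x the step has a Lipschitz inverse, and countably many balls cover
    them ([null_step_preimage]). The bad starting points are a countable union of
    preimages under iterates of F of null trapped sets in rational balls
    ([bad_start_null], [bad_start_saddle]). *)

(** * The spectral theorem *)

Section Dot.
Context {R : realType} {n : nat}.
Implicit Types (u v w : 'rV[R]_n) (A : 'M[R]_n).

Definition dotv u v : R := (u *m v^T) ord0 ord0.

Lemma dotvE u v : dotv u v = \sum_i u ord0 i * v ord0 i.
Proof. by rewrite /dotv mxE; apply: eq_bigr => i _; rewrite mxE. Qed.

Lemma dotvC u v : dotv u v = dotv v u.
Proof. by rewrite !dotvE; apply: eq_bigr => i _; rewrite mulrC. Qed.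

Lemma dotvDl u v w : dotv (u + v) w = dotv u w + dotv v w.
Proof. by rewrite /dotv mulmxDl mxE. Qed.

Lemma dotvZl a u w : dotv (a *: u) w = a * dotv u w.
Proof. by rewrite /dotv -scalemxAl mxE. Qed.

Lemma dotvNl u w : dotv (- u) w = - dotv u w.
Proof. by rewrite /dotv mulNmx mxE. Qed.

Lemma dotvDr u v w : dotv w (u + v) = dotv w u + dotv w v.
Proof. by rewrite dotvC dotvDl !(dotvC w). Qed.

Lemma dotvZr a u w : dotv w (a *: u) = a * dotv w u.
Proof. by rewrite dotvC dotvZl dotvC. Qed.

Lemma dotvNr u w : dotv w (- u) = - dotv w u.
Proof. by rewrite dotvC dotvNl dotvC. Qed.

Lemma dotv0l u : dotv 0 u = 0.
Proof. by rewrite /dotv mul0mx mxE. Qed.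

Lemma dotv_mulmxl A u v : dotv (u *m A) v = dotv u (v *m A^T).
Proof. by rewrite /dotv trmx_mul trmxK mulmxA. Qed.

Lemma dotvv_ge0 u : 0 <= dotv u u.
Proof. by rewrite dotvE sumr_ge0// => i _; rewrite -expr2 sqr_ge0. Qed.

Lemma dotvv_eq0 u : dotv u u = 0 -> u = 0.
Proof.
rewrite dotvE => /eqP; rewrite psumr_eq0 => [/allP h|i _]; last first.
  by rewrite -expr2 sqr_ge0.
apply/rowP => i; rewrite mxE; apply/eqP; rewrite -sqrf_eq0 expr2.
exact: (h i (mem_index_enum _)).
Qed.

Lemma dotvv_gt0 u : u != 0 -> 0 < dotv u u.
Proof.
by move=> u0; rewrite lt_def dotvv_ge0 andbT; apply: contra u0 => /eqP/dotvv_eq0->.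
Qed.

(** Otherwise the form would be negative at u - s (u A) for a small s > 0, where
    its value is - 2 s <u A, u A> + O(s^2). *)
Lemma psd_isotropic A u : A^T = A -> (forall w, 0 <= dotv (w *m A) w) ->
  dotv (u *m A) u = 0 -> u *m A = 0.
Proof.
move=> AT psd uu; apply: dotvv_eq0.
set v := u *m A; set b := dotv (v *m A) v; have b0 : 0 <= b by apply: psd.
have := psd (u - (dotv v v / (b + 1)) *: v).
set s := _ / _.
(* The denominator b + 1 rather than b keeps s meaningful when b = 0. *)
have vv0 := dotvv_ge0 v.
have -> : dotv ((u - s *: v) *m A) (u - s *: v) = s * (s * b - 2 * dotv v v).
  rewrite mulmxBl -scalemxAl !(dotvDl, dotvDr, dotvNl, dotvNr, dotvZl, dotvZr).
  rewrite uu (dotv_mulmxl A v u) AT -/v -/b; ring.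
have b1 : 0 < b + 1 by lra.
have sb : s * (b + 1) = dotv v v by rewrite /s divfK// gt_eqF.
have s0 : 0 <= s by rewrite divr_ge0// ltW.
move=> h; nra.
Qed.

End Dot.

Section Spectral.
Context {R : realType}.

Lemma mx_entry_le m n (M : 'M[R]_(m, n)) i j : `|M i j| <= `|M|.
Proof.
rewrite [leRHS]/Num.norm /= mx_normrE; apply/bigmax_geP; right => /=.
by exists (i, j).
Qed.

Lemma mx_norm_le m n (M : 'M[R]_(m, n)) b : 0 <= b ->
  (forall i j, `|M i j| <= b) -> `|M| <= b.
Proof.
move=> b0 h; rewrite [leLHS]/Num.norm /= mx_normrE.
by apply/bigmax_leP; split => // -[i j] _ /=.
Qed.

Lemma scalar_mx1_norm (a : R) : `|a%:M : 'M[R]_1| = `|a|.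
Proof.
apply/eqP; rewrite eq_le; apply/andP; split.
  by apply: mx_norm_le => // i j; rewrite !ord1 mxE eqxx.
by have := mx_entry_le (a%:M : 'M[R]_1) ord0 ord0; rewrite mxE eqxx.
Qed.

Lemma cvg_sumr (T : Type) (F : set_system T) {FF : Filter F} (V : normedModType R)
    (I : Type) (r : seq I) (f : I -> T -> V) (l : I -> V) :
  (forall i, f i x @[x --> F] --> l i) ->
  \sum_(i <- r) f i x @[x --> F] --> \sum_(i <- r) l i.
Proof.
move=> fl; elim: r => [|i r IH].
  rewrite big_nil; under eq_fun do rewrite big_nil; exact: cvg_cst.
rewrite big_cons; under eq_fun do rewrite big_cons; exact: cvgD.
Qed.

Lemma continuous_sumr (T : topologicalType) (V : normedModType R)
    (I : Type) (r : seq I) (f : I -> T -> V) :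
  (forall i, continuous (f i)) -> continuous (fun x => \sum_(i <- r) f i x).
Proof. by move=> fc x; apply: (@cvg_sumr _ (nbhs x)) => i; exact: fc. Qed.

Lemma quad_form_continuous n (A : 'M[R]_n) :
  continuous (fun u : 'rV[R]_n => dotv (u *m A) u).
Proof.
have -> : (fun u : 'rV[R]_n => dotv (u *m A) u) =
    (fun u => \sum_i (\sum_j u ord0 j * A j i) * u ord0 i).
  by apply/funext => v; rewrite dotvE; apply: eq_bigr => i _; rewrite mxE.
have lin i : continuous (fun u : 'rV[R]_n => \sum_j u ord0 j * A j i).
  apply: continuous_sumr => j v; apply: (@cvgM _ _ (nbhs v)); last exact: cvg_cst.
  exact: coord_continuous.
apply: continuous_sumr => i u; apply: (@cvgM _ _ (nbhs u)); first exact: lin.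
exact: coord_continuous.
Qed.

(** Take a maximiser of the Rayleigh quotient on the unit sphere: with l the
    maximum, l - A is positive semidefinite and the maximiser is isotropic
    for it. *)
Lemma symmetric_eigenvector n (A : 'M[R]_n.+1) : A^T = A ->
  exists u l, dotv u u = 1 /\ u *m A = l *: u.
Proof.
move=> AT; pose S := [set u : 'rV[R]_n.+1 | dotv u u = 1].
have S0 : S !=set0.
  exists (delta_mx 0 0); rewrite /S /= dotvE (bigD1 0)//= big1 ?addr0.
    by rewrite !mxE !eqxx mulr1.
  by move=> i i0; rewrite !mxE (negPf i0) andbF mulr0.
have cS : compact S.
  apply: bounded_closed_compact.
    exists 1; split => // M M1 u /= Su; apply: (le_trans _ (ltW M1)).
    apply: mx_norm_le => // i j; rewrite (ord1 i) -(@expr_le1 _ 2)//.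
    rewrite -Su dotvE (bigD1 j)//= real_normK ?num_real// expr2 lerDl.
    by apply: sumr_ge0 => k _; rewrite -expr2 sqr_ge0.
  have -> : S = (fun u : 'rV[R]_n.+1 => dotv (u *m 1%:M) u) @^-1` [set 1].
    by apply/funext => u; rewrite /S /= mulmx1.
  by apply: closed_comp => // u _; exact: quad_form_continuous.
have [u /set_mem Su umax] := EVT_max_rV S0 cS
  (continuous_subspaceT (@quad_form_continuous _ A)).
pose l := dotv (u *m A) u.
exists u, l; split => //.
apply/eqP; rewrite -subr_eq0 -mul_mx_scalar -mulmxBr; apply/eqP.
rewrite -opprB mulmxN; apply/eqP; rewrite oppr_eq0; apply/eqP.
have quadE w : dotv (w *m (l%:M - A)) w = l * dotv w w - dotv (w *m A) w.
  by rewrite mulmxBr mul_mx_scalar dotvDl dotvNl dotvZl.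
apply: psd_isotropic.
- by rewrite linearB /= tr_scalar_mx AT.
- move=> w; rewrite quadE subr_ge0.
  have [->|w0] := eqVneq w 0; first by rewrite mul0mx !dotv0l mulr0.
  have ww := dotvv_gt0 w0; pose c := Num.sqrt (dotv w w).
  have c0 : 0 < c by rewrite sqrtr_gt0.
  have cc : c * c = dotv w w by rewrite -expr2 sqr_sqrtr// ltW.
  have : c^-1 *: w \in S.
    rewrite inE /S /= dotvZl dotvZr -cc; field; exact: lt0r_neq0.
  move=> /umax; rewrite -/l -scalemxAl dotvZl dotvZr => h.
  have : c * (c * (c^-1 * (c^-1 * dotv (w *m A) w))) <= c * (c * l).
    by rewrite !ler_pM2l.
  by rewrite !mulVKf ?gt_eqF// !mulrA cc mulrC.
- by rewrite quadE Su mulr1 subrr.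
Qed.

(** Householder's reflection exchanging u and the first basis vector. *)
Lemma orthogonal_with_first_row n (u : 'rV[R]_n.+1) : dotv u u = 1 ->
  exists Q : 'M[R]_n.+1, Q *m Q^T = 1%:M /\ row ord0 Q = u.
Proof.
move=> uu; pose e : 'rV[R]_n.+1 := delta_mx ord0 ord0.
have ee : dotv e e = 1.
  rewrite dotvE (bigD1 ord0)//= big1 ?addr0 => [|i i0].
    by rewrite !mxE !eqxx mulr1.
  by rewrite !mxE (negPf i0) andbF mulr0.
have [->|ue] := eqVneq u e.
  by exists 1%:M; rewrite trmx1 mulmx1 row1.
pose w := u - e; have w0 : w != 0 by rewrite subr_eq0.
have ww := dotvv_gt0 w0; pose c := 2 / dotv w w.
have wwE : dotv w w = 2 - 2 * dotv e u.
  rewrite /w !(dotvDl, dotvDr, dotvNl, dotvNr) uu ee (dotvC u e); ring.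
exists (1%:M - c *: (w^T *m w)).
have trQ : (1%:M - c *: (w^T *m w))^T = 1%:M - c *: (w^T *m w).
  by rewrite linearB /= trmx1 linearZ /= trmx_mul trmxK.
split; last first.
  rewrite rowE -/e mulmxBr mulmx1 -scalemxAr mulmxA.
  have -> : e *m w^T = (dotv e w)%:M.
    by rewrite [LHS]mx11_scalar.
  rewrite mul_scalar_mx scalerA.
  have -> : c * dotv e w = -1.
    have -> : dotv e w = - (dotv w w / 2).
      by rewrite wwE /w dotvDr dotvNr ee; field.
    rewrite /c; field; exact: lt0r_neq0.
  by rewrite scaleN1r opprK /w addrC subrK.
rewrite trQ; set N := w^T *m w.
have NN : N *m N = dotv w w *: N.
  rewrite /N -mulmxA (mulmxA w) [w *m w^T]mx11_scalar -/(dotv w w).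
  by rewrite mul_scalar_mx -scalemxAr.
have cc : c * (c * dotv w w) = c + c by rewrite /c; field; exact: lt0r_neq0.
rewrite mulmxBr mulmx1 mulmxBl mul1mx -scalemxAl -scalemxAr NN !scalerA -mulrA cc.
by rewrite scalerDl opprB addrK subrK.
Qed.

Lemma block_diag_congr p q (D1 : 'M[R]_p) (D2 Q : 'M[R]_q) :
  block_mx D1 0 0 (Q^T *m D2 *m Q) =
  (block_mx (1%:M : 'M[R]_p) 0 0 Q)^T *m block_mx D1 0 0 D2 *m block_mx (1%:M : 'M[R]_p) 0 0 Q.
Proof.
rewrite tr_block_mx trmx1 !trmx0 !mulmx_block.
by rewrite !(mul0mx, mulmx0, addr0, add0r, mul1mx, mulmx1).
Qed.

Lemma block_orthogonal p q (Q : 'M[R]_q) : Q *m Q^T = 1%:M ->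
  block_mx (1%:M : 'M[R]_p) 0 0 Q *m (block_mx (1%:M : 'M[R]_p) 0 0 Q)^T = 1%:M.
Proof.
move=> QQ; rewrite tr_block_mx trmx1 !trmx0 mulmx_block QQ.
by rewrite !(mul0mx, mulmx0, addr0, add0r, mul1mx) -scalar_mx_block.
Qed.

(** The spectral theorem, splitting off one eigenvector at a time. Vectors are
    rows, so the eigenvectors are the rows of Q. *)
Lemma spectral n (A : 'M[R]_n) : A^T = A ->
  exists (Q : 'M[R]_n) (d : 'rV[R]_n),
    Q *m Q^T = 1%:M /\ A = Q^T *m diag_mx d *m Q.
Proof.
elim: n A => [|n IH] A AT.
  by exists 1%:M, 0; rewrite !(thinmx0, flatmx0).
have [u [l [uu uA]]] := symmetric_eigenvector AT.
have [P [PP rP]] := orthogonal_with_first_row uu.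
have PP' : P^T *m P = 1%:M by exact: mulmx1C.
pose B : 'M[R]_(1 + n) := P *m A *m P^T.
have BT : B^T = B by rewrite /B !trmx_mul trmxK AT mulmxA.
have B0 : row ord0 B = l *: delta_mx ord0 ord0.
  by rewrite /B !row_mul rP uA -scalemxAl -rP -row_mul PP row1.
have B0E j : B ord0 j = l *+ (j == ord0).
  have /rowP/(_ j) := B0; rewrite [row _ _ _ _]mxE => ->.
  by rewrite !mxE eqxx /= mulr_natr.
have i0E : lshift n (ord0 : 'I_1) = ord0 by exact: val_inj.
have ulB : ulsubmx B = l%:M.
  apply/matrixP => i j; rewrite !ord1 [LHS]mxE [LHS]mxE i0E B0E.
  by rewrite [RHS]mxE !eqxx.
have urB : ursubmx B = 0.
  by apply/matrixP => i j; rewrite !ord1 [LHS]mxE [LHS]mxE i0E B0E [RHS]mxE.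
have dlB : dlsubmx B = 0 by rewrite -BT -[RHS]trmx0 -urB trmx_ursub.
have [|Q [d [QQ QB]]] := IH (drsubmx B).
  by rewrite trmx_drsub BT.
pose Q1 : 'M[R]_(1 + n) := block_mx 1%:M 0 0 Q.
have BE : B = Q1^T *m diag_mx (row_mx l%:M d) *m Q1.
  rewrite -[LHS](@submxK _ 1 n 1 n) ulB urB dlB QB diag_mx_row.
  have -> : diag_mx (l%:M : 'rV_1) = l%:M.
    by apply/matrixP => i j; rewrite !ord1 !mxE eqxx.
  exact: block_diag_congr.
have Q11 : Q1 *m Q1^T = 1%:M by exact: block_orthogonal.
exists (Q1 *m P), (row_mx l%:M d); split.
  by rewrite trmx_mul mulmxA -(mulmxA Q1) PP mulmx1.
transitivity (P^T *m B *m P).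
  by rewrite /B !mulmxA PP' mul1mx -mulmxA PP' mulmx1.
by rewrite [in LHS]BE trmx_mul !mulmxA.
Qed.

End Spectral.

(** * The sign of a symmetric matrix *)

Section SignMatrix.
Context {R : realType} {n : nat}.
Implicit Types (A Q U : 'M[R]_n) (d : 'rV[R]_n).

(** The common form of the spans of the positive and of the negative
    eigenvectors. *)
Definition eigenspan (P : pred R) A : 'M[R]_n :=
  (\sum_(a <- rootsR (char_poly A) | P a) eigenspace A a)%MS.

Lemma eigenspan_sup (P : pred R) A a m (W : 'M[R]_(m, n)) : (0 < m)%N ->
  P a -> W != 0 -> (W <= eigenspace A a)%MS -> (W <= eigenspan P A)%MS.
Proof.
move=> m0 Pa W0 WA; have eva : eigenvalue A a.
  by rewrite /eigenvalue; apply: contraNneq W0 => h; move: WA; rewrite h submx0.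
have : a \in rootsR (char_poly A).
  have p0 : char_poly A != 0 by rewrite monic_neq0// char_poly_monic.
  by rewrite -(roots_on_rootsR p0) in_itv/= -eigenvalue_root_char.
rewrite /eigenspan; elim: rootsR => // b s IH; rewrite inE big_cons.
case/orP => [/eqP <-|/IH h]; first by rewrite Pa (submx_trans WA)// addsmxSl.
by case: ifP => // _; rewrite (submx_trans h)// addsmxSr.
Qed.

Lemma eigenspan_ortho (P : pred R) A (v : 'rV[R]_n) b : A^T = A ->
  ~~ P b -> v *m A = b *: v -> eigenspan P A *m v^T = 0.
Proof.
move=> AT Pb vA; apply/sub_kermxP; rewrite /eigenspan.
elim: rootsR => [|a s IH]; first by rewrite big_nil sub0mx.
rewrite big_cons; case: ifP => // Pa; rewrite addsmx_sub IH andbT.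
apply/sub_kermxP; set E := eigenspace A a.
have EA : E *m A = a *: E by apply/eigenspaceP.
have : a *: (E *m v^T) = b *: (E *m v^T).
  have vAT : b *: v^T = A *m v^T by rewrite -[in RHS]AT -trmx_mul vA linearZ.
  by rewrite scalemxAl -EA scalemxAr vAT mulmxA.
move/eqP; rewrite -subr_eq0 -scalerBl scaler_eq0 subr_eq0 => /orP[/eqP ab|/eqP//].
by rewrite -ab Pa in Pb.
Qed.

Lemma ortho_cap0 U : (U :&: kermx U^T = 0)%MS.
Proof.
apply/eqP; rewrite -submx0; apply/row_subP => i.
set x := row i _.
have := row_sub i (U :&: kermx U^T)%MS; rewrite -/x sub_capmx => /andP[].
case/submxP => y xE /sub_kermxP xU.
rewrite submx0; apply/eqP/dotvv_eq0.
by rewrite /dotv {2}xE trmx_mul mulmxA xU mul0mx mxE.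
Qed.

(** In an orthonormal eigenbasis each basis vector lies either in the span or in
    its orthogonal complement. *)
Lemma ortho_projE (P : pred R) A Q d : Q *m Q^T = 1%:M ->
  A = Q^T *m diag_mx d *m Q ->
  ortho_proj (eigenspan P A) =
  Q^T *m diag_mx (\row_i (P (d ord0 i))%:R) *m Q.
Proof.
move=> QQ AE; have QQ' : Q^T *m Q = 1%:M by exact: mulmx1C.
have AT : A^T = A by rewrite AE !trmx_mul tr_diag_mx trmxK mulmxA.
have rQ i : row i Q *m A = d ord0 i *: row i Q.
  rewrite AE !mulmxA -row_mul QQ row1 -rowE.
  by rewrite row_diag_mx -scalemxAl -rowE.
rewrite -[LHS]mul1mx -QQ' -[LHS]mulmxA -[RHS]mulmxA; congr (_ *m _).
apply/row_matrixP => i; rewrite !row_mul row_diag_mx -scalemxAl -rowE mxE.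
have ri0 : row i Q != 0.
  apply/eqP => ri; have : (row i Q *m (row i Q)^T) ord0 ord0 = 0.
    by rewrite ri mul0mx mxE.
  move/eqP.
  have -> : (row i Q *m (row i Q)^T) ord0 ord0 = (Q *m Q^T) i i.
    by rewrite !mxE; apply: eq_bigr => k _; rewrite !mxE.
  by rewrite QQ mxE eqxx oner_eq0.
rewrite /ortho_proj; have [Pi|Pi] := boolP (P (d ord0 i)).
  rewrite scale1r proj_mx_id//; first exact: ortho_cap0.
  by apply: (@eigenspan_sup _ _ (d ord0 i)) => //; apply/eigenspaceP.
rewrite scale0r proj_mx_0//; first exact: ortho_cap0.
apply/sub_kermxP; rewrite -[LHS]trmxK trmx_mul trmxK.
by rewrite (eigenspan_ortho AT Pi (rQ i)) trmx0.
Qed.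

(** The function sign applied to A in the sense of the functional calculus. The
    step of the algorithm multiplies the Newton direction by this matrix. *)
Definition sgnmx A : 'M[R]_n := pr_pos A - pr_neg A.

Lemma sgnmxE A Q d : Q *m Q^T = 1%:M -> A = Q^T *m diag_mx d *m Q ->
  sgnmx A = Q^T *m diag_mx (\row_i Num.sg (d ord0 i)) *m Q.
Proof.
move=> QQ AE; rewrite /sgnmx /pr_pos /pr_neg.
rewrite (ortho_projE (fun a => 0 < a) QQ AE) (ortho_projE (fun a => a < 0) QQ AE).
rewrite -mulmxBl -mulmxBr -raddfB /=; congr (_ *m diag_mx _ *m _).
apply/rowP => i; rewrite !mxE.
by case: sgrP => h; rewrite ?h ?(lt_gtF h) ?ltxx ?subr0 ?sub0r.
Qed.

Lemma diag_conj_mul Q d1 d2 : Q *m Q^T = 1%:M ->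
  (Q^T *m diag_mx d1 *m Q) *m (Q^T *m diag_mx d2 *m Q) =
  Q^T *m diag_mx (\row_i (d1 ord0 i * d2 ord0 i)) *m Q.
Proof.
move=> QQ; rewrite -!mulmxA (mulmxA Q) QQ mul1mx (mulmxA (diag_mx d1)).
congr (_ *m (_ *m _)).
by rewrite mulmx_diag.
Qed.

Lemma diag_conj_unit Q d : Q *m Q^T = 1%:M ->
  Q^T *m diag_mx d *m Q \in unitmx -> forall i, d ord0 i != 0.
Proof.
move=> QQ; rewrite !unitmx_mul => /andP[/andP[_ +] _] i.
rewrite unitmxE det_diag unitfE => /prodf_neq0; exact.
Qed.

Lemma sgnmx_tr A : A^T = A -> (sgnmx A)^T = sgnmx A.
Proof.
move=> /spectral[Q [d [QQ AE]]]; rewrite (sgnmxE QQ AE).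
by rewrite !trmx_mul tr_diag_mx trmxK mulmxA.
Qed.

Lemma sgnmx_comm A : A^T = A -> sgnmx A *m A = A *m sgnmx A.
Proof.
move=> /spectral[Q [d [QQ AE]]]; rewrite (sgnmxE QQ AE) AE !diag_conj_mul//.
congr (_ *m diag_mx _ *m _); apply/rowP => i; by rewrite !mxE mulrC.
Qed.

Lemma sgnmx_sq A : A^T = A -> A \in unitmx -> sgnmx A *m sgnmx A = 1%:M.
Proof.
move=> /spectral[Q [d [QQ AE]]]; rewrite (sgnmxE QQ AE) AE => Au.
rewrite diag_conj_mul// -[RHS](mulmx1C QQ) -[in RHS](mulmx1 Q^T).
congr (_ *m _ *m _); rewrite -diag_const_mx; congr diag_mx.
apply/rowP => i; rewrite !mxE -expr2 sqr_sg.
by rewrite (diag_conj_unit QQ Au).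
Qed.

(** The product is the absolute value of A. *)
Lemma sgnmx_psd A (x : 'rV[R]_n) : A^T = A -> 0 <= dotv (x *m (sgnmx A *m A)) x.
Proof.
move=> /spectral[Q [d [QQ AE]]]; rewrite (sgnmxE QQ AE) AE.
rewrite diag_conj_mul// !mulmxA dotv_mulmxl; set y := x *m Q^T.
rewrite dotvE sumr_ge0// => i _; rewrite mul_mx_diag mxE [X in _ * X * _]mxE mulrAC -expr2.
by rewrite mulr_ge0 ?sqr_ge0// ?mxE -normrEsg.
Qed.

End SignMatrix.

(** * Asymptotics of matrix-valued functions *)

Section Asymptotics.
Context {R : realType} {T : Type} {F : set_system T} {FF : Filter F}.
Implicit Types (inc : T -> R).

Lemma mulmx_norm_le m n p (A : 'M[R]_(m, n)) (B : 'M[R]_(n, p)) :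
  `|A *m B| <= n%:R * `|A| * `|B|.
Proof.
apply: mx_norm_le => [|i j]; first by rewrite !mulr_ge0.
rewrite mxE (le_trans (ler_norm_sum _ _ _))//.
rewrite (@le_trans _ _ (\sum_(k < n) `|A| * `|B|))//.
  by apply: ler_sum => k _; rewrite normrM ler_pM// mx_entry_le.
by rewrite sumr_const card_ord -mulrA mulr_natl.
Qed.

(** Matrices of all shapes occur below, compared with one real gauge inc: the
    relations X = o(inc) and X = O(inc) along F, with the gauge 1 written one_.
    In particular lilo one_ X says that X tends to 0. *)
Definition lilo inc m n (X : T -> 'M[R]_(m, n)) :=
  forall e : R, 0 < e -> \forall t \near F, `|X t| <= e * inc t.

Definition bigo inc m n (X : T -> 'M[R]_(m, n)) :=
  exists2 C : R, 0 < C & \forall t \near F, `|X t| <= C * inc t.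

Definition one_ : T -> R := fun=> 1.

Lemma near_lilo inc m n (X Y : T -> 'M[R]_(m, n)) :
  (\forall t \near F, X t = Y t) -> lilo inc X -> lilo inc Y.
Proof.
move=> XY + e e0 => /(_ e e0) Xe.
by near=> t; rewrite -(near XY t)//; near: t.
Unshelve. all: by end_near. Qed.

Lemma liloD inc m n (X Y : T -> 'M[R]_(m, n)) :
  lilo inc X -> lilo inc Y -> lilo inc (fun t => X t + Y t).
Proof.
move=> Xo Yo e e0; have e2 : 0 < e / 2 by rewrite divr_gt0.
near=> t; rewrite (le_trans (ler_normD _ _))//.
have -> : e * inc t = e / 2 * inc t + e / 2 * inc t by rewrite -mulrDl -splitr.
by apply: lerD; near: t; [exact: Xo | exact: Yo].
Unshelve. all: by end_near. Qed.

Lemma liloN inc m n (X : T -> 'M[R]_(m, n)) :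
  lilo inc X -> lilo inc (fun t => - X t).
Proof. by move=> Xo e e0; under eq_near do rewrite normrN; exact: Xo. Qed.

Lemma liloB inc m n (X Y : T -> 'M[R]_(m, n)) :
  lilo inc X -> lilo inc Y -> lilo inc (fun t => X t - Y t).
Proof. by move=> Xo Yo; apply: liloD => //; exact: liloN. Qed.

Lemma bigoD inc m n (X Y : T -> 'M[R]_(m, n)) :
  bigo inc X -> bigo inc Y -> bigo inc (fun t => X t + Y t).
Proof.
move=> [C C0 XC] [D D0 YD]; exists (C + D); first exact: addr_gt0.
near=> t; rewrite (le_trans (ler_normD _ _))// mulrDl.
by apply: lerD; near: t.
Unshelve. all: by end_near. Qed.

Lemma bigoN inc m n (X : T -> 'M[R]_(m, n)) :
  bigo inc X -> bigo inc (fun t => - X t).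
Proof.
by move=> [C C0 XC]; exists C => //; under eq_near do rewrite normrN.
Qed.

Lemma lilo_bigo inc m n (X : T -> 'M[R]_(m, n)) : lilo inc X -> bigo inc X.
Proof. by move=> Xo; exists 1 => //; exact: Xo. Qed.

Lemma bigo_cst m n (A : 'M[R]_(m, n)) : bigo one_ (fun=> A).
Proof.
exists (`|A| + 1); first by rewrite ltr_wpDl.
by near=> t; rewrite mulr1 lerDl.
Unshelve. all: by end_near. Qed.

Lemma vanish_bounded m n (X : T -> 'M[R]_(m, n)) (A : 'M[R]_(m, n)) :
  lilo one_ (fun t => X t - A) -> bigo one_ X.
Proof.
move=> /lilo_bigo h; have := bigoD h (bigo_cst A).
by congr bigo; apply/funext => t; rewrite subrK.
Qed.

Lemma lilo_mulmxr i1 i2 m n p (X : T -> 'M[R]_(m, n)) (Y : T -> 'M[R]_(n, p)) :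
  (forall t, 0 <= i1 t) -> bigo i1 X -> lilo i2 Y ->
  lilo (fun t => i1 t * i2 t) (fun t => X t *m Y t).
Proof.
move=> i10 [C C0 XC] Yo e e0.
have D0 : 0 < n%:R * C + 1 :> R by rewrite ltr_wpDl// mulr_ge0// ltW.
have e'0 : 0 < e / (n%:R * C + 1) by rewrite divr_gt0.
near=> t.
have hX : `|X t| <= C * i1 t by near: t.
have hY : `|Y t| <= e / (n%:R * C + 1) * i2 t by near: t; exact: Yo.
rewrite (le_trans (mulmx_norm_le _ _))// -mulrA.
rewrite (@le_trans _ _ (n%:R * (C * i1 t * (e / (n%:R * C + 1) * i2 t))))//.
  by rewrite ler_wpM2l// ler_pM.
have Y0 : 0 <= e / (n%:R * C + 1) * i2 t by rewrite (le_trans _ hY).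
have i20 : 0 <= i2 t by move: Y0; rewrite pmulr_rge0.
rewrite [leLHS](_ : _ = (n%:R * C) * (e / (n%:R * C + 1)) * (i1 t * i2 t)); last ring.
rewrite ler_wpM2r//; first by rewrite mulr_ge0.
rewrite mulrCA ger_pMr// ler_pdivrMr// mul1r; lra.
Unshelve. all: by end_near. Qed.

Lemma lilo_mulmxl i1 i2 m n p (X : T -> 'M[R]_(m, n)) (Y : T -> 'M[R]_(n, p)) :
  (forall t, 0 <= i2 t) -> lilo i1 X -> bigo i2 Y ->
  lilo (fun t => i1 t * i2 t) (fun t => X t *m Y t).
Proof.
move=> i20 Xo [C C0 YC] e e0.
have D0 : 0 < n%:R * C + 1 :> R by rewrite ltr_wpDl// mulr_ge0// ltW.
have e'0 : 0 < e / (n%:R * C + 1) by rewrite divr_gt0.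
near=> t.
have hY : `|Y t| <= C * i2 t by near: t.
have hX : `|X t| <= e / (n%:R * C + 1) * i1 t by near: t; exact: Xo.
rewrite (le_trans (mulmx_norm_le _ _))// -mulrA.
rewrite (@le_trans _ _ (n%:R * (e / (n%:R * C + 1) * i1 t * (C * i2 t))))//.
  by rewrite ler_wpM2l// ler_pM.
have X0 : 0 <= e / (n%:R * C + 1) * i1 t by rewrite (le_trans _ hX).
have i10 : 0 <= i1 t by move: X0; rewrite pmulr_rge0.
rewrite [leLHS](_ : _ = (n%:R * C) * (e / (n%:R * C + 1)) * (i1 t * i2 t)); last ring.
rewrite ler_wpM2r//; first by rewrite mulr_ge0.
rewrite mulrCA ger_pMr// ler_pdivrMr// mul1r; lra.
Unshelve. all: by end_near. Qed.

Lemma bigo_mulmx i1 i2 m n p (X : T -> 'M[R]_(m, n)) (Y : T -> 'M[R]_(n, p)) :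
  bigo i1 X -> bigo i2 Y ->
  bigo (fun t => i1 t * i2 t) (fun t => X t *m Y t).
Proof.
move=> [C C0 XC] [D D0 YD].
exists (n%:R * C * D + 1); first by rewrite ltr_wpDl// !mulr_ge0// ltW.
near=> t.
have hX : `|X t| <= C * i1 t by near: t.
have hY : `|Y t| <= D * i2 t by near: t.
rewrite (le_trans (mulmx_norm_le _ _))// -mulrA.
rewrite (@le_trans _ _ (n%:R * (C * i1 t * (D * i2 t))))//.
  by rewrite ler_wpM2l// ler_pM.
have i10 : 0 <= i1 t.
  by have := le_trans (normr_ge0 _) hX; rewrite pmulr_rge0.
have i20 : 0 <= i2 t.
  by have := le_trans (normr_ge0 _) hY; rewrite pmulr_rge0.
rewrite mulrDl mul1r -[leLHS]addr0 lerD ?mulr_ge0//.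
by rewrite le_eqVlt; apply/orP; left; apply/eqP; ring.
Unshelve. all: by end_near. Qed.

Lemma one_mul inc : (fun t => one_ t * inc t) = inc.
Proof. by apply/funext => t; rewrite mul1r. Qed.

Lemma mul_one inc : (fun t => inc t * one_ t) = inc.
Proof. by apply/funext => t; rewrite mulr1. Qed.

(** Products in which one factor is measured against 1 and the other against
    inc. *)
Lemma bounded_lilo inc m n p (X : T -> 'M[R]_(m, n)) (Y : T -> 'M[R]_(n, p)) :
  bigo one_ X -> lilo inc Y -> lilo inc (fun t => X t *m Y t).
Proof. by move=> hX hY; rewrite -(one_mul inc); exact: lilo_mulmxr. Qed.

Lemma lilo_bounded inc m n p (X : T -> 'M[R]_(m, n)) (Y : T -> 'M[R]_(n, p)) :
  lilo inc X -> bigo one_ Y -> lilo inc (fun t => X t *m Y t).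
Proof. by move=> hX hY; rewrite -(mul_one inc); exact: lilo_mulmxl. Qed.

Lemma vanish_bigo inc m n p (X : T -> 'M[R]_(m, n)) (Y : T -> 'M[R]_(n, p)) :
  (forall t, 0 <= inc t) ->
  lilo one_ X -> bigo inc Y -> lilo inc (fun t => X t *m Y t).
Proof. by move=> i0 hX hY; rewrite -(one_mul inc); exact: lilo_mulmxl. Qed.

Lemma bigo_vanish inc m n p (X : T -> 'M[R]_(m, n)) (Y : T -> 'M[R]_(n, p)) :
  (forall t, 0 <= inc t) ->
  bigo inc X -> lilo one_ Y -> lilo inc (fun t => X t *m Y t).
Proof. by move=> i0 hX hY; rewrite -(mul_one inc); exact: lilo_mulmxr. Qed.

Lemma bigo_bounded inc m n p (X : T -> 'M[R]_(m, n)) (Y : T -> 'M[R]_(n, p)) :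
  bigo inc X -> bigo one_ Y -> bigo inc (fun t => X t *m Y t).
Proof. by move=> hX hY; rewrite -(mul_one inc); exact: bigo_mulmx. Qed.

Lemma bounded_bigo inc m n p (X : T -> 'M[R]_(m, n)) (Y : T -> 'M[R]_(n, p)) :
  bigo one_ X -> bigo inc Y -> bigo inc (fun t => X t *m Y t).
Proof. by move=> hX hY; rewrite -(one_mul inc); exact: bigo_mulmx. Qed.

Lemma lilo_le inc m n p q (X : T -> 'M[R]_(m, n)) (Y : T -> 'M[R]_(p, q)) K :
  0 <= K -> (\forall t \near F, `|Y t| <= K * `|X t|) -> lilo inc X -> lilo inc Y.
Proof.
move=> K0 YX Xo e e0; have K1 : 0 < K + 1 by rewrite ltr_wpDl.
have e'0 : 0 < e / (K + 1) by rewrite divr_gt0.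
near=> t; have hX : `|X t| <= e / (K + 1) * inc t by near: t; exact: Xo.
have hY : `|Y t| <= K * `|X t| by near: t.
rewrite (le_trans hY)// (@le_trans _ _ ((K + 1) * `|X t|))//.
  by rewrite ler_wpM2r// lerDl.
by rewrite -ler_pdivlMl// mulrA (mulrC _ e).
Unshelve. all: by end_near. Qed.

Lemma bigo_le inc m n p q (X : T -> 'M[R]_(m, n)) (Y : T -> 'M[R]_(p, q)) K :
  0 <= K -> (\forall t \near F, `|Y t| <= K * `|X t|) -> bigo inc X -> bigo inc Y.
Proof.
move=> K0 YX [C C0 hX]; have K1 : 0 < K + 1 by rewrite ltr_wpDl.
exists ((K + 1) * C); first exact: mulr_gt0.
near=> t; have hY : `|Y t| <= K * `|X t| by near: t.
rewrite (le_trans hY)// (@le_trans _ _ ((K + 1) * `|X t|))//.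
  by rewrite ler_wpM2r// lerDl.
by rewrite -mulrA ler_pM2l//; near: t.
Unshelve. all: by end_near. Qed.

Lemma hadamard_le m n (X c : 'M[R]_(m, n)) :
  `|\matrix_(i, j) (X i j * c i j)| <= `|c| * `|X|.
Proof.
apply: mx_norm_le => [|i j]; first exact: mulr_ge0.
by rewrite mxE normrM mulrC ler_pM// mx_entry_le.
Qed.

(** A row x in the kernel of a satisfies x = x (D - a) D^-1, hence |x| <= |x| / 2
    when a is close to D. *)
Lemma near_unitmx n (a : T -> 'M[R]_n) (D : 'M[R]_n) : D \in unitmx ->
  lilo one_ (fun t => a t - D) -> \forall t \near F, a t \in unitmx.
Proof.
move=> Du aD.
pose K := n%:R * (n%:R * `|invmx D|) + 1.
have K0 : 0 < K by rewrite ltr_wpDl// !mulr_ge0.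
have e0 : 0 < (2 * K)^-1 by rewrite invr_gt0 mulr_gt0.
have := aD _ e0; apply: filterS => t; rewrite mulr1 => h.
rewrite -row_free_unit -kermx_eq0; apply/eqP/row_matrixP => i; rewrite row0.
set x := row i _.
have xa : x *m a t = 0.
  by apply/sub_kermxP; exact: row_sub.
have xE : x = - (x *m (a t - D) *m invmx D).
  by rewrite mulmxBr xa sub0r mulNmx opprK mulmxK.
have xle : `|x| <= `|x| / 2.
  rewrite {1}xE normrN (le_trans (mulmx_norm_le _ _))//.
  rewrite (@le_trans _ _ (n%:R * (n%:R * `|x| * (2 * K)^-1) * `|invmx D|))//.
    rewrite ler_wpM2r// ler_wpM2l// (le_trans (mulmx_norm_le _ _))//.
    by rewrite ler_wpM2l// mulr_ge0.
  rewrite [leLHS](_ : _ = `|x| * (n%:R * (n%:R * `|invmx D|) / (2 * K))); last ring.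
  rewrite ler_wpM2l// ler_pdivrMr ?mulr_gt0// mulKf//.
  rewrite /K; lra.
by apply/normr0_eq0/eqP; rewrite eq_le normr_ge0 andbT; lra.
Qed.

(** From a^-1 = D^-1 - a^-1 (a - D) D^-1 the inverse is first seen to be bounded,
    and then to converge. *)
Lemma vanish_invmx n (a : T -> 'M[R]_n) (D : 'M[R]_n) : D \in unitmx ->
  lilo one_ (fun t => a t - D) -> lilo one_ (fun t => invmx (a t) - invmx D).
Proof.
move=> Du aD.
have invE : \forall t \near F,
    invmx (a t) - invmx D = - (invmx (a t) *m ((a t - D) *m invmx D)).
  have := near_unitmx Du aD; apply: filterS => t au.
  by rewrite mulmxBl mulmxBr mulKmx// mulmxV// mulmx1 opprB.
have bnd : bigo one_ (fun t => invmx (a t)).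
  have : lilo one_ (fun t => (a t - D) *m invmx D).
    by apply: lilo_bounded => //; exact: bigo_cst.
  have e0 : 0 < (2 * (n%:R + 1))^-1 :> R.
    by rewrite invr_gt0 mulr_gt0// ltr_wpDl.
  move=> /(_ _ e0) h.
  exists (2 * `|invmx D| + 1); first by rewrite ltr_wpDl// mulr_ge0.
  near=> t.
  have hE : invmx (a t) = invmx D - (invmx (a t) *m ((a t - D) *m invmx D)).
    by rewrite -(near invE t)// addrC subrK.
  have : `|invmx (a t)| <= `|invmx D| + `|invmx (a t)| / 2.
    rewrite {1}hE (le_trans (ler_normB _ _))// lerD2l.
    rewrite (le_trans (mulmx_norm_le _ _))//.
    rewrite (@le_trans _ _ (n%:R * `|invmx (a t)| * (2 * (n%:R + 1))^-1))//.
      rewrite ler_wpM2l ?mulr_ge0//.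
      by rewrite -[leRHS]mulr1; near: t.
    rewrite -mulrA mulrCA ler_wpM2l// ler_pdivrMr ?mulr_gt0 ?ltr_wpDl//.
    by rewrite mulKf// lerDl.
  rewrite mulr1; lra.
apply: (near_lilo (X := fun t => - (invmx (a t) *m ((a t - D) *m invmx D)))).
  by apply: filterS invE => t ->.
apply: liloN; apply: (bounded_lilo bnd).
by apply: lilo_bounded; [exact: aD | exact: bigo_cst].
Unshelve. all: by end_near. Qed.

End Asymptotics.
Arguments lilo {R T} F inc {m n} X.
Arguments bigo {R T} F inc {m n} X.
Arguments one_ {R T} _ /.

(** * The derivative of the matrix sign *)

Section SignClose.
Context {R : realType} {n : nat}.
Variables (D Q : 'M[R]_n) (d : 'rV[R]_n).
Hypotheses (QQ : Q *m Q^T = 1%:M) (DE : D = Q^T *m diag_mx d *m Q)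
  (Du : D \in unitmx).

Let d0 i : d ord0 i != 0.
Proof. by move: Du; rewrite DE => /(diag_conj_unit QQ). Qed.

Let e i := Num.sg (d ord0 i).

Let ee i : e i * e i = 1.
Proof. by rewrite /e -expr2 sqr_sg d0. Qed.

Let rowQD i : row i Q *m D = d ord0 i *: row i Q.
Proof.
by rewrite DE !mulmxA -row_mul QQ row1 -rowE row_diag_mx -scalemxAl -rowE.
Qed.

Let rowQS i : row i Q *m sgnmx D = e i *: row i Q.
Proof.
rewrite (sgnmxE QQ DE) !mulmxA -row_mul QQ row1 -rowE row_diag_mx -scalemxAl.
by rewrite -rowE mxE.
Qed.

Lemma orthogonal_norm_le (P : 'M[R]_n) : P *m P^T = 1%:M -> `|P| <= 1.
Proof.
move=> PP; apply: mx_norm_le => // i j.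
rewrite -(@expr_le1 _ 2)//.
have <- : \sum_k P i k * P i k = 1.
  transitivity ((P *m P^T) i i); last by rewrite PP mxE eqxx.
  by rewrite mxE; apply: eq_bigr => k _; rewrite mxE.
rewrite (bigD1 j)//= real_normK ?num_real// expr2 lerDl.
by apply: sumr_ge0 => k _; rewrite -expr2 sqr_ge0.
Qed.

Lemma row_norm_le m p (A : 'M[R]_(m, p)) i : `|row i A| <= `|A|.
Proof. by apply: mx_norm_le => // k j; rewrite mxE mx_entry_le. Qed.

Lemma norm_sqr_le_dotv (u : 'rV[R]_n) : `|u| * `|u| <= dotv u u.
Proof.
rewrite -expr2 -(@sqr_sqrtr _ (dotv u u)) ?dotvv_ge0//.
rewrite ler_pXn2r ?nnegrE ?sqrtr_ge0//.
apply: mx_norm_le => [|i j]; first exact: sqrtr_ge0.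
rewrite (ord1 i) -(@ler_pXn2r _ 2) ?nnegrE ?sqrtr_ge0// sqr_sqrtr ?dotvv_ge0//.
rewrite dotvE (bigD1 j)//= real_normK ?num_real// expr2 lerDl.
by apply: sumr_ge0 => k _; rewrite -expr2 sqr_ge0.
Qed.

Lemma dotv_norm_le (u v : 'rV[R]_n) : `|dotv u v| <= n%:R * `|u| * `|v|.
Proof.
rewrite /dotv (le_trans (mx_entry_le _ _ _))// (le_trans (mulmx_norm_le _ _))//.
rewrite ler_wpM2l ?mulr_ge0//; apply: mx_norm_le => // i j.
by rewrite mxE mx_entry_le.
Qed.

(** For a unit eigenvector x of D with eigenvalue d of sign e, the vector
    u = x S_A - e x lies in the span of the eigenvectors of A of sign -e, so
    e <u A, u> <= 0, whereas <u A, u> equals d <u, u> up to A - D. *)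
Lemma sgnmx_row_close (A : 'M[R]_n) i : A^T = A -> A \in unitmx ->
  `|d ord0 i| * `|row i Q *m (sgnmx A - sgnmx D)| <=
  2 * (n%:R * n%:R) * `|A - D|.
Proof.
move=> AT Au; set x := row i Q; set u := x *m _.
have SS := sgnmx_sq AT Au; have ST := sgnmx_tr AT; have SA := sgnmx_comm AT.
set S := sgnmx A in SS ST SA u *.
have uE : u = x *m S - e i *: x by rewrite /u mulmxBr rowQS.
have uS : u *m S = - (e i *: u).
  rewrite uE mulmxBl -mulmxA SS mulmx1 -scalemxAl scalerBr scalerA ee scale1r.
  by rewrite opprB.
have neg : e i * dotv (u *m A) u <= 0.
  have -> : e i * dotv (u *m A) u = - dotv (u *m (S *m A)) u.
    by rewrite mulmxA uS mulNmx dotvNl opprK -scalemxAl dotvZl.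
  by rewrite oppr_le0 sgnmx_psd.
have uu : dotv u u = - (2 * e i) * dotv x u.
  have -> : dotv u u = dotv (x *m S) u - e i * dotv x u.
    by rewrite {1}uE dotvDl dotvNl dotvZl.
  rewrite dotv_mulmxl ST uS dotvNr dotvZr; ring.
have uAu : dotv (u *m A) u = - (2 * e i) * dotv (x *m A) u.
  have -> : dotv (u *m A) u = dotv (x *m A *m S) u - e i * dotv (x *m A) u.
    rewrite {1}uE mulmxBl dotvDl dotvNl -(mulmxA x S A) SA (mulmxA x A S).
    by rewrite -scalemxAl dotvZl.
  rewrite dotv_mulmxl ST uS dotvNr dotvZr; ring.
have xA : x *m A = d ord0 i *: x + x *m (A - D).
  by rewrite mulmxBr rowQD addrC subrK.
have main : `|d ord0 i| * dotv u u <= 2 * dotv (x *m (A - D)) u.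
  move: neg; rewrite uAu xA dotvDl dotvZl normrEsg -/(e i) => h.
  have : e i * d ord0 i * dotv u u =
     - (2 * (e i * e i)) * (d ord0 i * dotv x u) by rewrite uu; ring.
  have : e i * (- (2 * e i) * (d ord0 i * dotv x u + dotv (x *m (A - D)) u)) =
     - (2 * (e i * e i)) * (d ord0 i * dotv x u)
     - 2 * (e i * e i) * dotv (x *m (A - D)) u by ring.
  rewrite ee; lra.
have [->|u0] := eqVneq u 0; first by rewrite normr0 mulr0 !mulr_ge0.
have u_gt0 : 0 < `|u| by rewrite normr_gt0.
rewrite -(ler_pM2r u_gt0).
rewrite (@le_trans _ _ (`|d ord0 i| * dotv u u))//.
  by rewrite -mulrA ler_wpM2l// norm_sqr_le_dotv.
rewrite (le_trans main)// -!mulrA ler_pM2l//.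
rewrite (le_trans (ler_norm _))// (le_trans (dotv_norm_le _ _))// -!mulrA.
rewrite ler_wpM2l// !mulrA ler_wpM2r// (le_trans (mulmx_norm_le _ _))//.
rewrite ler_wpM2r// -[leRHS]mulr1 ler_wpM2l//.
by rewrite (le_trans (row_norm_le _ _))// orthogonal_norm_le.
Qed.

(** The rows of Q (S_A - S_D) are bounded one by one. *)
Lemma sgnmx_close : exists2 C : R, 0 < C &
  forall A : 'M[R]_n, A^T = A -> A \in unitmx ->
  `|sgnmx A - sgnmx D| <= C * `|A - D|.
Proof.
pose K i := 2 * (n%:R * n%:R) / `|d ord0 i|.
have K0 i : 0 <= K i by rewrite divr_ge0// !mulr_ge0.
exists (n%:R * (\sum_i K i) + 1).
  by rewrite ltr_wpDl// mulr_ge0// sumr_ge0.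
move=> A AT Au.
have -> : sgnmx A - sgnmx D = Q^T *m (Q *m (sgnmx A - sgnmx D)).
  by rewrite mulmxA (mulmx1C QQ) mul1mx.
rewrite (le_trans (mulmx_norm_le _ _))//.
have QT : `|Q^T| <= 1.
  by apply: orthogonal_norm_le; rewrite trmxK (mulmx1C QQ).
have : `|Q *m (sgnmx A - sgnmx D)| <= (\sum_i K i) * `|A - D|.
  apply: mx_norm_le => [|i j]; first by rewrite mulr_ge0// sumr_ge0.
  have -> : (Q *m (sgnmx A - sgnmx D)) i j =
            (row i Q *m (sgnmx A - sgnmx D)) ord0 j by rewrite -row_mul [RHS]mxE.
  rewrite (le_trans (mx_entry_le _ _ _))//.
  rewrite (@le_trans _ _ (K i * `|A - D|))//; last first.
    by rewrite ler_wpM2r// (bigD1 i)//= lerDl sumr_ge0.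
  rewrite /K mulrAC ler_pdivlMr ?normr_gt0// mulrC.
  exact: sgnmx_row_close.
move=> h; rewrite (@le_trans _ _ (n%:R * 1 * ((\sum_i K i) * `|A - D|)))//.
  by rewrite ler_pM ?mulr_ge0// ler_wpM2l.
by rewrite mulr1 mulrA mulrDl mul1r lerDl.
Qed.

End SignClose.

(** The identity S A = A S subtracted at two points: the increment of S commutes
    with D up to the increment of A and terms of second order. *)
Lemma commutation_increment (R : realType) n (s1 s2 a1 a2 S D : 'M[R]_n) :
  s1 *m a1 = a1 *m s1 -> s2 *m a2 = a2 *m s2 ->
  (s1 - s2) *m D - D *m (s1 - s2) =
  ((a1 - a2) *m S - S *m (a1 - a2)) +
  ((a1 - a2) *m (s2 - S) - (s2 - S) *m (a1 - a2) - (s1 - s2) *m (a1 - D)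
   + (a1 - D) *m (s1 - s2)).
Proof.
move=> c1 c2; rewrite !mulmxBl !mulmxBr c1 c2.
by apply/matrixP => i j; rewrite !mxE; ring.
Qed.

(** The identity S S = 1 subtracted at two points. *)
Lemma square_increment (R : realType) n (s1 s2 S : 'M[R]_n) :
  s1 *m s1 = s2 *m s2 ->
  (s1 - s2) *m S + S *m (s1 - s2) =
  - ((s1 - s2) *m (s1 - S)) - (s2 - S) *m (s1 - s2).
Proof.
move=> sq; rewrite !mulmxBl !mulmxBr sq.
by apply/matrixP => i j; rewrite !mxE; ring.
Qed.

Section SignDerivative.
Context {R : realType} {n : nat} {T : Type} {F : set_system T} {FF : Filter F}.
Variables (D Q : 'M[R]_n) (d : 'rV[R]_n).
Hypotheses (QQ : Q *m Q^T = 1%:M) (DE : D = Q^T *m diag_mx d *m Q)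
  (Du : D \in unitmx).

(** For equal eigenvalues this is 0 / 0 = 0, which is the derivative of sign away
    from 0. *)
Definition sgn_divdiff (dd : 'rV[R]_n) i j : R :=
  (Num.sg (dd ord0 j) - Num.sg (dd ord0 i)) / (dd ord0 j - dd ord0 i).

(** The Daleckii-Krein formula: in an eigenbasis the derivative of a function of
    a matrix multiplies entries by divided differences. *)
Definition dsgnmx (P : 'M[R]_n) (dd : 'rV[R]_n) (M : 'M[R]_n) : 'M[R]_n :=
  P^T *m (\matrix_(i, j) ((P *m M *m P^T) i j * sgn_divdiff dd i j)) *m P.

Lemma vanish_sgnmx (a : T -> 'M[R]_n) :
  (\forall t \near F, (a t)^T = a t) -> lilo F one_ (fun t => a t - D) ->
  lilo F one_ (fun t => sgnmx (a t) - sgnmx D).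
Proof.
move=> aT aD; have [C C0 hC] := sgnmx_close QQ DE Du.
move=> e e0; have au : \forall t \near F, a t \in unitmx by exact: near_unitmx Du aD.
have /aD h : 0 < e / C by rewrite divr_gt0.
near=> t.
rewrite mulr1 (le_trans (hC (a t) _ _))//; [by near: t | by near: t |].
rewrite mulrC -ler_pdivlMr//.
suff : `|a t - D| <= e / C * one_ t by rewrite mulr1.
by near: t.
Unshelve. all: by end_near. Qed.

Lemma dsgnmx_le : exists2 K : R, 0 <= K &
  forall M : 'M[R]_n, `|dsgnmx Q d M| <= K * `|M|.
Proof.
have hr (X B : 'M[R]_n) : `|X *m B| <= n%:R * `|B| * `|X|.
  by rewrite (le_trans (mulmx_norm_le _ _))// mulrAC.
pose C := \matrix_(i, j) sgn_divdiff d i j.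
exists (n%:R * `|Q| * (n%:R * `|Q^T| * (`|C| * (n%:R * `|Q^T| * (n%:R * `|Q|))))).
  by rewrite !mulr_ge0.
move=> M; rewrite /dsgnmx.
have -> : \matrix_(i, j) ((Q *m M *m Q^T) i j * sgn_divdiff d i j) =
  \matrix_(i, j) ((Q *m M *m Q^T) i j * C i j).
  by apply/matrixP => i j; rewrite !mxE.
rewrite (le_trans (hr _ _))// -[leRHS]mulrA ler_wpM2l ?mulr_ge0//.
rewrite (le_trans (mulmx_norm_le _ _))// -[leRHS]mulrA ler_wpM2l ?mulr_ge0//.
rewrite (le_trans (hadamard_le _ _))// -[leRHS]mulrA ler_wpM2l//.
rewrite (le_trans (hr _ _))// -[leRHS]mulrA ler_wpM2l ?mulr_ge0//.
exact: mulmx_norm_le.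
Qed.

Variables (inc : T -> R) (a1 a2 : T -> 'M[R]_n).
Hypotheses (inc0 : forall t, 0 <= inc t)
  (a1T : \forall t \near F, (a1 t)^T = a1 t)
  (a2T : \forall t \near F, (a2 t)^T = a2 t)
  (a1D : lilo F one_ (fun t => a1 t - D)) (a2D : lilo F one_ (fun t => a2 t - D))
  (a12 : bigo F inc (fun t => a1 t - a2 t)).

(** Subtract the identities S A = A S and S S = 1 at the two matrices: up to
    small terms, the increment of S solves a pair of linear equations that in
    an eigenbasis of D decouple entrywise. *)
Lemma sgnmx_diff :
  lilo F inc (fun t => sgnmx (a1 t) - sgnmx (a2 t) - dsgnmx Q d (a1 t - a2 t)).
Proof.
pose S := sgnmx D; pose s1 t := sgnmx (a1 t); pose s2 t := sgnmx (a2 t).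
pose Dl t := s1 t - s2 t; pose E t := a1 t - a2 t.
have s1S : lilo F one_ (fun t => s1 t - S) by exact: vanish_sgnmx.
have s2S : lilo F one_ (fun t => s2 t - S) by exact: vanish_sgnmx.
(* The increment of S is not yet known to be O(inc), so it is first added to
   the gauge. *)
pose inc2 t := inc t + `|Dl t|.
have inc20 t : 0 <= inc2 t by rewrite addr_ge0.
have E2 : bigo F inc2 E.
  case: a12 => C C0 hC; exists C => //; apply: filterS hC => t h.
  by rewrite (le_trans h)// ler_pM2l// lerDl.
have Dl2 : bigo F inc2 Dl.
  by exists 1 => //; near=> t; rewrite mul1r lerDr.
pose r t := E t *m (s2 t - S) - (s2 t - S) *m E t - Dl t *m (a1 t - D)
  + (a1 t - D) *m Dl t.
pose q t := - (Dl t *m (s1 t - S)) - (s2 t - S) *m Dl t.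
have ro : lilo F inc2 r.
  apply: liloD; last exact: vanish_bigo.
  apply: liloB; last exact: bigo_vanish.
  by apply: liloB; [exact: bigo_vanish | exact: vanish_bigo].
have qo : lilo F inc2 q.
  by apply: liloB; [apply: liloN; exact: bigo_vanish | exact: vanish_bigo].
have a1u : \forall t \near F, a1 t \in unitmx by exact: near_unitmx Du a1D.
have a2u : \forall t \near F, a2 t \in unitmx by exact: near_unitmx Du a2D.
have sg i : Num.sg (d ord0 i) * Num.sg (d ord0 i) = 1.
  by rewrite -expr2 sqr_sg (diag_conj_unit QQ)// -DE.
(* The equation from commutation determines the entries of Dl at pairs of
   eigenvalues of opposite signs, the one from squares the other entries. *)
pose k : 'M[R]_n := \matrix_(i, j)
  if Num.sg (d ord0 i) == Num.sg (d ord0 j) then 0 else (d ord0 j - d ord0 i)^-1.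
pose l : 'M[R]_n := \matrix_(i, j)
  if Num.sg (d ord0 i) == Num.sg (d ord0 j) then Num.sg (d ord0 j) / 2 else 0.
pose cj (X : 'M[R]_n) := Q *m X *m Q^T.
pose z t := Q^T *m (\matrix_(i, j) (cj (r t) i j * k i j) +
                    \matrix_(i, j) (cj (q t) i j * l i j)) *m Q.
have zE : \forall t \near F, z t = Dl t - dsgnmx Q d (E t).
  near=> t.
  have A1T : (a1 t)^T = a1 t by near: t.
  have A2T : (a2 t)^T = a2 t by near: t.
  have c1 : s1 t *m a1 t = a1 t *m s1 t by exact: sgnmx_comm.
  have c2 : s2 t *m a2 t = a2 t *m s2 t by exact: sgnmx_comm.
  have sq1 : s1 t *m s1 t = 1%:M by apply: sgnmx_sq => //; near: t.
  have sq2 : s2 t *m s2 t = 1%:M by apply: sgnmx_sq => //; near: t.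
  have e1 : Dl t *m D - D *m Dl t = (E t *m S - S *m E t) + r t.
    exact: commutation_increment.
  have e2 : Dl t *m S + S *m Dl t = q t.
    by apply: square_increment; rewrite sq1 sq2.
  have QQ' := mulmx1C QQ.
  have cjr X (dd : 'rV[R]_n) i j :
      cj (X *m (Q^T *m diag_mx dd *m Q)) i j = cj X i j * dd ord0 j.
    rewrite /cj -!mulmxA QQ mulmx1 !mulmxA mul_mx_diag mxE; congr (_ * _).
  have cjl X (dd : 'rV[R]_n) i j :
      cj ((Q^T *m diag_mx dd *m Q) *m X) i j = dd ord0 i * cj X i j.
    by rewrite /cj !mulmxA QQ mul1mx -!mulmxA mul_diag_mx mxE.
  have cjD X Y i j : cj (X + Y) i j = cj X i j + cj Y i j.
    by rewrite /cj mulmxDr mulmxDl mxE.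
  have cjB X Y i j : cj (X - Y) i j = cj X i j - cj Y i j.
    by rewrite /cj mulmxBr mulmxBl !mxE.
  have SE := sgnmxE QQ DE.
  have f1 i j : cj (Dl t) i j * (d ord0 j - d ord0 i) =
      cj (E t) i j * (Num.sg (d ord0 j) - Num.sg (d ord0 i)) + cj (r t) i j.
    have : cj (Dl t *m D - D *m Dl t) i j = cj ((E t *m S - S *m E t) + r t) i j.
      by rewrite e1.
    rewrite cjB cjD cjB /S SE DE !cjr !cjl !mxE => h; rewrite mulrBr mulrBr.
    by rewrite (mulrC _ (d ord0 i)) h (mulrC _ (Num.sg (d ord0 i))).
  have f2 i j : cj (Dl t) i j * (Num.sg (d ord0 j) + Num.sg (d ord0 i)) = cj (q t) i j.
    by rewrite -e2 (cjD (Dl t *m S)) /S SE !cjr !cjl !mxE mulrDr (mulrC _ (Num.sg (d ord0 i))).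
  suff -> : z t = Q^T *m (cj (Dl t) - \matrix_(i, j) (cj (E t) i j * sgn_divdiff d i j)) *m Q.
    rewrite mulmxBr mulmxBl; congr (_ - _).
    by rewrite /cj !mulmxA QQ' mul1mx -mulmxA QQ' mulmx1.
  rewrite /z; congr (_ *m _ *m _); apply/matrixP => i j.
  transitivity (cj (r t) i j * k i j + cj (q t) i j * l i j).
    by rewrite mxE; congr (_ + _); rewrite mxE.
  transitivity (cj (Dl t) i j - cj (E t) i j * sgn_divdiff d i j); last first.
    by rewrite [RHS]mxE; congr (_ + _); rewrite [RHS]mxE; congr (- _); rewrite [RHS]mxE.
  have -> : k i j = if Num.sg (d ord0 i) == Num.sg (d ord0 j) then 0
    else (d ord0 j - d ord0 i)^-1 by rewrite mxE.
  have -> : l i j = if Num.sg (d ord0 i) == Num.sg (d ord0 j)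
    then Num.sg (d ord0 j) / 2 else 0 by rewrite mxE.
  rewrite /sgn_divdiff.
  have := f1 i j; have := f2 i j.
  set x := cj (Dl t) i j; set y := cj (E t) i j.
  case: eqP => [ij <- _|ij _ h].
    rewrite ij subrr mul0r !mulr0 subr0 add0r.
    have -> : x * (Num.sg (d ord0 j) + Num.sg (d ord0 j)) * (Num.sg (d ord0 j) / 2) =
      x * (Num.sg (d ord0 j) * Num.sg (d ord0 j)) by field.
    by rewrite sg mulr1.
  have dij : d ord0 j - d ord0 i != 0.
    by rewrite subr_eq0; apply/eqP => dd; apply: ij; rewrite dd.
  rewrite mulr0 addr0; apply: (mulIf dij).
  rewrite mulrBl h [y * (_ / _)]mulrA !divfK//; ring.
have zo : lilo F inc2 z.
  apply: lilo_bounded; last exact: bigo_cst.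
  apply: bounded_lilo; first exact: bigo_cst.
  have cjo (X : T -> 'M[R]_n) : lilo F inc2 X -> lilo F inc2 (fun t => cj (X t)).
    move=> h; apply: lilo_bounded; last exact: bigo_cst.
    by apply: bounded_lilo => //; exact: bigo_cst.
  apply: liloD.
    apply: (lilo_le (X := fun t => cj (r t)) (K := `|k|)) => //; last exact: cjo.
    by near=> t; exact: hadamard_le.
  apply: (lilo_le (X := fun t => cj (q t)) (K := `|l|)) => //; last exact: cjo.
  by near=> t; exact: hadamard_le.
have zo2 : lilo F inc2 (fun t => Dl t - dsgnmx Q d (E t)) by exact: near_lilo zo.
have dE : bigo F inc (fun t => dsgnmx Q d (E t)).
  have [K K0 hK] := dsgnmx_le.
  by apply: (bigo_le K0 _ a12); near=> t; exact: hK.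
(* With the constant 1 / 2 the part of the gauge that was added is absorbed. *)
have DlO : exists2 C : R, 0 < C & \forall t \near F, inc2 t <= C * inc t.
  case: dE => C C0 hC; exists (2 * C + 2); first by rewrite addr_gt0// mulr_gt0.
  have := zo2 (1 / 2) ltac:(by rewrite divr_gt0) => hz; near=> t.
  have h1 : `|Dl t - dsgnmx Q d (E t)| <= 1 / 2 * inc2 t by near: t.
  have h2 : `|dsgnmx Q d (E t)| <= C * inc t by near: t.
  have : `|Dl t| <= `|Dl t - dsgnmx Q d (E t)| + `|dsgnmx Q d (E t)|.
    by rewrite -{1}(subrK (dsgnmx Q d (E t)) (Dl t)) ler_normD.
  rewrite /inc2 in h1 *; lra.
case: DlO => C C0 hC e e0.
have /zo2 h : 0 < e / C by rewrite divr_gt0.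
near=> t; have h1 : `|Dl t - dsgnmx Q d (E t)| <= e / C * inc2 t by near: t.
rewrite (le_trans h1)// -mulrA ler_pM2l// ler_pdivrMl//.
by near: t.
Unshelve. all: by end_near. Qed.

End SignDerivative.

(** * The derivative of the modified Newton direction *)

Section StepDerivative.
Context {R : realType} {T : Type} {F : set_system T} {FF : Filter F}.

Lemma lilo_prodl inc m n p (X X' : T -> 'M[R]_(m, n)) (Y : T -> 'M[R]_(n, p)) Y0 :
  (forall t, 0 <= inc t) -> lilo F inc (fun t => X t - X' t) -> bigo F inc X' ->
  lilo F one_ (fun t => Y t - Y0) -> lilo F inc (fun t => X t *m Y t - X' t *m Y0).
Proof.
move=> i0 XX' X'O YY0.
apply: (near_lilo (X := fun t => (X t - X' t) *m Y t + X' t *m (Y t - Y0))).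
  by near=> t; rewrite mulmxBl mulmxBr addrA subrK.
apply: liloD; last exact: bigo_vanish.
by apply: lilo_bounded => //; exact: vanish_bounded YY0.
Unshelve. all: by end_near. Qed.

Lemma lilo_prodr inc m n p (Y : T -> 'M[R]_(m, n)) Y0 (X X' : T -> 'M[R]_(n, p)) :
  (forall t, 0 <= inc t) -> lilo F inc (fun t => X t - X' t) -> bigo F inc X' ->
  lilo F one_ (fun t => Y t - Y0) -> lilo F inc (fun t => Y t *m X t - Y0 *m X' t).
Proof.
move=> i0 XX' X'O YY0.
apply: (near_lilo (X := fun t => Y t *m (X t - X' t) + (Y t - Y0) *m X' t)).
  by near=> t; rewrite mulmxBl mulmxBr addrA subrK.
apply: liloD; last exact: vanish_bigo.
by apply: bounded_lilo => //; exact: vanish_bounded YY0.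
Unshelve. all: by end_near. Qed.

Lemma vanish_prod m n p (X : T -> 'M[R]_(m, n)) X0 (Y : T -> 'M[R]_(n, p)) Y0 :
  lilo F one_ (fun t => X t - X0) -> lilo F one_ (fun t => Y t - Y0) ->
  lilo F one_ (fun t => X t *m Y t - X0 *m Y0).
Proof.
by move=> XX YY; apply: (lilo_prodl (X' := fun=> X0)) => //; exact: bigo_cst.
Qed.

Lemma lilo_congr_bigo inc m n (X X' : T -> 'M[R]_(m, n)) :
  lilo F inc (fun t => X t - X' t) -> bigo F inc X' -> bigo F inc X.
Proof.
move=> XX' X'O; rewrite (_ : X = fun t => X t - X' t + X' t).
  exact: bigoD (lilo_bigo XX') X'O.
by apply/funext => t; rewrite subrK.
Qed.

Context {n : nat}.
Variables (D Q : 'M[R]_n) (d : 'rV[R]_n).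
Hypotheses (QQ : Q *m Q^T = 1%:M) (DE : D = Q^T *m diag_mx d *m Q)
  (Du : D \in unitmx).

Definition nqn_dir (g : 'rV[R]_n) (A : 'M[R]_n) : 'rV[R]_n :=
  g *m invmx A *m sgnmx A.

(** The derivative of nqn_dir at (g0, A) in the direction (G, M), by the product
    rule; P and dd diagonalise A. *)
Definition dnqn_dir (P : 'M[R]_n) (dd g0 : 'rV[R]_n) (A : 'M[R]_n)
    (G : 'rV[R]_n) (M : 'M[R]_n) : 'rV[R]_n :=
  G *m invmx A *m sgnmx A - g0 *m (invmx A *m M *m invmx A) *m sgnmx A
  + g0 *m invmx A *m dsgnmx P dd M.

Lemma dsgnmxB (P : 'M[R]_n) dd (M N : 'M[R]_n) :
  dsgnmx P dd (M - N) = dsgnmx P dd M - dsgnmx P dd N.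
Proof.
rewrite /dsgnmx -mulmxBl -mulmxBr; congr (_ *m _ *m _).
rewrite mulmxBr mulmxBl; set X := P *m M *m _; set Y := P *m N *m _.
by apply/matrixP => i j; rewrite !mxE; ring.
Qed.

Variables (inc : T -> R) (a1 a2 M : T -> 'M[R]_n) (g1 g2 G : T -> 'rV[R]_n)
  (g0 : 'rV[R]_n).
Hypotheses (inc0 : forall t, 0 <= inc t)
  (a1T : \forall t \near F, (a1 t)^T = a1 t)
  (a2T : \forall t \near F, (a2 t)^T = a2 t)
  (a1D : lilo F one_ (fun t => a1 t - D)) (a2D : lilo F one_ (fun t => a2 t - D))
  (a12 : lilo F inc (fun t => a1 t - a2 t - M t)) (MO : bigo F inc M)
  (g2g : lilo F one_ (fun t => g2 t - g0))
  (g12 : lilo F inc (fun t => g1 t - g2 t - G t)) (GO : bigo F inc G).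

(** The product rule, for increments between two points that both tend to the
    base point: strict differentiability. *)
Lemma nqn_dir_diff : lilo F inc (fun t =>
  nqn_dir (g1 t) (a1 t) - nqn_dir (g2 t) (a2 t) - dnqn_dir Q d g0 D (G t) (M t)).
Proof.
have a1u : \forall t \near F, a1 t \in unitmx by exact: near_unitmx Du a1D.
have a2u : \forall t \near F, a2 t \in unitmx by exact: near_unitmx Du a2D.
pose b1 t := invmx (a1 t); pose b2 t := invmx (a2 t).
pose s1 t := sgnmx (a1 t); pose s2 t := sgnmx (a2 t).
have b1D : lilo F one_ (fun t => b1 t - invmx D) by exact: vanish_invmx.
have b2D : lilo F one_ (fun t => b2 t - invmx D) by exact: vanish_invmx.
have s1D : lilo F one_ (fun t => s1 t - sgnmx D) by exact: (vanish_sgnmx QQ DE Du).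
have a12O : bigo F inc (fun t => a1 t - a2 t) by exact: lilo_congr_bigo MO.
have [K K0 hK] := dsgnmx_le Q d.
have dMO : bigo F inc (fun t => dsgnmx Q d (M t)).
  by apply: (bigo_le K0 _ MO); near=> t; exact: hK.
have s12 : lilo F inc (fun t => s1 t - s2 t - dsgnmx Q d (M t)).
  have h1 := sgnmx_diff (FF := FF) QQ DE Du inc0 a1T a2T a1D a2D a12O.
  have h2 : lilo F inc (fun t => dsgnmx Q d (a1 t - a2 t - M t)).
    by apply: (lilo_le K0 _ a12); near=> t; exact: hK.
  refine (near_lilo _ (liloD h1 h2)); near=> t.
  by rewrite /= (dsgnmxB _ _ (a1 t - a2 t)) addrA subrK.
have b12 : lilo F inc (fun t => b1 t - b2 t - (- (invmx D *m M t *m invmx D))).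
  apply: (near_lilo (X := fun t => - (b1 t *m (a1 t - a2 t) *m b2 t
      - invmx D *m M t *m invmx D))).
    near=> t.
    have u1 : a1 t \in unitmx by near: t.
    have u2 : a2 t \in unitmx by near: t.
    rewrite opprB opprK addrC; congr (_ + _).
    by rewrite mulmxBr mulmxBl mulVmx// mul1mx mulmxK// opprB.
  apply: liloN; apply: lilo_prodl => //; last first.
    by apply: bounded_bigo => //; exact: bigo_cst.
  exact: lilo_prodr.
have b12O : bigo F inc (fun t => - (invmx D *m M t *m invmx D)).
  apply: bigoN; apply: bigo_bounded; last exact: bigo_cst.
  by apply: bounded_bigo => //; exact: bigo_cst.
have t1 : lilo F inc (fun t => (g1 t - g2 t) *m (b1 t *m s1 t)
    - G t *m (invmx D *m sgnmx D)).
  by apply: lilo_prodl => //; exact: vanish_prod.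
have t2 : lilo F inc (fun t => g2 t *m (b1 t - b2 t) *m s1 t
   - g0 *m (- (invmx D *m M t *m invmx D)) *m sgnmx D).
  apply: lilo_prodl => //; first exact: lilo_prodr.
  by apply: bounded_bigo => //; exact: bigo_cst.
have t3 : lilo F inc (fun t => (g2 t *m b2 t) *m (s1 t - s2 t)
   - (g0 *m invmx D) *m dsgnmx Q d (M t)).
  by apply: lilo_prodr => //; exact: vanish_prod.
refine (near_lilo _ (liloD (liloD t1 t2) t3)); near=> t.
rewrite /nqn_dir /dnqn_dir -/(b1 t) -/(b2 t) -/(s1 t) -/(s2 t).
rewrite !(mulmxBl, mulmxBr, mulmxN, mulNmx, mulmxA).
by apply/matrixP => i j; rewrite !mxE; ring.
Unshelve. all: by end_near. Qed.

End StepDerivative.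

(** * Functions of class C^k *)

Section StrictDifferentiability.
Context {R : realType} {m : nat}.
Implicit Types (u : 'rV[R]_m -> R) (x y p q v : 'rV[R]_m).

Lemma derive_partial u x v : differentiable u x ->
  'D_v u x = \sum_i v ord0 i * partial u i x.
Proof.
move=> du; rewrite deriveE// [v in LHS]row_sum_delta linear_sum.
by apply: eq_bigr => i _; rewrite linearZ /= /partial deriveE.
Qed.

Lemma is_derive_line u q v t : differentiable u (q + t *: v) ->
  is_derive t 1 (fun s => u (q + s *: v)) ('D_v u (q + t *: v)).
Proof.
move=> /diff_derivable-/(_ v) du.
have E : (fun h => h^-1 *: (((fun s => u (q + s *: v)) \o shift t) (h *: 1)
    - u (q + t *: v))) =
  (fun h => h^-1 *: ((u \o shift (q + t *: v)) (h *: v) - u (q + t *: v))).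
  apply/funext => h; congr (_ *: (_ - _)) => /=; congr u.
  by rewrite scalerDl [h%:A]mulr1 addrC -addrA (addrC (t *: v)).
by split; [rewrite /derivable E | rewrite /derive E].
Qed.

(** The mean value theorem along a segment; the strict bounds on t matter when
    the formula is divided by t. *)
Lemma MVT_line u q v : (forall y, differentiable u y) ->
  exists2 t, 0 < t < 1 &
    u (q + v) - u q = \sum_i v ord0 i * partial u i (q + t *: v).
Proof.
move=> du.
have dl (t : R) : is_derive t 1 (fun s => u (q + s *: v)) ('D_v u (q + t *: v)).
  by apply: is_derive_line.
have [|t] := @MVT R (fun s => u (q + s *: v))
  (fun t => 'D_v u (q + t *: v)) 0 1 ltr01 (fun t _ => dl t).
  by apply: derivable_within_continuous => t _; have [] := dl t.
rewrite in_itv /= => t01; rewrite subr0 mulr1 scale1r scale0r addr0 => ->.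
by exists t => //; rewrite derive_partial.
Qed.

(** Strict differentiability: the increment is compared between two points that
    both tend to x. It is what invertibility and contraction estimates need. *)
Definition strict_at u x (c : 'cV[R]_m) := forall e : R, 0 < e ->
  \forall p \near x & q \near x,
    `|u p - u q - ((p - q) *m c) ord0 ord0| <= e * `|p - q|.

Lemma C1_strict u x : (forall y, differentiable u y) ->
  (forall i, continuous (partial u i)) ->
  strict_at u x (\col_i partial u i x).
Proof.
move=> du cu e e0; pose e' := e / (m%:R + 1).
have e'0 : 0 < e' by rewrite divr_gt0// ltr_wpDl.
have : \forall y \near x, forall i, `|partial u i y - partial u i x| <= e'.
  apply: (@filter_forall _ _ _ (nbhs x)) => i.
  by have /cvgrPdistC_le/(_ _ e'0) := cu i x.
move=> /nbhs_ballP[r /= r0 hr].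
exists (ball x r, ball x r); first by split; exact: nbhsx_ballx.
move=> [p q] [/= xp xq].
have [t t01 E] := MVT_line q (p - q) du.
rewrite (addrC q (p - q)) subrK in E; rewrite {}E.
rewrite mxE -sumrB (le_trans (ler_norm_sum _ _ _))//.
have xt : ball x r (q + t *: (p - q)).
  move: xp xq; rewrite -!ball_normE /ball_ /= => xp xq.
  have -> : x - (q + t *: (p - q)) = t *: (x - p) + (1 - t) *: (x - q).
    by apply/rowP => i; rewrite !mxE; ring.
  have [t0 t1] : 0 <= t /\ t <= 1 by move: t01 => /andP[/ltW ? /ltW].
  rewrite (le_lt_trans (ler_normD _ _))// !normrZ ger0_norm// ger0_norm ?subr_ge0//.
  have [->|tn0] := eqVneq t 0; first by rewrite mul0r add0r subr0 mul1r.
  have tp : 0 < t by rewrite lt_def tn0.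
  have -> : r = t * r + (1 - t) * r by ring.
  by rewrite ltr_leD// ?ltr_pM2l// ler_wpM2l ?subr_ge0// ltW.
rewrite (@le_trans _ _ (\sum_(i < m) `|p - q| * e'))//.
  apply: ler_sum => i _; rewrite [X in _ - _ * X]mxE -mulrBr normrM ler_pM// ?mx_entry_le//.
  exact: (hr _ xt i).
rewrite sumr_const card_ord -mulrnAr [leRHS]mulrC ler_wpM2l// -mulr_natr /e'.
by rewrite mulrAC ler_pdivrMr ?ltr_wpDl// ler_pM2l// lerDl.
Qed.

Lemma CkS_differentiable k u : Ck k.+1 u -> forall x, differentiable u x.
Proof. by case. Qed.

Lemma CkS_continuous k u : Ck k u -> continuous u.
Proof.
case: k => [//|k] [du _] x; exact: differentiable_continuous.
Qed.

Lemma CkS_partial k u i : Ck k.+1 u -> Ck k (partial u i).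
Proof. by case=> _; apply. Qed.

Lemma CkW k u : Ck k.+1 u -> Ck k u.
Proof.
elim: k u => [|k IH] u h; first exact: (CkS_continuous h).
by split; [exact: CkS_differentiable h | move=> i; apply/IH/CkS_partial].
Qed.

Lemma Ck1_strict u x : Ck 1 u -> strict_at u x (\col_i partial u i x).
Proof.
by move=> [du cu]; apply: C1_strict.
Qed.

Lemma partialB_shift u v i y : (forall x, differentiable u x) ->
  partial (fun z => u (z + v) - u z) i y = partial u i (y + v) - partial u i y.
Proof.
move=> du; have d1 : differentiable (fun z => u (z + v)) y.
  apply: differentiable_comp => //.
have -> : partial u i (y + v) = partial (fun z => u (z + v)) i y.
  have E : (fun h : R => h^-1 *: ((u \o shift (y + v)) (h *: delta_mx ord0 i)
      - u (y + v))) =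
    (fun h : R => h^-1 *: (((fun z => u (z + v)) \o shift y)
      (h *: delta_mx ord0 i) - u (y + v))).
    by apply/funext => h /=; rewrite addrA.
  by rewrite /partial /derive E.
by rewrite /partial deriveB //; exact: diff_derivable.
Qed.

Lemma second_difference_arith (a b c d t l z : R) : a - b - (c - d) = t * z ->
  a - b - c + d - t * t * l = t * (z - t * l).
Proof. by move=> E; rewrite mulrBr -E; ring. Qed.

(** The second difference is t times an increment of the partial derivative in the
    direction i, by the mean value theorem, to which strict differentiability
    applies. *)
Lemma second_difference f x i j e : Ck 2 f -> 0 < e ->
  \forall t \near 0^'+,
    `|f (x + t *: delta_mx ord0 i + t *: delta_mx ord0 j)
      - f (x + t *: delta_mx ord0 i) - f (x + t *: delta_mx ord0 j) + f x
      - t * t * partial (partial f i) j x| <= t * t * e.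
Proof.
move=> fC2 e0; pose a := partial (partial f i) j x.
have fd := CkS_differentiable fC2.
have /(_ _ e0) [[U V] [/= Ux Vx] hUV] := Ck1_strict x (CkS_partial i fC2).
have /nbhs_ballP[r /= r0 hr] : nbhs x (U `&` V).
  exact: (@filterI _ (nbhs x)).
near=> t.
have t0 : 0 < t by near: t; exact: nbhs_right_gt.
have tr : t < r / 2 by near: t; apply: nbhs_right_lt; rewrite divr_gt0.
set vi := t *: delta_mx ord0 i; set vj := t *: delta_mx ord0 j.
have n1 (k : 'I_m) : `|delta_mx ord0 k : 'rV[R]_m| <= 1.
  by apply: mx_norm_le => // a' b; rewrite mxE; case: (_ && _); rewrite ?normr1 ?normr0.
have ud y : differentiable (fun z => f (z + vj) - f z) y.
  apply: differentiableB => //; exact: differentiable_comp.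
have [s /andP[/ltW s0 /ltW s1]] := MVT_line x vi ud.
rewrite (bigD1 i)//= big1 ?addr0; last first.
  by move=> k ki; rewrite !mxE (negPf ki) andbF mulr0 mul0r.
rewrite [vi ord0 i]mxE mxE !eqxx mulr1 partialB_shift// => E.
set y := x + s *: vi in E.
have bd z : `|x - z| <= 2 * t -> (U `&` V) z.
  move=> h; apply: hr; rewrite -ball_normE /ball_ /= (le_lt_trans h)//.
  by rewrite mulrC -ltr_pdivlMr.
have yU : (U `&` V) y.
  apply: bd; rewrite /y opprD addNKr normrN !normrZ (gtr0_norm t0) (ger0_norm s0).
  rewrite (@le_trans _ _ (1 * (t * 1)))//; last by lra.
  by rewrite ler_pM ?mulr_ge0// ?(ltW t0)// ler_pM2l.
have yvU : (U `&` V) (y + vj).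
  apply: bd; rewrite /y -addrA opprD addNKr normrN (le_trans (ler_normD _ _))//.
  rewrite !normrZ (gtr0_norm t0) (ger0_norm s0).
  have -> : 2 * t = 1 * (t * 1) + t * 1 by ring.
  rewrite lerD//; last by rewrite ler_pM2l.
  by rewrite ler_pM ?mulr_ge0// ?(ltW t0)// ler_pM2l.
have := hUV (y + vj, y); rewrite /= => /(_ (conj yvU.1 yU.2)).
have -> : y + vj - y = vj by rewrite addrC addKr.
have -> : (vj *m (\col_k partial (partial f i) k x)) ord0 ord0 = t * a.
  by rewrite /vj -scalemxAl -rowE !mxE.
have -> : f (x + vi + vj) - f (x + vi) - f (x + vj) + f x - t * t * a =
  t * (partial f i (y + vj) - partial f i y - t * a).
  exact: second_difference_arith E.
move=> h; rewrite normrM gtr0_norm// -mulrA ler_pM2l//.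
rewrite (le_trans h)// [leRHS]mulrC ler_wpM2l ?(ltW e0)//.
by rewrite normrZ gtr0_norm// -[leRHS]mulr1 ler_pM2l.
Unshelve. all: by end_near. Qed.

(** Schwarz's theorem: the second difference is symmetric in i and j. *)
Lemma partialC f x i j : Ck 2 f ->
  partial (partial f i) j x = partial (partial f j) i x.
Proof.
move=> fC2; set a := LHS; set b := RHS.
have [//|ab] := eqVneq a b.
have e0 : 0 < `|a - b| / 4 by rewrite divr_gt0// normr_gt0 subr_eq0.
have close (c d A t : R) : 0 < t -> `|A - t * t * c| <= t * t * (`|c - d| / 4) ->
    `|A - t * t * d| <= t * t * (`|c - d| / 4) -> c = d.
  move=> t0 h1 h2; have tt : 0 < t * t by exact: mulr_gt0.
  have : `|t * t * (c - d)| <= t * t * (`|c - d| / 4) + t * t * (`|c - d| / 4).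
    rewrite (_ : t * t * (c - d) = (A - t * t * d) - (A - t * t * c)); last ring.
    by rewrite (le_trans (ler_normB _ _))// lerD.
  rewrite normrM (gtr0_norm tt) -mulrDr ler_pM2l// => h.
  by apply/eqP; rewrite -subr_eq0 -normr_le0; lra.
have ha := second_difference x i j fC2 e0.
have hb := second_difference x j i fC2 e0.
have [t [t0 h1]] : exists t : R, [/\ 0 < t,
   `|f (x + t *: delta_mx ord0 i + t *: delta_mx ord0 j)
      - f (x + t *: delta_mx ord0 i) - f (x + t *: delta_mx ord0 j) + f x
      - t * t * a| <= t * t * (`|a - b| / 4) &
   `|f (x + t *: delta_mx ord0 j + t *: delta_mx ord0 i)
      - f (x + t *: delta_mx ord0 j) - f (x + t *: delta_mx ord0 i) + f x
      - t * t * b| <= t * t * (`|a - b| / 4)].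
  have h0 : \forall t \near (0 : R)^'+, 0 < t by exact: nbhs_right_gt.
  have [t [[t0 h1] h2]] := filter_ex (filterI (filterI h0 ha) hb).
  exact: (ex_intro _ t (And3 t0 h1 h2)).
rewrite [x + t *: delta_mx ord0 j + _]addrAC; move: h1.
move: (f (x + t *: delta_mx ord0 i + t *: delta_mx ord0 j))
  (f (x + t *: delta_mx ord0 i)) (f (x + t *: delta_mx ord0 j)) (f x) => A B C D h1.
rewrite [A - C - B]addrAC; exact: (close _ _ _ _ t0 h1).
Qed.

End StrictDifferentiability.

(** * Powers of the Euclidean norm *)

Section NormPower.
Context {R : realType}.

Lemma powR_strict (b t0 : R) : 0 < t0 -> forall e : R, 0 < e ->
  exists2 r : R, 0 < r & forall s t, `|s - t0| < r -> `|t - t0| < r ->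
    `|s `^ b - t `^ b - b * t0 `^ (b - 1) * (s - t)| <= e * `|s - t|.
Proof.
move=> t00 e e0.
have cd : (fun t : R => b * t `^ (b - 1)) @ t0 --> b * t0 `^ (b - 1).
  apply: cvgM; first exact: cvg_cst.
  have : {for t0, continuous (fun t : R => t `^ (b - 1))}; last exact.
  apply: differentiable_continuous; apply/derivable1_diffP.
  by apply: derivable_powR; rewrite in_itv /= t00.
have /cvgrPdistC_le/(_ _ e0)/nbhs_ballP[r1 /= r10 hr1] := cd.
exists (Num.min r1 t0); first by rewrite lt_min r10.
have main s t : t <= s -> `|s - t0| < Num.min r1 t0 -> `|t - t0| < Num.min r1 t0 ->
    `|s `^ b - t `^ b - b * t0 `^ (b - 1) * (s - t)| <= e * `|s - t|.
  move=> ts; rewrite !lt_min => /andP[s1 s2] /andP[t1 t2].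
  have tp : 0 < t by move: t2; rewrite ltr_distl => /andP[]; rewrite subrr.
  have dp y : 0 < y -> derivable (@powR R ^~ b) y 1.
    by move=> y0; apply: derivable_powR; rewrite in_itv /= y0.
  have [|||c cts ->] := @MVT_segment R (@powR R ^~ b) (fun y => b * y `^ (b - 1)) t s.
  - exact: ts.
  - move=> y; rewrite in_itv /= => /andP[ty _].
    by apply: is_derive1_powR; exact: lt_trans ty.
  - apply: derivable_within_continuous => y; rewrite in_itv /= => /andP[ty _].
    by apply: dp; exact: lt_le_trans ty.
  rewrite -mulrBl normrM ler_wpM2r//; apply: hr1; rewrite -ball_normE /ball_ /=.
  move: cts s1 t1; rewrite in_itv /= => /andP[tc cs].
  by rewrite !ltr_distl => /andP[? ?] /andP[? ?]; apply/andP; split; lra.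
move=> s t hs ht; have [ts|st] := leP t s; first exact: main.
rewrite (_ : _ - _ - _ = - (t `^ b - s `^ b - b * t0 `^ (b - 1) * (t - s))).
  by rewrite normrN (distrC s t); apply: main => //; exact: ltW.
ring.
Qed.

Lemma powR_lip (a c s t : R) : 0 < a -> 0 <= s <= c -> 0 <= t <= c ->
  `|s `^ (1 + a) - t `^ (1 + a)| <= (1 + a) * c `^ a * `|s - t|.
Proof.
move=> a0.
have a1 : 0 < 1 + a by lra.
have main x y : y <= x -> 0 <= x <= c -> 0 <= y <= c ->
    `|x `^ (1 + a) - y `^ (1 + a)| <= (1 + a) * c `^ a * `|x - y|.
  move=> yx /andP[x0 xc] /andP[y0 yc].
  have c0 : 0 <= c by exact: le_trans xc.
  have xpc z : 0 <= z -> z <= c -> z `^ a <= c `^ a.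
    by move=> z0 zc; apply: ge0_ler_powR => //; exact: ltW.
  have [y0'|yN0] := eqVneq y 0.
    rewrite y0' powR0 ?gt_eqF// !subr0 -(mulr_powRB1 x0 a1).
    have -> : 1 + a - 1 = a by ring.
    rewrite normrM (ger0_norm (powR_ge0 _ _)) mulrC ler_wpM2r//.
    rewrite (le_trans (xpc _ x0 xc))// -[leLHS]mul1r ler_wpM2r ?powR_ge0//.
    by lra.
  have yp : 0 < y by rewrite lt_def yN0.
  have [|||z zxy ->] := @MVT_segment R (@powR R ^~ (1 + a))
      (fun y => (1 + a) * y `^ (1 + a - 1)) y x.
  - exact: yx.
  - move=> z; rewrite in_itv /= => /andP[ty _].
    by apply: is_derive1_powR; exact: lt_trans ty.
  - apply: derivable_within_continuous => z; rewrite in_itv /= => /andP[ty _].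
    by apply: derivable_powR; rewrite in_itv /= andbT; exact: lt_le_trans ty.
  have -> : 1 + a - 1 = a by ring.
  move: zxy; rewrite in_itv /= => /andP[yz zx].
  rewrite normrM ler_wpM2r// ger0_norm ?mulr_ge0 ?powR_ge0 ?(ltW a1)//.
  rewrite ler_pM2l//; apply: xpc; first exact: le_trans yz.
  exact: le_trans xc.
move=> hs ht; have [ts|st] := leP t s; first exact: main.
by rewrite distrC (distrC s); apply: main => //; exact: ltW.
Qed.

Context {m : nat}.
Implicit Types (u v : 'rV[R]_m).

Lemma enorm_sqr u : enorm u ^+ 2 = dotv u u.
Proof.
rewrite /enorm sqr_sqrtr; last by apply: sumr_ge0 => i _; exact: sqr_ge0.
by rewrite dotvE; apply: eq_bigr => i _; rewrite expr2.
Qed.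

Lemma enorm_ge0 u : 0 <= enorm u. Proof. exact: sqrtr_ge0. Qed.

Lemma enormE u : enorm u = Num.sqrt (dotv u u).
Proof. by rewrite -enorm_sqr sqrtr_sqr ger0_norm// enorm_ge0. Qed.

Lemma enorm0 : enorm (0 : 'rV[R]_m) = 0.
Proof. by rewrite enormE dotv0l sqrtr0. Qed.

Lemma enorm_gt0 u : u != 0 -> 0 < enorm u.
Proof. by move=> u0; rewrite enormE sqrtr_gt0 dotvv_gt0. Qed.

Lemma norm_le_enorm u : `|u| <= enorm u.
Proof.
rewrite -(@ler_pXn2r _ 2) ?nnegrE ?enorm_ge0// enorm_sqr expr2.
exact: norm_sqr_le_dotv.
Qed.

Lemma enorm_le_norm u : enorm u <= (m%:R + 1) * `|u|.
Proof.
have m0 : 0 <= m%:R :> R by [].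
rewrite -(@ler_pXn2r _ 2) ?nnegrE ?enorm_ge0 ?mulr_ge0 ?addr_ge0// enorm_sqr.
rewrite (le_trans (ler_norm _))// (le_trans (dotv_norm_le _ _))// exprMn -mulrA.
rewrite -expr2 ler_wpM2r ?sqr_ge0//; nra.
Qed.

Lemma dotv_CS u v : dotv u v <= enorm u * enorm v.
Proof.
have [v0|v0] := eqVneq v 0.
  by rewrite v0 dotvC dotv0l mulr_ge0// enorm_ge0.
have := dotvv_ge0 (enorm v ^+ 2 *: u - dotv u v *: v).
rewrite !(dotvDl, dotvDr, dotvNl, dotvNr, dotvZl, dotvZr) -!enorm_sqr (dotvC v u).
have v2 : 0 < enorm v ^+ 2 by rewrite exprn_gt0// enorm_gt0.
set a := dotv u v; set U := enorm u; set V := enorm v in v2 *.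
rewrite (_ : _ + _ = V ^+ 2 * ((U * V) ^+ 2 - a ^+ 2)); last ring.
rewrite pmulr_rge0// subr_ge0 => h.
have UV : 0 <= U * V by rewrite mulr_ge0// enorm_ge0.
by apply: real_ler_normlW; rewrite ?num_real// -(@ler_pXn2r _ 2) ?nnegrE// real_normK ?num_real.
Qed.

Lemma enorm_dist u v : `|enorm u - enorm v| <= enorm (u - v).
Proof.
rewrite -(@ler_pXn2r _ 2) ?nnegrE ?enorm_ge0// real_normK ?num_real// enorm_sqr.
rewrite !(dotvDl, dotvDr, dotvNl, dotvNr) -!enorm_sqr (dotvC v u).
have := dotv_CS u v; lra.
Qed.

Context {T : Type} {F : set_system T} {FF : Filter F}.
Variables (alpha : R) (inc : T -> R) (g1 g2 G : T -> 'rV[R]_m) (g0 : 'rV[R]_m).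
Hypotheses (alpha_gt0 : 0 < alpha) (inc0 : forall t, 0 <= inc t)
  (g1g : lilo F one_ (fun t => g1 t - g0)) (g2g : lilo F one_ (fun t => g2 t - g0))
  (g12 : lilo F inc (fun t => g1 t - g2 t - G t)) (GO : bigo F inc G).

(** The differential of |g|^(1 + alpha) = <g, g>^((1 + alpha) / 2) at g maps h to
    this coefficient times <h, g>. *)
Definition norm_power_coef (g : 'rV[R]_m) : R :=
  2 * ((1 + alpha) / 2 * dotv g g `^ ((1 + alpha) / 2 - 1)).

(** At g0 = 0 the power has a small Lipschitz constant on a small ball, because
    alpha > 0; elsewhere it is a smooth function of <g, g>. The 1 x 1 matrix gives
    access to the calculus of lilo and bigo. *)
Lemma norm_power_diff : lilo F inc (fun t =>
  (enorm (g1 t) `^ (1 + alpha) - enorm (g2 t) `^ (1 + alpha)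
   - norm_power_coef g0 * dotv (G t) g0)%:M : 'M[R]_1).
Proof.
have sc := @scalar_mx1_norm R.
have g12O : bigo F inc (fun t => g1 t - g2 t) by exact: lilo_congr_bigo GO.
have [gE|gN0] := eqVneq g0 0.
  have [C C0 hC] := g12O => e e0.
  have K0 : 0 < (1 + alpha) * ((m%:R + 1) * C).
    by rewrite !mulr_gt0// ltr_wpDl// ltW.
  pose e1 := e / ((1 + alpha) * ((m%:R + 1) * C)).
  have e10 : 0 < e1 by rewrite divr_gt0.
  (* On the ball of radius c the Lipschitz constant is (1 + alpha) e1. *)
  pose c := e1 `^ alpha^-1; have c0 : 0 < c by rewrite powR_gt0.
  have cE : c `^ alpha = e1.
    by rewrite /c -powRrM mulVf ?gt_eqF// powRr1// ltW.
  have e20 : 0 < c / (m%:R + 1) by rewrite divr_gt0// ltr_wpDl.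
  have small (g : 'rV[R]_m) : `|g - g0| <= c / (m%:R + 1) * 1 -> enorm g <= c.
    rewrite gE subr0 mulr1 => h; rewrite (le_trans (enorm_le_norm _))//.
    by rewrite mulrC -ler_pdivlMr// ltr_wpDl.
  near=> t; rewrite sc gE dotvC dotv0l mulr0 subr0.
  have h1 : enorm (g1 t) <= c by apply: small; near: t; exact: g1g.
  have h2 : enorm (g2 t) <= c by apply: small; near: t; exact: g2g.
  have h3 : `|g1 t - g2 t| <= C * inc t by near: t.
  rewrite (le_trans (@powR_lip alpha c _ _ _ _ _))// ?enorm_ge0// cE.
  rewrite (@le_trans _ _ ((1 + alpha) * e1 * ((m%:R + 1) * (C * inc t))))//.
    apply: ler_wpM2l; first by rewrite mulr_ge0 ?(ltW e10)// addr_ge0// ltW.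
    rewrite (le_trans (enorm_dist _ _))// (le_trans (enorm_le_norm _))//.
    by rewrite ler_wpM2l// addr_ge0.
  rewrite [leLHS](_ : _ = e1 * ((1 + alpha) * ((m%:R + 1) * C)) * inc t); last ring.
  by rewrite /e1 divfK// gt_eqF.
pose b := (1 + alpha) / 2; pose t0 := dotv g0 g0.
have t00 : 0 < t0 by exact: dotvv_gt0.
have sE (g : 'rV[R]_m) : enorm g `^ (1 + alpha) = dotv g g `^ b.
  rewrite enormE -powR12_sqrt ?dotvv_ge0// -powRrM; congr (_ `^ _).
  by rewrite /b; field.
pose q1 t := dotv (g1 t) (g1 t); pose q2 t := dotv (g2 t) (g2 t).
have trv (g : T -> 'rV[R]_m) (h : 'rV[R]_m) :
    lilo F one_ (fun t => g t - h) -> lilo F one_ (fun t => (g t)^T - h^T).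
  move=> gh; apply: (lilo_le (X := fun t => g t - h) (K := 1)) => //.
  near=> t; rewrite mul1r -linearB; apply: mx_norm_le => // i j.
  by rewrite mxE mx_entry_le.
have qE t : (q1 t - q2 t)%:M = (g1 t - g2 t) *m ((g1 t)^T + (g2 t)^T).
  rewrite -linearD [RHS]mx11_scalar; congr (_%:M); rewrite -/(dotv _ _).
  by rewrite !(dotvDl, dotvDr, dotvNl, dotvNr) (dotvC (g2 t) (g1 t)) /q1 /q2; ring.
have gg : lilo F one_ (fun t => ((g1 t)^T + (g2 t)^T) - (g0^T + g0^T)).
  apply: (near_lilo _ (liloD (trv _ _ g1g) (trv _ _ g2g))); near=> t.
  by rewrite /= addrACA opprD.
have q12 : lilo F inc (fun t => (q1 t - q2 t)%:M - G t *m (g0^T + g0^T)).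
  apply: (near_lilo _ (lilo_prodl inc0 g12 GO gg)); near=> t.
  by rewrite qE.
have q12O : bigo F inc (fun t => (q1 t - q2 t)%:M : 'M[R]_1).
  by apply: (lilo_congr_bigo q12); apply: bigo_bounded => //; exact: bigo_cst.
have qv (g : T -> 'rV[R]_m) : lilo F one_ (fun t => g t - g0) ->
    lilo F one_ (fun t => (dotv (g t) (g t) - t0)%:M : 'M[R]_1).
  move=> gg0; apply: (near_lilo _ (vanish_prod gg0 (trv _ _ gg0))); near=> t.
  rewrite /= [X in X - _]mx11_scalar [X in _ - X]mx11_scalar -raddfB /=.
  by rewrite -/(dotv _ _).
have s12 : lilo F inc (fun t => (q1 t `^ b - q2 t `^ b
    - b * t0 `^ (b - 1) * (q1 t - q2 t))%:M : 'M[R]_1).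
  case: q12O => C C0 hC e e0.
  have eC : 0 < e / C by rewrite divr_gt0.
  have [r r0 hr] := powR_strict b t00 eC.
  have r2 : 0 < r / 2 by rewrite divr_gt0.
  near=> t.
  have k1 : `|q1 t - t0| <= r / 2.
    by rewrite -sc -[leRHS]mulr1; near: t; exact: (qv _ g1g).
  have k2 : `|q2 t - t0| <= r / 2.
    by rewrite -sc -[leRHS]mulr1; near: t; exact: (qv _ g2g).
  have k3 : `|q1 t - q2 t| <= C * inc t by rewrite -sc; near: t.
  rewrite sc (le_trans (hr _ _ _ _))//; [lra | lra |].
  rewrite (@le_trans _ _ (e / C * (C * inc t)))//; first by rewrite ler_pM2l.
  by rewrite mulrA divfK// gt_eqF.
have s12' : lilo F inc (fun t => (b * t0 `^ (b - 1))%:M *m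
    ((q1 t - q2 t)%:M - G t *m (g0^T + g0^T)) : 'M[R]_1).
  by apply: bounded_lilo => //; exact: bigo_cst.
apply: (near_lilo _ (liloD s12 s12')); near=> t.
rewrite /= mul_scalar_mx [G t *m _]mx11_scalar -raddfB /= scale_scalar_mx -raddfD.
congr (_%:M); rewrite !sE -/(q1 t) -/(q2 t) /norm_power_coef -/b -/t0.
rewrite -linearD -/(dotv _ _) dotvDr; ring.
Unshelve. all: by end_near. Qed.

End NormPower.

(** * The step with a fixed shift *)

Lemma mx_sub2E (R : realType) m n (A B C : 'M[R]_(m, n)) i j :
  (A - B - C) i j = A i j - B i j - C i j.
Proof. by rewrite !mxE. Qed.

Lemma shift_increment_arith (R : comRingType) (b : bool) (h1 h0 d' d s1 s0 : R) :
  (h1 + (d' * s1) *+ b) - (h0 + (d * s0) *+ b) =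
  (h1 - h0) + ((d' - d) * s1 + d * (s1 - s0)) *+ b.
Proof. by case: b; rewrite ?mulr1n ?mulr0n; ring. Qed.

Lemma shift_diff_arith (R : comRingType) (b : bool) (h1 h2 z d' d s1 s2 ds : R) :
  (h1 + (d' * s1) *+ b) - (h2 + (d' * s2) *+ b) - (z + (d * ds) *+ b) =
  (h1 - h2 - z) + (d' * (s1 - s2 - ds) + (d' - d) * ds) *+ b.
Proof. by case: b; rewrite ?mulr1n ?mulr0n; ring. Qed.

Lemma mx_subE (R : realType) m n (A B : 'M[R]_(m, n)) i j :
  (A - B) i j = A i j - B i j.
Proof. by rewrite !mxE. Qed.

Section Entrywise.
Context {R : realType} {T : Type} {F : set_system T} {FF : Filter F}.
Variables (inc : T -> R) (m n : nat) (X : T -> 'M[R]_(m, n)).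
Hypothesis inc0 : forall t, 0 <= inc t.

Lemma lilo_entries :
  (forall i j (e : R), 0 < e -> \forall t \near F, `|X t i j| <= e * inc t) ->
  lilo F inc X.
Proof.
move=> h e e0.
have : \forall t \near F, forall ij : 'I_m * 'I_n, `|X t ij.1 ij.2| <= e * inc t.
  by apply: filter_forall => -[i j]; exact: h.
apply: filterS => t ht; apply: mx_norm_le; first by rewrite mulr_ge0 // ltW.
by move=> i j; exact: (ht (i, j)).
Qed.

Lemma bigo_entries :
  (forall i j, exists C : R, \forall t \near F, `|X t i j| <= C * inc t) ->
  bigo F inc X.
Proof.
move=> h; have /choice[C hC] : forall ij : 'I_m * 'I_n,
    exists C : R, \forall t \near F, `|X t ij.1 ij.2| <= C * inc t.
  by move=> [i j]; exact: h.
have K0 : 0 <= \sum_ij `|C ij| by apply: sumr_ge0.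
exists (\sum_ij `|C ij| + 1); first by rewrite ltr_wpDl.
have : \forall t \near F, forall ij : 'I_m * 'I_n,
    `|X t ij.1 ij.2| <= C ij * inc t by apply: filter_forall => ij; exact: hC.
apply: filterS => t ht; apply: mx_norm_le; first by rewrite mulr_ge0// addr_ge0.
move=> i j; rewrite (le_trans (ht (i, j)))// ler_wpM2r//.
rewrite (bigD1 (i, j))//= -addrA (le_trans (ler_norm _))// lerDl addr_ge0//.
by apply: sumr_ge0.
Qed.

End Entrywise.

Section FixedShift.
Context {R : realType} {m : nat}.
Variables (f : 'rV[R]_m -> R) (alpha : R).
Hypotheses (fC3 : Ck 3 f) (alpha_gt0 : 0 < alpha).
Implicit Types (x p q h : 'rV[R]_m).

(** The step of the algorithm when d is the selected shift. *)
Definition nqn_fixed (d : R) x : 'rV[R]_m :=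
  x - nqn_dir (gradient f x) (shifted_hessian f alpha d x).

(** The derivatives at x, in the direction h, of the Hessian and of the shifted
    Hessian with the shift d. *)
Definition dhessian x h : 'M[R]_m :=
  \matrix_(i, j) (h *m (\col_k partial (partial (partial f i) j) k x)) ord0 ord0.

Definition dshifted_hessian (d : R) x h : 'M[R]_m := dhessian x h +
  (d * (norm_power_coef alpha (gradient f x)
        * dotv (h *m hessian f x) (gradient f x)))%:M.

Lemma hessian_tr x : (hessian f x)^T = hessian f x.
Proof.
by apply/matrixP => i j; rewrite !mxE; apply: partialC; exact: CkW.
Qed.

Lemma shifted_hessian_tr d x :
  (shifted_hessian f alpha d x)^T = shifted_hessian f alpha d x.
Proof. by rewrite /shifted_hessian linearD /= hessian_tr tr_scalar_mx. Qed.

Lemma shifted_hessianE d x i j : shifted_hessian f alpha d x i j =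
  partial (partial f i) j x + (d * enorm (gradient f x) `^ (1 + alpha)) *+ (i == j).
Proof. by rewrite !mxE. Qed.

Lemma dshifted_hessianE d x h i j : dshifted_hessian d x h i j =
  (h *m (\col_k partial (partial (partial f i) j) k x)) ord0 ord0 +
  (d * (norm_power_coef alpha (gradient f x)
        * dotv (h *m hessian f x) (gradient f x))) *+ (i == j).
Proof. by rewrite /dshifted_hessian mxE [dhessian _ _ _ _]mxE [_%:M _ _]mxE. Qed.

(** Pairs of points tending to x, together with a shift tending to d: estimates
    along this filter are uniform in the shift. *)
Definition pair_filter x (d : R) : set_system ('rV[R]_m * 'rV[R]_m * R) :=
  filter_prod (filter_prod (nbhs x) (nbhs x)) (nbhs d).

Global Instance pair_filter_filter x d : Filter (pair_filter x d).
Proof. exact: filter_prod_filter. Qed.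

Definition dist2 (t : 'rV[R]_m * 'rV[R]_m * R) : R := `|t.1.1 - t.1.2|.

Lemma pair_near1 x d (P : 'rV[R]_m -> Prop) : (\forall p \near x, P p) ->
  \forall t \near pair_filter x d, P t.1.1.
Proof.
move=> h; exists ([set pq | P pq.1], setT) => /=.
  split; last exact: filterT.
  by exists (P, setT) => /=; [split => //; exact: filterT | move=> [p q] []].
by move=> [[p q] d'] [].
Qed.

Lemma pair_near2 x d (P : 'rV[R]_m -> Prop) : (\forall p \near x, P p) ->
  \forall t \near pair_filter x d, P t.1.2.
Proof.
move=> h; exists ([set pq | P pq.2], setT) => /=.
  split; last exact: filterT.
  by exists (setT, P) => /=; [split => //; exact: filterT | move=> [p q] []].
by move=> [[p q] d'] [].
Qed.

Lemma pair_near12 x d (P : 'rV[R]_m -> 'rV[R]_m -> Prop) :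
  (\forall p \near x & q \near x, P p q) ->
  \forall t \near pair_filter x d, P t.1.1 t.1.2.
Proof.
move=> h; exists ([set pq | P pq.1 pq.2], setT) => /=.
  by split; [exact: h | exact: filterT].
by move=> [[p q] d'] [].
Qed.

Lemma pair_near3 x d (P : R -> Prop) : (\forall d' \near d, P d') ->
  \forall t \near pair_filter x d, P t.2.
Proof.
move=> h; exists (setT, P) => /=; first by split => //; exact: filterT.
by move=> [[p q] d'] [].
Qed.

Lemma mul_col_le h (c : 'cV[R]_m) :
  `|(h *m c) ord0 ord0| <= m%:R * `|c| * `|h|.
Proof.
rewrite (le_trans (mx_entry_le _ _ _))// (le_trans (mulmx_norm_le _ _))//.
by rewrite mulrAC.
Qed.

Section AtPoint.
Variables (x : 'rV[R]_m) (d : R).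
Let F := pair_filter x d.
Let g := gradient f x.
Let H := hessian f x.
Let incr (t : 'rV[R]_m * 'rV[R]_m * R) := t.1.1 - t.1.2.

Let dist20 t : 0 <= dist2 t. Proof. exact: normr_ge0. Qed.

Let cont1 u (e : R) : continuous u -> 0 < e ->
  \forall t \near F, `|u t.1.1 - u x : R| <= e * 1.
Proof.
move=> /(_ x)/cvgrPdistC_le h e0.
by apply: (@pair_near1 x d (fun p => `|u p - u x| <= e * 1)); rewrite mulr1; exact: h.
Qed.

Let cont2 u (e : R) : continuous u -> 0 < e ->
  \forall t \near F, `|u t.1.2 - u x : R| <= e * 1.
Proof.
move=> /(_ x)/cvgrPdistC_le h e0.
by apply: (@pair_near2 x d (fun p => `|u p - u x| <= e * 1)); rewrite mulr1; exact: h.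
Qed.

Lemma gradient_vanish1 : lilo F one_ (fun t => gradient f t.1.1 - g).
Proof.
apply: lilo_entries => // i j e e0.
under eq_near => t do rewrite !mxE.
by apply: cont1 => //; exact: CkS_continuous (CkS_partial j fC3).
Qed.

Lemma gradient_vanish2 : lilo F one_ (fun t => gradient f t.1.2 - g).
Proof.
apply: lilo_entries => // i j e e0.
under eq_near => t do rewrite !mxE.
by apply: cont2 => //; exact: CkS_continuous (CkS_partial j fC3).
Qed.

Lemma incr_bigo : bigo F dist2 incr.
Proof. by exists 1 => //; near=> t; rewrite mul1r. Unshelve. all: by end_near. Qed.

Lemma dgradient_bigo : bigo F dist2 (fun t => incr t *m H).
Proof. by apply: bigo_bounded; [exact: incr_bigo | exact: bigo_cst]. Qed.

Lemma gradient_diff :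
  lilo F dist2 (fun t => gradient f t.1.1 - gradient f t.1.2 - incr t *m H).
Proof.
apply: lilo_entries => // i j e e0.
have E t : (gradient f t.1.1 - gradient f t.1.2 - incr t *m H) i j =
    partial f j t.1.1 - partial f j t.1.2 -
    (incr t *m (\col_k partial (partial f j) k x)) ord0 ord0.
  rewrite ord1 mx_sub2E; congr (_ - _ - _); try by rewrite mxE.
  rewrite !mxE; apply: eq_bigr => k _; congr (_ * _); rewrite !mxE.
  by apply: partialC; exact: CkW.
under eq_near => t do rewrite E.
apply: (@pair_near12 x d (fun p q => `|partial f j p - partial f j q -
  ((p - q) *m (\col_k partial (partial f j) k x)) ord0 ord0| <= e * `|p - q|)).
by apply: Ck1_strict => //; apply: CkW; exact: CkS_partial.
Qed.

Let s (p : 'rV[R]_m) := enorm (gradient f p) `^ (1 + alpha).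
Let ds t := norm_power_coef alpha g * dotv (incr t *m H) g.

Lemma s_diff e : 0 < e ->
  \forall t \near F, `|s t.1.1 - s t.1.2 - ds t| <= e * dist2 t.
Proof.
move=> e0; have h := norm_power_diff (FF := pair_filter_filter x d) alpha_gt0
  dist20 gradient_vanish1 gradient_vanish2 gradient_diff dgradient_bigo.
have := h e e0; apply: filterS => t; by rewrite scalar_mx1_norm.
Qed.

Lemma s_vanish (y : 'rV[R]_m * 'rV[R]_m * R -> 'rV[R]_m) e :
  lilo F one_ (fun t => gradient f (y t) - g) -> 0 < e ->
  \forall t \near F, `|s (y t) - s x| <= e.
Proof.
move=> yv e0.
have h0 : lilo F one_ (fun t : 'rV[R]_m * 'rV[R]_m * R => g - g).
  by move=> e' e'0; near=> t; rewrite subrr normr0 mulr1 ltW.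
have h1 : lilo F one_ (fun t : 'rV[R]_m * 'rV[R]_m * R => gradient f (y t) - g - 0).
  by move=> e' e'0; near=> t; rewrite subr0; near: t; exact: yv.
have h2 : bigo F one_ (fun t : 'rV[R]_m * 'rV[R]_m * R => 0 : 'rV[R]_m).
  exact: bigo_cst.
have h := norm_power_diff (FF := pair_filter_filter x d) alpha_gt0
  (fun=> ler01) yv h0 h1 h2.
have := h e e0; apply: filterS => t.
by rewrite scalar_mx1_norm dotv0l mulr0 subr0 mulr1.
Unshelve. all: by end_near. Qed.

Lemma ds_bigo : exists2 C : R, 0 < C &
  \forall t \near F, `|ds t| <= C * dist2 t.
Proof.
have [C C0 hC] := dgradient_bigo.
exists (`|norm_power_coef alpha g| * (m%:R * C * `|g|) + 1).
  by rewrite ltr_wpDl// !mulr_ge0// ltW.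
move: hC; apply: filterS => t ht.
rewrite mulrDl; apply: ler_wpDr; first by rewrite mul1r dist20.
rewrite normrM -[leRHS]mulrA; apply: ler_wpM2l => //.
rewrite (le_trans (dotv_norm_le _ _))//.
rewrite [leRHS](_ : _ = m%:R * (C * dist2 t) * `|g|); last ring.
by rewrite ler_wpM2r// ler_wpM2l.
Qed.

Lemma dshifted_bigo : bigo F dist2 (fun t => dshifted_hessian d x (incr t)).
Proof.
apply: bigoD; apply: bigo_entries => // i j.
  exists (m%:R * `|\col_k partial (partial (partial f i) j) k x|).
  by near=> t; rewrite mxE; exact: mul_col_le.
have [C C0 hC] := ds_bigo; exists (`|d| * C); near=> t.
have hds : `|ds t| <= C * dist2 t by near: t.
rewrite mxE -/(ds t); case: (_ == _); rewrite ?mulr1n ?mulr0n.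
  by rewrite normrM -[leRHS]mulrA; apply: ler_wpM2l.
by rewrite normr0 mulr_ge0// mulr_ge0// ltW.
Unshelve. all: by end_near. Qed.

Lemma shifted_vanish (y : 'rV[R]_m * 'rV[R]_m * R -> 'rV[R]_m) :
  lilo F one_ (fun t => gradient f (y t) - g) ->
  (forall u (e : R), continuous u -> 0 < e ->
    \forall t \near F, `|u (y t) - u x : R| <= e * 1) ->
  lilo F one_ (fun t => shifted_hessian f alpha t.2 (y t) -
                        shifted_hessian f alpha d x).
Proof.
move=> yv yc; apply: lilo_entries => // i j e e0.
have E (t : 'rV[R]_m * 'rV[R]_m * R) : (shifted_hessian f alpha t.2 (y t) - shifted_hessian f alpha d x) i j =
   (partial (partial f i) j (y t) - partial (partial f i) j x) +
   ((t.2 - d) * s (y t) + d * (s (y t) - s x)) *+ (i == j).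
  rewrite mx_subE; apply: etrans (shift_increment_arith _ _ _ _ _ _ _).
  exact: (congr2 (fun a b => a - b) (shifted_hessianE _ _ _ _) (shifted_hessianE _ _ _ _)).
under eq_near => t do rewrite E.
have e2 : 0 < e / 2 by rewrite divr_gt0.
have e4 : 0 < e / 4 by rewrite divr_gt0.
have ed : 0 < e / 4 / (`|s x| + 1) by rewrite divr_gt0// ltr_wpDl.
have es : 0 < e / 4 / (`|d| + 1) by rewrite divr_gt0// ltr_wpDl.
have ch : continuous (partial (partial f i) j).
  exact: CkS_continuous (CkS_partial j (CkS_partial i fC3)).
have hd : \forall t \near F, `|t.2 - d| <= e / 4 / (`|s x| + 1).
  apply: (@pair_near3 x d (fun d' => `|d' - d| <= e / 4 / (`|s x| + 1))).
  apply/nbhs_ballP; exists (e / 4 / (`|s x| + 1)) => //= d'.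
  by rewrite -ball_normE /ball_ /= distrC => /ltW.
near=> t.
have k1 : `|partial (partial f i) j (y t) - partial (partial f i) j x| <= e / 2 * 1.
  by near: t; exact: yc.
have k2 : `|s (y t) - s x| <= e / 4 / (`|d| + 1) by near: t; exact: s_vanish.
have k2' : `|s (y t) - s x| <= 1 by near: t; exact: s_vanish.
have k3 : `|t.2 - d| <= e / 4 / (`|s x| + 1) by near: t.
rewrite mulr1 (le_trans (ler_normD _ _))//.
have -> : e = e / 2 + (e / 4 + e / 4) by field.
apply: lerD; first by rewrite -[leRHS]mulr1.
case: (i == j); last by rewrite mulr0n normr0 addr_ge0// ltW.
rewrite mulr1n (le_trans (ler_normD _ _))// !normrM; apply: lerD.
  have sy : `|s (y t)| <= `|s x| + 1.
    by rewrite -{1}(subrK (s x) (s (y t))) (le_trans (ler_normD _ _))// addrC lerD2l.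
  rewrite (@le_trans _ _ (e / 4 / (`|s x| + 1) * (`|s x| + 1)))//.
    by rewrite ler_pM.
  by rewrite divfK// gt_eqF// ltr_wpDl.
rewrite (@le_trans _ _ ((`|d| + 1) * (e / 4 / (`|d| + 1))))//.
  by rewrite ler_pM// lerDl.
by rewrite mulrC divfK// gt_eqF// ltr_wpDl.
Unshelve. all: by end_near. Qed.

Lemma shifted_vanish1 : lilo F one_ (fun t =>
  shifted_hessian f alpha t.2 t.1.1 - shifted_hessian f alpha d x).
Proof. exact: (@shifted_vanish (fun t => t.1.1) gradient_vanish1 cont1). Qed.

Lemma shifted_diff : lilo F dist2 (fun t => shifted_hessian f alpha t.2 t.1.1
  - shifted_hessian f alpha t.2 t.1.2 - dshifted_hessian d x (incr t)).
Proof.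
apply: lilo_entries => // i j e e0.
pose w t := partial (partial f i) j t.1.1 - partial (partial f i) j t.1.2
   - (incr t *m (\col_k partial (partial (partial f i) j) k x)) ord0 ord0.
have E (t : 'rV[R]_m * 'rV[R]_m * R) : (shifted_hessian f alpha t.2 t.1.1
     - shifted_hessian f alpha t.2 t.1.2 - dshifted_hessian d x (incr t)) i j =
  w t + (t.2 * (s t.1.1 - s t.1.2 - ds t) + (t.2 - d) * ds t) *+ (i == j).
  rewrite mx_sub2E; apply: etrans (shift_diff_arith _ _ _ _ _ _ _ _ _).
  exact: (congr2 (fun a b => a - b) (congr2 (fun a b => a - b)
    (shifted_hessianE _ _ _ _) (shifted_hessianE _ _ _ _)) (dshifted_hessianE _ _ _ _ _)).
under eq_near => t do rewrite E.
have [C C0 hC] := ds_bigo.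
have ed : 0 < e / 3 / C by rewrite divr_gt0// divr_gt0.
have es : 0 < e / 3 / (`|d| + 1) by rewrite !divr_gt0// ltr_wpDl.
have e3 : 0 < e / 3 by rewrite divr_gt0.
have hd r : 0 < r -> \forall t \near F, `|t.2 - d| <= r.
  move=> r0; apply: (@pair_near3 x d (fun d' => `|d' - d| <= r)).
  apply/nbhs_ballP; exists r => //= d'.
  by rewrite -ball_normE /ball_ /= distrC => /ltW.
have hw : \forall t \near F, `|w t| <= e / 3 * dist2 t.
  apply: (@pair_near12 x d (fun p q => `|partial (partial f i) j p
    - partial (partial f i) j q - ((p - q) *m
    (\col_k partial (partial (partial f i) j) k x)) ord0 ord0| <= e / 3 * `|p - q|)).
  by apply: Ck1_strict => //; exact: (CkS_partial j (CkS_partial i fC3)).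
near=> t.
have k1 : `|w t| <= e / 3 * dist2 t by near: t.
have k2 : `|s t.1.1 - s t.1.2 - ds t| <= e / 3 / (`|d| + 1) * dist2 t.
  by near: t; exact: s_diff.
have k3 : `|t.2 - d| <= e / 3 / C by near: t; exact: hd.
have k3' : `|t.2 - d| <= 1 by near: t; exact: hd.
have k4 : `|ds t| <= C * dist2 t by near: t.
rewrite (le_trans (ler_normD _ _))//.
have -> : e * dist2 t = e / 3 * dist2 t + (e / 3 * dist2 t + e / 3 * dist2 t) by field.
apply: lerD => //.
case: (i == j); last by rewrite mulr0n normr0 addr_ge0// mulr_ge0// ltW.
rewrite mulr1n (le_trans (ler_normD _ _))// (normrM t.2) (normrM (t.2 - d)); apply: lerD.
  have t2 : `|t.2| <= `|d| + 1.
    by rewrite -{1}(subrK d t.2) (le_trans (ler_normD _ _))// addrC lerD2l.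
  rewrite (@le_trans _ _ ((`|d| + 1) * (e / 3 / (`|d| + 1) * dist2 t)))//.
    by rewrite ler_pM.
  have dp : `|d| + 1 != 0 by rewrite gt_eqF// ltr_wpDl.
  by rewrite mulrA (mulrC (`|d| + 1)) divfK.
rewrite (@le_trans _ _ (e / 3 / C * (C * dist2 t)))//; first by rewrite ler_pM.
by rewrite mulrA divfK// gt_eqF.
Unshelve. all: by end_near. Qed.

(** The chain rule: the step is x - nqn_dir (g x) (A x), where g is C^2, and A is
    the sum of the C^1 function H and of a multiple of a power of |g|. *)
Theorem nqn_fixed_diff (Q : 'M[R]_m) (dd : 'rV[R]_m) : Q *m Q^T = 1%:M ->
  shifted_hessian f alpha d x = Q^T *m diag_mx dd *m Q ->
  shifted_hessian f alpha d x \in unitmx ->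
  lilo F dist2 (fun t => nqn_fixed t.2 t.1.1 - nqn_fixed t.2 t.1.2 -
    (incr t - dnqn_dir Q dd g (shifted_hessian f alpha d x) (incr t *m H)
                (dshifted_hessian d x (incr t)))).
Proof.
move=> QQ DE Du.
pose A1 (t : 'rV[R]_m * 'rV[R]_m * R) := shifted_hessian f alpha t.2 t.1.1.
pose A2 (t : 'rV[R]_m * 'rV[R]_m * R) := shifted_hessian f alpha t.2 t.1.2.
pose D := shifted_hessian f alpha d x.
have v1 : lilo F one_ (fun t => A1 t - D) by exact: shifted_vanish1.
have v2 : lilo F one_ (fun t => A2 t - D).
  exact: (@shifted_vanish (fun t => t.1.2) gradient_vanish2 cont2).
have t1 : \forall t \near F, (A1 t)^T = A1 t.
  by near=> t; exact: shifted_hessian_tr.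
have t2 : \forall t \near F, (A2 t)^T = A2 t.
  by near=> t; exact: shifted_hessian_tr.
have h := @nqn_dir_diff R _ F (pair_filter_filter x d) m D Q dd QQ DE Du dist2 A1 A2
  (fun t => dshifted_hessian d x (incr t)) (fun t => gradient f t.1.1)
  (fun t => gradient f t.1.2) (fun t => incr t *m H) g dist20 t1 t2 v1 v2
  shifted_diff dshifted_bigo gradient_vanish2 gradient_diff
  dgradient_bigo.
refine (near_lilo _ (liloN h)).
near=> t; rewrite /nqn_fixed /incr -/D -/(A1 t) -/(A2 t).
move: (nqn_dir _ _) (nqn_dir _ _) (dnqn_dir _ _ _ _ _ _) => a b c.
by apply/matrixP => i j; rewrite !mxE; ring.
Unshelve. all: by end_near. Qed.

End AtPoint.
End FixedShift.

(** * Nondegenerate critical points *)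

Section StepLocal.
Context {R : realType} {m : nat}.
Variables (f : 'rV[R]_m -> R) (alpha : R).
Hypotheses (fC3 : Ck 3 f) (alpha_gt0 : 0 < alpha).
Implicit Types (x p q h z : 'rV[R]_m).

Lemma pair_filter_ball x d (P : 'rV[R]_m * 'rV[R]_m * R -> Prop) :
  (\forall t \near pair_filter x d, P t) ->
  exists2 r : R, 0 < r & forall p q d',
    `|p - x| < r -> `|q - x| < r -> `|d' - d| < r -> P (p, q, d').
Proof.
move=> [[U V] [/= [[U1 U2] [/= U1x U2x] hU] Vd] hP].
have /nbhs_ballP[r1 /= r10 hr1] := U1x.
have /nbhs_ballP[r2 /= r20 hr2] := U2x.
have /nbhs_ballP[r3 /= r30 hr3] := Vd.
exists (Num.min r1 (Num.min r2 r3)); first by rewrite !lt_min r10 r20.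
move=> p q d'; rewrite !lt_min => /and3P[p1 _ _] /and3P[_ q2 _] /and3P[_ _ d3].
apply: (hP (p, q, d')); split => /=.
  apply: (hU (p, q)); split => /=.
    by apply: hr1; rewrite -ball_normE /ball_ /= distrC.
  by apply: hr2; rewrite -ball_normE /ball_ /= distrC.
by apply: hr3; rewrite -ball_normE /ball_ /= distrC.
Qed.

Lemma shifted_unit_ball x d : shifted_hessian f alpha d x \in unitmx ->
  exists2 r : R, 0 < r & forall p d', `|p - x| < r -> `|d' - d| < r ->
    shifted_hessian f alpha d' p \in unitmx.
Proof.
move=> Du.
have v1 := shifted_vanish1 fC3 alpha_gt0 x d.
have u1 : \forall t \near pair_filter x d,
    shifted_hessian f alpha t.2 t.1.1 \in unitmx.
  exact: near_unitmx Du v1.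
have [r r0 hr] := @pair_filter_ball x d
  (fun t => shifted_hessian f alpha t.2 t.1.1 \in unitmx) u1.
exists r; first exact: r0.
move=> p d' px dd.
exact: (hr p p d' px px dd).
Qed.

(** The first index is the smallest one, so it is selected as soon as its shift is
    admissible. *)
Lemma nqn_step_fixed (delta : 'I_m.+1 -> R) p :
  shifted_hessian f alpha (delta ord0) p \in unitmx ->
  nqn_step f alpha delta p = nqn_fixed f alpha (delta ord0) p.
Proof.
move=> Du; rewrite /nqn_step /nqn_fixed /nqn_dir /sgnmx mulmxBr.
suff -> : nqn_delta f alpha delta p = delta ord0 by [].
rewrite /nqn_delta; case: ifP => // _; congr delta.
by case: arg_minnP => // i _ /(_ _ Du); rewrite leqn0 => /eqP i0; apply: val_inj.
Qed.

Section Critical.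
Variable z : 'rV[R]_m.
Hypotheses (gz : gradient f z = 0) (Hz : hessian f z \in unitmx).

Lemma shifted_critical d : shifted_hessian f alpha d z = hessian f z.
Proof.
rewrite /shifted_hessian gz enorm0 powR0 ?mulr0 ?raddf0 ?addr0//.
by rewrite gt_eqF// addr_gt0.
Qed.

(** The terms of the derivative that contain the gradient vanish, and what remains
    is 1 - H H^-1 S = 1 - S with S the sign of H: it kills the positive eigenspace
    and doubles the negative one. *)
Lemma critical_strict d e : 0 < e ->
  exists2 r : R, 0 < r & forall p q, `|p - z| < r -> `|q - z| < r ->
    shifted_hessian f alpha d p \in unitmx /\
    `|nqn_fixed f alpha d p - nqn_fixed f alpha d q -
      (p - q) *m (1%:M - sgnmx (hessian f z))| <= e * `|p - q|.
Proof.
move=> e0.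
have [Q [l [QQ HE]]] := spectral (hessian_tr fC3 z).
have DE : shifted_hessian f alpha d z = Q^T *m diag_mx l *m Q.
  by rewrite shifted_critical.
have Du : shifted_hessian f alpha d z \in unitmx by rewrite shifted_critical.
have [r1 r10 hr1] := pair_filter_ball
  (nqn_fixed_diff fC3 alpha_gt0 QQ DE Du e0).
have [r2 r20 hr2] := shifted_unit_ball Du.
exists (Num.min r1 r2); first by rewrite lt_min r10.
move=> p q; rewrite !lt_min => /andP[p1 p2] /andP[q1 q2].
have d0 (r : R) : 0 < r -> `|d - d| < r by rewrite subrr normr0.
split; first exact: hr2 p d p2 (d0 _ r20).
have := hr1 p q d p1 q1 (d0 _ r10); rewrite /dist2 /=.
rewrite /dnqn_dir gz !mul0mx subr0 addr0 shifted_critical mulmxK//.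
by rewrite (mulmxBr _ 1%:M) mulmx1.
Qed.

End Critical.
End StepLocal.

(** * Generic shifts *)

Section GenericShift.
Context {R : realType} {m : nat}.
Variables (Q : 'M[R]_m) (l g : 'rV[R]_m) (s : R) (n : 'I_m -> 'M[R]_m)
  (sg : 'I_m -> R).
Hypotheses (Qu : Q \in unitmx) (s0 : s != 0).

(** The matrix of the derivative of the fixed-shift step, in an eigenbasis of
    the Hessian with eigenvalues l; e stands for the signs of the eigenvalues
    l + d s of the shifted Hessian and c for their divided differences. *)
Definition step_jacobian (d : R) (e : 'I_m -> R) (c : 'I_m -> 'I_m -> R) : 'M[R]_m :=
  \matrix_(k, j) (Q j k * (1 - l ord0 j * e j / (l ord0 j + d * s))
    + \sum_i g ord0 i * n k i j * e j / ((l ord0 i + d * s) * (l ord0 j + d * s))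
    + g ord0 j * (d * sg k) * e j / ((l ord0 j + d * s) * (l ord0 j + d * s))
    - \sum_i g ord0 i * n k i j * c i j / (l ord0 i + d * s)).

(* In the variable u = 1 / d: tau i is u (l i + d s), and PZ is Pi^2 times the
   matrix of the derivative, cleared of its denominators. *)
Let tau i : {poly R} := l ord0 i *: 'X + s%:P.
Let rho i : {poly R} := \prod_(k | k != i) tau k.
Let Pi : {poly R} := \prod_k tau k.

Let PZ (e : 'I_m -> R) (c : 'I_m -> 'I_m -> R) : 'M[{poly R}]_m :=
  \matrix_(k, j) (Q j k *: (Pi * Pi - (l ord0 j * e j) *: ('X * rho j * Pi))
    + \sum_i (g ord0 i * n k i j * e j) *: ('X * rho i * ('X * rho j))
    + (g ord0 j * sg k * e j) *: ('X * rho j * rho j)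
    - \sum_i (g ord0 i * n k i j * c i j) *: ('X * rho i * Pi)).

Let PZE e c u k j : (PZ e c k j).[u] =
  Q j k * (Pi.[u] * Pi.[u] - (l ord0 j * e j) * (u * (rho j).[u] * Pi.[u]))
    + \sum_i (g ord0 i * n k i j * e j) * (u * (rho i).[u] * (u * (rho j).[u]))
    + (g ord0 j * sg k * e j) * (u * (rho j).[u] * (rho j).[u])
    - \sum_i (g ord0 i * n k i j * c i j) * (u * (rho i).[u] * Pi.[u]).
Proof.
rewrite mxE !(hornerD, hornerN, hornerZ, hornerM, hornerX) !horner_sum.
congr (_ + _ + _ - _); apply: eq_bigr => i _.
  by rewrite !(hornerZ, hornerM, hornerX).
by rewrite !(hornerZ, hornerM, hornerX).
Qed.

Let PZ0 e c : \det (PZ e c) != 0.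
Proof.
have Pi0 : Pi.[0] != 0.
  rewrite /Pi horner_prod; apply/prodf_neq0 => i _.
  by rewrite /tau !hornerE.
apply/eqP => h; have : (\det (PZ e c)).[0] = 0 by rewrite h horner0.
rewrite -[_.[0]]/(horner_eval 0 _) -det_map_mx.
have -> : map_mx (horner_eval 0) (PZ e c) = (Pi.[0] * Pi.[0]) *: Q^T.
  apply/matrixP => k j; rewrite [LHS]mxE [RHS]mxE [Q^T k j]mxE.
  rewrite -[LHS]/((PZ e c k j).[0]) PZE !big1 => [|i _|i _].
  - by rewrite !(mul0r, mulr0, subr0, addr0) mulrC.
  - by rewrite !(mul0r, mulr0).
  - by rewrite !(mul0r, mulr0).
rewrite detZ det_tr => /eqP; rewrite mulf_eq0 expf_eq0 mulf_eq0 orbb.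
move: Qu; rewrite unitmxE unitfE => /negPf ->.
by rewrite (negPf Pi0) andbF.
Qed.

(** In the variable 1/d the matrix is, up to a scalar factor, polynomial, and at
    1/d = 0 it is a nonzero multiple of Q^T; so its determinant has finitely many
    roots. *)
Lemma step_jacobian_unit e c : exists B : seq R, forall d, d \notin B ->
  (forall i, l ord0 i + d * s != 0) -> step_jacobian d e c \in unitmx.
Proof.
exists (0 :: [seq u^-1 | u <- rootsR (\det (PZ e c))]) => d.
rewrite inE negb_or => /andP[d0 dB] D0.
pose u := d^-1; have u0 : u != 0 by rewrite invr_eq0.
pose D i := l ord0 i + d * s.
have tauE i : (tau i).[u] = u * D i.
  by rewrite /tau !hornerE /D mulrDr mulrA mulVf// mul1r mulrC.
have PiE i : Pi.[u] = (tau i).[u] * (rho i).[u].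
  by rewrite -hornerM /Pi (bigD1 i).
have Pi0 : Pi.[u] != 0.
  rewrite /Pi horner_prod; apply/prodf_neq0 => i _.
  by rewrite tauE; apply: mulf_neq0 => //; exact: D0.
have xE i : u * (rho i).[u] = Pi.[u] / D i.
  by rewrite (PiE i) tauE mulrAC mulfK//; exact: D0.
have : (\det (PZ e c)).[u] != 0.
  apply: contra dB => h; apply/mapP; exists u; last by rewrite invrK.
  by rewrite -(roots_on_rootsR (PZ0 e c)) in_itv.
rewrite -[_.[u]]/(horner_eval u _) -det_map_mx.
have -> : map_mx (horner_eval u) (PZ e c) = (Pi.[u] * Pi.[u]) *: step_jacobian d e c.
  apply/matrixP => k j; rewrite [LHS]mxE [RHS]mxE [X in _ * X]mxE.
  rewrite -[LHS]/((PZ e c k j).[u]) PZE.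
  have distr4 (K a b c' e' : R) :
    K * (a + b + c' - e') = K * a + K * b + K * c' - K * e' by ring.
  rewrite distr4 !mulr_sumr.
  have Dj0 : D j != 0 by exact: D0.
  have rE : (rho j).[u] = d * (Pi.[u] / D j).
    by rewrite -xE mulrA mulfV// mul1r.
  congr (_ + _ + _ - _); first by rewrite xE -/(D j); field.
  - apply: eq_bigr => i _; have Di0 : D i != 0 by exact: D0.
    by rewrite !xE -/(D i) -/(D j); field; rewrite Di0 Dj0.
  - by rewrite xE rE -/(D j); field.
  - apply: eq_bigr => i _; have Di0 : D i != 0 by exact: D0.
    by rewrite xE -/(D i); field.
rewrite detZ mulf_eq0 negb_or => /andP[_ h].
by rewrite unitmxE unitfE.
Qed.

End GenericShift.

Lemma linear_rowE (R : realType) m n (L : 'rV[R]_m -> 'rV[R]_n) :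
  (forall a u v, L (a *: u + v) = a *: L u + L v) ->
  forall h, L h = h *m (\matrix_k L (delta_mx ord0 k)).
Proof.
move=> lin h.
have LD u v : L (u + v) = L u + L v by rewrite -[u]scale1r lin !scale1r.
have L0 : L 0 = 0 by apply: (@addrI _ (L 0)); rewrite -LD !addr0.
have LZ a u : L (a *: u) = a *: L u by rewrite -[a *: u]addr0 lin L0 addr0.
rewrite {1}[h]row_sum_delta (big_morph L LD L0) mulmx_sum_row.
by apply: eq_bigr => i _; rewrite LZ rowK.
Qed.

Lemma mx_linE (R : realType) m n (a : R) (A B : 'M[R]_(m, n)) i j :
  (a *: A + B) i j = a * A i j + B i j.
Proof. by rewrite !mxE. Qed.

Section GenericGood.
Context {R : realType} {m : nat}.
Variables (f : 'rV[R]_m -> R) (alpha : R).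
Hypotheses (fC3 : Ck 3 f) (alpha_gt0 : 0 < alpha).

(** Nonsingularity of the derivative of the step at x, in a form that is open in
    (x, d) and that speaks of the step itself. *)
Definition good_shift x d := exists r c : R, [/\ 0 < r, 0 < c &
  forall p q d', `|p - x| < r -> `|q - x| < r -> `|d' - d| < r ->
    shifted_hessian f alpha d' p \in unitmx /\
    c * `|p - q| <= `|nqn_fixed f alpha d' p - nqn_fixed f alpha d' q|].

Variable x : 'rV[R]_m.
Hypothesis gx : gradient f x != 0.
Let g := gradient f x.
Let H := hessian f x.
Let s := enorm g `^ (1 + alpha).
Variables (Q : 'M[R]_m) (l : 'rV[R]_m).
Hypotheses (QQ : Q *m Q^T = 1%:M) (HE : H = Q^T *m diag_mx l *m Q).

Let s0 : s != 0. Proof. by rewrite gt_eqF// powR_gt0// enorm_gt0. Qed.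

Let dd d : 'rV[R]_m := \row_i (l ord0 i + d * s).

Lemma shifted_spectral d :
  shifted_hessian f alpha d x = Q^T *m diag_mx (dd d) *m Q.
Proof.
rewrite /shifted_hessian -/g -/s -/H HE.
have -> : diag_mx (dd d) = diag_mx l + (d * s)%:M.
  apply/matrixP => i j; rewrite !mxE; case: eqP => [->|_]; rewrite ?mulr1n ?mulr0n ?addr0//.
rewrite mulmxDr mulmxDl; congr (_ + _).
by rewrite mul_mx_scalar -scalemxAl (mulmx1C QQ) scalemx1.
Qed.

Lemma diag_conj_inv d : (forall i, dd d ord0 i != 0) ->
  invmx (Q^T *m diag_mx (dd d) *m Q) =
  Q^T *m diag_mx (\row_i (dd d ord0 i)^-1) *m Q.
Proof.
move=> d0; set A := Q^T *m diag_mx (dd d) *m Q; set B := RHS.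
have BA : B *m A = 1%:M.
  rewrite /A /B diag_conj_mul// -[RHS](mulmx1C QQ) -[in RHS](mulmx1 Q^T).
  congr (_ *m _ *m _); rewrite -diag_const_mx; congr diag_mx.
  by apply/rowP => i; rewrite !mxE mulVf//; have := d0 i; rewrite mxE.
have Au : A \in unitmx by case: (mulmx1_unit BA).
by rewrite -[LHS]mul1mx -BA mulmxK.
Qed.

Let L d (h : 'rV[R]_m) := h - dnqn_dir Q (dd d) g (shifted_hessian f alpha d x)
  (h *m H) (dshifted_hessian f alpha d x h).

Lemma dshifted_linear d (a : R) (u v : 'rV[R]_m) :
  dshifted_hessian f alpha d x (a *: u + v) =
  a *: dshifted_hessian f alpha d x u + dshifted_hessian f alpha d x v.
Proof.
apply/matrixP => i j; have E h := dshifted_hessianE f alpha d x h i j.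
apply: (etrans (E _)); apply: (etrans _ (esym (mx_linE _ _ _ _ _))).
apply: (etrans _ (esym (congr2 (fun X Y => a * X + Y) (E u) (E v)))).
rewrite !mulmxDl -!scalemxAl dotvDl dotvZl mx_linE.
move: ((u *m _) _ _) ((v *m _) _ _) (dotv _ _) (dotv _ _) => A B C D.
by case: (i == j); rewrite ?mulr1n ?mulr0n; ring.
Qed.

Lemma dsgnmx_linear (P : 'M[R]_m) (e : 'rV[R]_m) (a : R) (M N : 'M[R]_m) :
  dsgnmx P e (a *: M + N) = a *: dsgnmx P e M + dsgnmx P e N.
Proof.
rewrite /dsgnmx scalemxAl scalemxAr -mulmxDl -mulmxDr; congr (_ *m _ *m _).
rewrite mulmxDr mulmxDl -scalemxAr -scalemxAl.
move: (P *m M *m _) (P *m N *m _) => X Y.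
by apply/matrixP => i j; rewrite !mxE; ring.
Qed.

Lemma L_linear d a u v : L d (a *: u + v) = a *: L d u + L d v.
Proof.
rewrite /L /dnqn_dir dshifted_linear dsgnmx_linear.
rewrite !(mulmxDl, mulmxDr, =^~ scalemxAl, =^~ scalemxAr).
move: (u *m _ *m _ *m _) (v *m _ *m _ *m _) (g *m _ *m dsgnmx _ _ _)
  (g *m _ *m dsgnmx _ _ _) (g *m _ *m _) (g *m _ *m _) => A B C D E F.
by apply/matrixP => i j; rewrite !mxE; ring.
Qed.

Let gQ := g *m Q^T.
Let n k := Q *m dhessian f x (delta_mx ord0 k) *m Q^T.
Let sg k := norm_power_coef alpha g * dotv (delta_mx ord0 k *m H) g.

(** The rows on the left are the images of the basis vectors under the derivative
    of the step; they are expressed in the eigenbasis Q. *)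
Lemma L_jacobian d : (forall i, dd d ord0 i != 0) ->
  (\matrix_k L d (delta_mx ord0 k)) *m Q^T =
  step_jacobian Q l gQ s n sg d (fun i => Num.sg (l ord0 i + d * s))
    (fun i j => sgn_divdiff (dd d) i j).
Proof.
move=> d0; have QQ' := mulmx1C QQ.
apply/row_matrixP => k; rewrite row_mul rowK; apply/rowP => j.
rewrite [RHS]mxE [RHS]mxE.
pose N := Q *m dshifted_hessian f alpha d x (delta_mx ord0 k) *m Q^T.
have NE i : N i j = n k i j + (d * sg k) *+ (i == j).
  rewrite /N /dshifted_hessian mulmxDr mulmxDl mxE -/(n k) -/g -/H -/(sg k).
  congr (_ + _); rewrite mul_mx_scalar -scalemxAl QQ scalemx1.
  by rewrite mxE.
pose I := \row_i (dd d ord0 i)^-1.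
pose Sg := \row_i Num.sg (dd d ord0 i).
have gE : g = gQ *m Q by rewrite /gQ -mulmxA QQ' mulmx1.
have invE : invmx (shifted_hessian f alpha d x) = Q^T *m diag_mx I *m Q.
  by rewrite shifted_spectral diag_conj_inv.
have sgE : sgnmx (shifted_hessian f alpha d x) = Q^T *m diag_mx Sg *m Q.
  exact: sgnmxE (shifted_spectral d).
have canc (p : nat) (A : 'M[R]_(p, m)) : A *m Q *m Q^T = A.
  by rewrite -mulmxA QQ mulmx1.
have t1 : (delta_mx ord0 k : 'rV[R]_m) *m H *m invmx (shifted_hessian f alpha d x)
    *m sgnmx (shifted_hessian f alpha d x) *m Q^T =
  (delta_mx ord0 k *m Q^T) *m diag_mx l *m diag_mx I *m diag_mx Sg.
  by rewrite invE sgE HE !mulmxA !canc.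
have t2 : g *m (invmx (shifted_hessian f alpha d x)
     *m dshifted_hessian f alpha d x (delta_mx ord0 k)
     *m invmx (shifted_hessian f alpha d x))
    *m sgnmx (shifted_hessian f alpha d x) *m Q^T =
  gQ *m diag_mx I *m N *m diag_mx I *m diag_mx Sg.
  by rewrite invE sgE gE /N !mulmxA !canc.
have t3 : g *m invmx (shifted_hessian f alpha d x)
    *m dsgnmx Q (dd d) (dshifted_hessian f alpha d x (delta_mx ord0 k)) *m Q^T =
  gQ *m diag_mx I *m (\matrix_(i, j) (N i j * sgn_divdiff (dd d) i j)).
  by rewrite invE gE /dsgnmx -/N !mulmxA !canc.
rewrite /L /dnqn_dir mulmxBl mulmxDl mulmxBl t1 t2 t3.
have rowjk : (delta_mx ord0 k *m Q^T : 'rV[R]_m) ord0 j = Q j k.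
  by rewrite -rowE !mxE.
have e1 : (delta_mx ord0 k *m Q^T *m diag_mx l *m diag_mx I *m diag_mx Sg
    : 'rV[R]_m) ord0 j = Q j k * l ord0 j * (dd d ord0 j)^-1 * Num.sg (dd d ord0 j).
  rewrite !mul_mx_diag mxE [X in X * _]mxE [X in X * _ * _]mxE rowjk.
  by rewrite [I _ _]mxE [Sg _ _]mxE.
have e2 : (gQ *m diag_mx I *m N *m diag_mx I *m diag_mx Sg : 'rV[R]_m) ord0 j =
  \sum_i gQ ord0 i * (dd d ord0 i)^-1 * N i j * (dd d ord0 j)^-1 * Num.sg (dd d ord0 j).
  rewrite 2!mul_mx_diag mxE [X in X * _]mxE [X in X * _ * _]mxE.
  rewrite [I _ _]mxE [Sg _ _]mxE -mulrA mulr_suml.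
  apply: eq_bigr => i _; rewrite mul_mx_diag [X in X * _ * _]mxE [I _ _]mxE.
  by rewrite !mulrA.
have e3 : (gQ *m diag_mx I *m (\matrix_(i, j) (N i j * sgn_divdiff (dd d) i j))
    : 'rV[R]_m) ord0 j =
  \sum_i gQ ord0 i * (dd d ord0 i)^-1 * (N i j * sgn_divdiff (dd d) i j).
  rewrite mxE; apply: eq_bigr => i _; rewrite mul_mx_diag [X in X * _]mxE.
  by rewrite [I _ _]mxE [X in _ * X]mxE.
have Lsub (A B C D : 'rV[R]_m) : (A - (B - C + D)) ord0 j =
    A ord0 j - (B ord0 j - C ord0 j + D ord0 j) by rewrite !mxE.
rewrite Lsub rowjk e1 e2 e3.
have ddE i : dd d ord0 i = l ord0 i + d * s by rewrite mxE.
have -> : \sum_i gQ ord0 i * (dd d ord0 i)^-1 * N i j * (dd d ord0 j)^-1 * Num.sg (dd d ord0 j) =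
  \sum_i gQ ord0 i * n k i j * Num.sg (l ord0 j + d * s) /
      ((l ord0 i + d * s) * (l ord0 j + d * s)) +
  gQ ord0 j * (d * sg k) * Num.sg (l ord0 j + d * s) /
      ((l ord0 j + d * s) * (l ord0 j + d * s)).
  rewrite (bigD1 j)//= [in RHS](bigD1 j)//= -addrA [X in _ = _ + X]addrC addrA.
  congr (_ + _).
    by rewrite NE eqxx mulr1n !ddE invfM; ring.
  apply: eq_bigr => i ij; rewrite NE (negPf ij) mulr0n addr0 !ddE invfM; ring.
have -> : \sum_i gQ ord0 i * (dd d ord0 i)^-1 * (N i j * sgn_divdiff (dd d) i j) =
  \sum_i gQ ord0 i * n k i j * sgn_divdiff (dd d) i j / (l ord0 i + d * s).
  apply: eq_bigr => i _; rewrite NE ddE.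
  have [->|ij] := eqVneq i j.
    by rewrite /sgn_divdiff subrr mul0r !mulr0 mul0r.
  by rewrite mulr0n addr0; ring.
rewrite ddE; ring.
Qed.

End GenericGood.

Section GenericShiftGood.
Context {R : realType} {m : nat}.
Variables (f : 'rV[R]_m -> R) (alpha : R).
Hypotheses (fC3 : Ck 3 f) (alpha_gt0 : 0 < alpha).

Lemma unit_expands n (L : 'M[R]_n) : L \in unitmx ->
  exists2 c : R, 0 < c & forall h : 'rV[R]_n, 2 * c * `|h| <= `|h *m L|.
Proof.
move=> Lu; pose K := n%:R * `|invmx L| + 1.
have K0 : 0 < K by rewrite ltr_wpDl// mulr_ge0.
exists (2 * K)^-1; first by rewrite invr_gt0 mulr_gt0.
move=> h; rewrite invfM mulrA mulfV// mul1r mulrC ler_pdivrMr//.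
rewrite -{1}(mulmxK Lu h) (le_trans (mulmx_norm_le _ _))//.
by rewrite mulrAC mulrC ler_wpM2l// /K lerDl.
Qed.

(** The signs of the eigenvalues l i + d s, hence also their divided differences in
    the derivative, are constants for each sign pattern b: there is one finite set
    of exceptions for each of the finitely many patterns. *)
Theorem generic_good x : gradient f x != 0 ->
  exists B : seq R, forall d, d \notin B -> good_shift f alpha x d.
Proof.
move=> gx; have [Q [l [QQ HE]]] := spectral (hessian_tr fC3 x).
pose g := gradient f x; pose s := enorm g `^ (1 + alpha).
have s0 : s != 0 by rewrite gt_eqF// powR_gt0// enorm_gt0.
have Qu : Q \in unitmx by case: (mulmx1_unit QQ).
pose gQ := g *m Q^T.
pose n k := Q *m dhessian f x (delta_mx ord0 k) *m Q^T.
pose sg k := norm_power_coef alpha g * dotv (delta_mx ord0 k *m hessian f x) g.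
pose e (b : {ffun 'I_m -> bool}) i : R := if b i then 1 else -1.
(* The differences of the eigenvalues are independent of the shift. *)
pose c b i j : R := (e b j - e b i) / (l ord0 j - l ord0 i).
have /choice[B hB] : forall b, exists B : seq R, forall d, d \notin B ->
    (forall i, l ord0 i + d * s != 0) ->
    step_jacobian Q l gQ s n sg d (e b) (c b) \in unitmx.
  by move=> b; exact: step_jacobian_unit.
exists ([seq - (l ord0 i / s) | i <- enum 'I_m] ++ flatten [seq B b | b <- enum {: {ffun 'I_m -> bool}}]).
move=> d; rewrite mem_cat negb_or => /andP[d1 d2].
have D0 i : l ord0 i + d * s != 0.
  apply: contra d1 => /eqP h; apply/mapP; exists i; first by rewrite mem_enum.
  apply: (mulIf s0); rewrite mulNr divfK//; apply/eqP.
  by rewrite -addr_eq0 addrC h.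
pose b : {ffun 'I_m -> bool} := [ffun i => 0 < l ord0 i + d * s].
have eE i : e b i = Num.sg (l ord0 i + d * s).
  by rewrite /e ffunE; case: sgrP (D0 i) => //; rewrite eqxx.
pose dd : 'rV[R]_m := \row_i (l ord0 i + d * s).
have dd0 i : dd ord0 i != 0 by rewrite mxE.
have cE i j : c b i j = sgn_divdiff dd i j.
  by rewrite /c /sgn_divdiff !eE !mxE; congr (_ / _); ring.
have Ju : step_jacobian Q l gQ s n sg d (fun i => Num.sg (l ord0 i + d * s))
    (fun i j => sgn_divdiff dd i j) \in unitmx.
  have <- : e b = (fun i => Num.sg (l ord0 i + d * s)) by apply/funext.
  have <- : c b = (fun i j => sgn_divdiff dd i j).
    by apply/funext => i; apply/funext => j.
  apply: hB => //; apply: contra d2 => h; apply/flattenP; exists (B b) => //.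
  by apply/mapP; exists b; first by rewrite mem_enum.
pose D := shifted_hessian f alpha d x.
have DE : D = Q^T *m diag_mx dd *m Q by exact: shifted_spectral.
have Du : D \in unitmx.
  rewrite DE !unitmx_mul unitmx_tr Qu andbT /= unitmxE det_diag unitfE.
  by apply/prodf_neq0 => i _.
pose L (h : 'rV[R]_m) := h - dnqn_dir Q dd g D (h *m hessian f x)
   (dshifted_hessian f alpha d x h).
pose Lm := \matrix_k L (delta_mx ord0 k).
have LE h : L h = h *m Lm.
  exact: (linear_rowE (L_linear f alpha x Q l d) h).
have Lu : Lm \in unitmx.
  have := L_jacobian (f := f) (alpha := alpha) (x := x) QQ HE dd0.
  move=> E; move: Ju; rewrite -[step_jacobian _ _ _ _ _ _ _ _ _]E.
  by rewrite unitmx_mul => /andP[].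
have [k k0 hk] := unit_expands Lu.
have [r1 r10 hr1] := pair_filter_ball (nqn_fixed_diff fC3 alpha_gt0 QQ DE Du k0).
have [r2 r20 hr2] := shifted_unit_ball fC3 alpha_gt0 Du.
exists (Num.min r1 r2), k; split; [by rewrite lt_min r10 | exact: k0 | ].
move=> p q d'; rewrite !lt_min => /andP[p1 p2] /andP[q1 q2] /andP[dd1 dd2].
split; first exact: (hr2 p d' p2 dd2).
have : `|nqn_fixed f alpha d' p - nqn_fixed f alpha d' q - (p - q) *m Lm|
    <= k * `|p - q| by rewrite -LE; exact: (hr1 p q d' p1 q1 dd1).
have := hk (p - q).
move: (nqn_fixed f alpha d' p - nqn_fixed f alpha d' q) => y h1 h2.
have : `|(p - q) *m Lm| <= `|y| + k * `|p - q|.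
  rewrite -(subKr y ((p - q) *m Lm)) (le_trans (ler_normB _ _))// lerD2l.
  exact: h2.
lra.
Qed.

End GenericShiftGood.

(** * Null sets *)

Section NullSets.
Context {R : realType} {m : nat}.
Hypothesis m_gt0 : (0 < m)%N.
Implicit Types (A B : set 'rV[R]_m).

(** Null sets, by covers with cubes for the sup norm. Bounding the sums over
    finite sets of indices avoids any reference to the order of summation. *)
Definition cube_null A := forall e : R, 0 < e ->
  exists (c : nat -> 'rV[R]_m) (r : nat -> R), [/\ forall k, 0 <= r k,
    forall x, A x -> exists k, `|x - c k| <= r k &
    forall s : seq nat, uniq s -> \sum_(k <- s) (2 * r k) ^+ m <= e].

Lemma null_of_cover A : (forall e : R, 0 < e ->
  exists (I : countType) (c : I -> 'rV[R]_m) (r : I -> R), [/\ forall k, 0 <= r k,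
    forall x, A x -> exists k, `|x - c k| <= r k &
    forall s : seq I, uniq s -> \sum_(k <- s) (2 * r k) ^+ m <= e]) ->
  cube_null A.
Proof.
move=> h e /h[I [c [r [r0 cov sum]]]].
exists (fun n => if pickle_inv n is Some i then c i else 0).
exists (fun n => if pickle_inv n is Some i then r i else 0); split.
- by move=> k; case: pickle_inv.
- by move=> x /cov[k xk]; exists (pickle k); rewrite pickleK_inv.
- move=> s us; rewrite (_ : \sum_(k <- s) _ =
    \sum_(i <- pmap (@pickle_inv I) s) (2 * r i) ^+ m).
    by apply: sum; apply: (pmap_uniq (@pickle_invK I)).
  elim: s {us} => [|k s IH] /=; first by rewrite !big_nil.
  rewrite big_cons IH; case: (pickle_inv k) => [i|] /=; first by rewrite big_cons.
  by rewrite mulr0 expr0n gtn_eqF// add0r.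
Qed.

Lemma null_sub A B : A `<=` B -> cube_null B -> cube_null A.
Proof.
move=> AB nB e /nB[c [r [r0 cov sum]]]; exists c, r; split => // x /AB.
exact: cov.
Qed.

Lemma sum_partition (I J : eqType) (p : I -> J) (s : seq I) (t : seq J) (w : I -> R) :
  uniq t -> {subset [seq p x | x <- s] <= t} ->
  \sum_(x <- s) w x = \sum_(j <- t) \sum_(x <- s | p x == j) w x.
Proof.
move=> ut st; under [RHS]eq_bigr => j _ do rewrite big_mkcond.
rewrite exchange_big /= big_seq [RHS]big_seq; apply: eq_bigr => x xs.
rewrite (bigD1_seq (p x)) ?eqxx//=; last by apply: st; exact: map_f.
by rewrite big1 ?addr0// => j; rewrite eq_sym => /negPf ->.
Qed.

Lemma sum_sub_uniq (I : eqType) (s t : seq I) (w : I -> R) : (forall i, 0 <= w i) ->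
  uniq s -> uniq t -> {subset s <= t} -> \sum_(i <- s) w i <= \sum_(i <- t) w i.
Proof.
move=> w0 us ut st; rewrite [leRHS](bigID (mem s)) /= -[leLHS]addr0 lerD//; last first.
  by rewrite sumr_ge0.
have P : perm_eq s [seq i <- t | i \in s].
  apply: uniq_perm => //; first exact: filter_uniq.
  by move=> i; rewrite mem_filter; case: (boolP (i \in s)) => // /st ->.
by rewrite (perm_big _ P) big_filter.
Qed.

Lemma sum_geometric (t : seq nat) : uniq t ->
  \sum_(j <- t) (2 ^- j.+1 : R) <= 1.
Proof.
move=> ut; pose N := (\max_(j <- t) j).+1.
have tN : {subset t <= iota 0 N}.
  by move=> j jt; rewrite mem_iota /= add0n ltnS; exact: leq_bigmax_seq.
rewrite (@le_trans _ _ (\sum_(j <- iota 0 N) (2 ^- j.+1 : R)))//.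
  by apply: sum_sub_uniq => //; exact: iota_uniq.
suff -> : \sum_(j <- iota 0 N) (2 ^- j.+1 : R) = 1 - 2 ^- N.
  by rewrite gerBl invr_ge0 exprn_ge0.
elim: (N) => [|n IH]; first by rewrite big_nil expr0 invr1 subrr.
rewrite -addn1 iotaD big_cat /= big_seq1 IH add0n addn1.
by rewrite exprS; field; rewrite expf_neq0.
Qed.

Lemma weight_ge0 (r : R) : 0 <= r -> 0 <= (2 * r) ^+ m.
Proof. by move=> r0; rewrite exprn_ge0// mulr_ge0. Qed.

(** The j-th set receives the share e / 2^(j + 1). *)
Lemma null_bigcup (J : countType) (A : J -> set 'rV[R]_m) :
  (forall j, cube_null (A j)) -> cube_null [set x | exists j, A j x].
Proof.
move=> nA; apply: null_of_cover => e e0.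
have ej (j : J) : 0 < e * 2 ^- (pickle j).+1 by rewrite mulr_gt0// invr_gt0 exprn_gt0.
have /choice[c /choice[r cr]] : forall j : J, exists (c : nat -> 'rV[R]_m) (r : nat -> R),
  [/\ forall k, 0 <= r k, forall x, A j x -> exists k, `|x - c k| <= r k &
   forall s : seq nat, uniq s ->
     \sum_(k <- s) (2 * r k) ^+ m <= e * 2 ^- (pickle j).+1].
  by move=> j; exact: nA (ej j).
exists (J * nat)%type, (fun i => c i.1 i.2), (fun i => r i.1 i.2); split.
- by move=> [j k]; have [] := cr j.
- by move=> x [j Ajx]; have [_ /(_ x Ajx)[k xk] _] := cr j; exists (j, k).
move=> s us; pose t := undup [seq i.1 | i <- s].
have ut : uniq t by exact: undup_uniq.
rewrite (@sum_partition _ _ fst s t)//; last by move=> j; rewrite mem_undup.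
rewrite (@le_trans _ _ (\sum_(j <- t) e * 2 ^- (pickle j).+1))//.
  apply: ler_sum => j _; have [_ _ h] := cr j.
  rewrite (le_trans _ (h [seq i.2 | i <- s & i.1 == j] _))//.
    rewrite big_map big_filter le_eqVlt; apply/orP; left; apply/eqP.
    by apply: eq_bigr => i /eqP ->.
  rewrite map_inj_in_uniq ?filter_uniq// => -[j1 k1] [j2 k2].
  by rewrite !mem_filter /= => /andP[/eqP -> _] /andP[/eqP -> _] ->.
rewrite -mulr_sumr -[leRHS]mulr1 ler_pM2l//.
rewrite -(big_map (@pickle J) xpredT (fun k => 2 ^- k.+1)).
by apply: sum_geometric; rewrite map_inj_uniq//; exact: (pcan_inj pickleK).
Qed.

Lemma cube_nullU A B : cube_null A -> cube_null B -> cube_null (A `|` B).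
Proof.
move=> nA nB; apply: (@null_sub _ [set x | exists b : bool, (if b then A else B) x]).
  by move=> x [Ax|Bx]; [exists true | exists false].
by apply: null_bigcup => -[].
Qed.

Lemma null_lebesgue A : cube_null A -> lebesgue_null A.
Proof.
move=> nA; rewrite /lebesgue_null /lebesgue_outer; apply/eqP.
rewrite eq_le; apply/andP; split; last first.
  apply: le_ereal_inf_tmp => _ [a [b [ab _ ->]]].
  apply: nneseries_ge0 => k _ _; rewrite lee_fin.
  by apply: prodr_ge0 => i _; rewrite subr_ge0.
apply/lee_addgt0Pr => e e0; rewrite add0e.
have [c [r [r0 cov sum]]] := nA e e0.
apply: (@le_trans _ _ (\sum_(0 <= k <oo) ((2 * r k) ^+ m)%:E)%E).
  apply: ereal_inf_lbound.
  exists (fun k => c k - const_mx (r k)), (fun k => c k + const_mx (r k)).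
  split.
  - by move=> k i; rewrite !mxE lerD2l (le_trans (y := 0))// oppr_le0.
  - move=> x /cov[k xk]; exists k => // i.
    have : `|x ord0 i - c k ord0 i| <= r k.
      by rewrite (le_trans _ xk)//; have := mx_entry_le (x - c k) ord0 i; rewrite !mxE.
    by rewrite !mxE ler_distl.
  - apply: eq_eseriesr => k _; congr (_%:E).
    rewrite (eq_bigr (fun=> 2 * r k)); first by rewrite prodr_const card_ord.
    by move=> i _; rewrite !mxE; ring.
apply: lime_le.
  by apply: is_cvg_nneseries => k _ _; rewrite lee_fin weight_ge0.
apply: nearW => n; rewrite sumEFin lee_fin.
by apply: (le_trans _ (sum (index_iota 0 n) (iota_uniq _ _))).
Qed.

(** A map that expands distances by a positive factor on B pulls cubes back to
    sets of comparable diameter, hence null sets to null sets. *)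
Lemma null_preimage (F : 'rV[R]_m -> 'rV[R]_m) A B (k : R) : 0 < k ->
  (forall p q, B p -> B q -> k * `|p - q| <= `|F p - F q|) ->
  cube_null A -> cube_null [set x | B x /\ A (F x)].
Proof.
move=> k0 FB nA e e0.
have K0 : 0 < (2 / k) ^+ m by rewrite exprn_gt0// divr_gt0.
have /nA[c [r [r0 cov sum]]] : 0 < e / (2 / k) ^+ m by rewrite divr_gt0.
have /choice[y hy] : forall i, exists y, (exists2 z, B z & `|F z - c i| <= r i) ->
    B y /\ `|F y - c i| <= r i.
  move=> i; have [[z Bz hz]|h] := pselect (exists2 z, B z & `|F z - c i| <= r i).
    by exists z.
  by exists 0 => /h.
exists y, (fun i => 2 / k * r i); split.
- by move=> i; rewrite mulr_ge0// divr_ge0// ltW.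
- move=> x [Bx /cov[i xi]]; exists i.
  have [By hyi] : B (y i) /\ `|F (y i) - c i| <= r i by apply: hy; exists x.
  rewrite mulrAC ler_pdivlMr// mulrC (le_trans (FB _ _ Bx By))//.
  have -> : F x - F (y i) = (F x - c i) - (F (y i) - c i).
    by rewrite opprB addrA subrK.
  by rewrite (le_trans (ler_normB _ _))// mulr_natl mulr2n lerD.
move=> s us; have := sum s us.
rewrite ler_pdivlMr// => h; rewrite (le_trans _ h)// mulr_suml.
rewrite le_eqVlt; apply/orP; left; apply/eqP; apply: eq_bigr => i _.
by rewrite mulrCA exprMn mulrC.
Qed.

(** There are N.+1 ^ p cells, the level sets of K, each of volume O(1 / N^m): the
    total volume is O(1 / N^(m - p)). *)
Lemma null_of_cells A (p : nat) (C : R) : (p < m)%N -> 0 <= C ->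
  (forall N, (0 < N)%N -> exists K : 'rV[R]_m -> {ffun 'I_p -> 'I_N.+1},
    forall x y, A x -> A y -> K x = K y -> `|x - y| <= C / N%:R) ->
  cube_null A.
Proof.
move=> pm C0 hK; apply: null_of_cover => e e0.
pose M := 2 ^+ p * (2 * C) ^+ m : R.
have M0 : 0 <= M by rewrite mulr_ge0// exprn_ge0// mulr_ge0.
pose N := (Num.truncn (M / e)).+1.
have N0 : (0 < N%:R :> R) by rewrite ltr0n.
have MN : M / N%:R <= e.
  rewrite ler_pdivrMr// mulrC -ler_pdivrMr// ltW//.
  by rewrite /N truncnS_gt.
have [K KP] := hK N isT.
have /choice[y hy] : forall k, exists y, (exists2 z, A z & K z = k) ->
    A y /\ K y = k.
  move=> k; have [[z Bz hz]|h] := pselect (exists2 z, A z & K z = k).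
    by exists z.
  by exists 0 => /h.
exists {ffun 'I_p -> 'I_N.+1}, y, (fun=> C / N%:R); split.
- by move=> _; rewrite divr_ge0// ltW.
- move=> x Ax; exists (K x); have [Ay Ky] := hy (K x) (ex_intro2 _ _ x Ax erefl).
  by apply: KP => //; rewrite Ky.
move=> s us; rewrite big_const_seq count_predT iter_addr_0.
rewrite (le_trans _ MN)//.
have szs : (size s)%:R <= (2 * N%:R) ^+ p :> R.
  rewrite (@le_trans _ _ (N.+1%:R ^+ p))//; last first.
    by apply: lerXn2r; rewrite ?nnegrE -?natrM// ler_nat mul2n -addnn -addn1 leq_add2l.
  rewrite -natrX ler_nat -(card_uniqP us) (leq_trans (max_card _))//.
  by rewrite card_ffun !card_ord.
rewrite (@le_trans _ _ ((2 * (C / N%:R)) ^+ m * (2 * N%:R) ^+ p))//.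
  rewrite -[leLHS]mulr_natr; apply: ler_wpM2l => //; rewrite weight_ge0// divr_ge0// ltW.
have -> : (2 * (C / N%:R)) ^+ m * (2 * N%:R) ^+ p = M * N%:R^-1 ^+ (m - p).
  rewrite /M mulrA !exprMn -[in N%:R^-1 ^+ m](subnK (ltnW pm)).
  rewrite (exprD N%:R^-1) [N%:R^-1 ^+ p]exprVn.
  have NN : N%:R ^- p * N%:R ^+ p = 1 :> R by rewrite mulVf// expf_neq0// gt_eqF.
  have gen (x0 x1 x2 x3 x4 x5 : R) : x4 * x5 = 1 ->
      x0 * x1 * (x2 * x4) * (x3 * x5) = x3 * (x0 * x1) * x2.
    by move=> h; rewrite -[RHS]mulr1 -h; ring.
  exact: gen NN.
rewrite ler_wpM2l// ler_iXnr ?subn_gt0//.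
by rewrite invf_le1// ler1n.
Qed.

(** The level sets of k are intervals of length 2 B / N; the last one holds the
    right end point alone. *)
Lemma grid (B : R) N : 0 < B -> (0 < N)%N -> exists k : R -> 'I_N.+1,
  forall a b, `|a| <= B -> `|b| <= B -> k a = k b -> `|a - b| <= 2 * B / N%:R.
Proof.
move=> B0 N0; have NR : 0 < N%:R :> R by rewrite ltr0n.
pose t a := (a + B) * N%:R / (2 * B).
have B2 : 0 < 2 * B by rewrite mulr_gt0.
exists (fun a => inord (Num.truncn (t a))) => a b aB bB.
have tr c : `|c| <= B -> [/\ (Num.truncn (t c))%:R <= t c,
    t c < (Num.truncn (t c)).+1%:R & (Num.truncn (t c) < N.+1)%N].
  rewrite ler_norml => /andP[c1 c2].
  have t0 : 0 <= t c by rewrite divr_ge0 ?(ltW B2)// mulr_ge0// -lerBlDr sub0r.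
  have /andP[h1 h2] := truncn_itv t0; split => //.
  rewrite ltnS -(ler_nat R) (le_trans h1)// /t ler_pdivrMr// mulrC ler_pM2l//.
  by rewrite mulr_natl mulr2n lerD2r.
have [a1 a2 a3] := tr a aB; have [b1 b2 b3] := tr b bB.
move=> /(congr1 val); rewrite /= !inordK// => ab.
rewrite ab in a1 a2.
have h : `|t a - t b| <= 1.
  by rewrite ler_distl; move: a1 a2 b1 b2; rewrite -natr1 => *; apply/andP; split; lra.
have -> : a - b = (t a - t b) * (2 * B / N%:R).
  by rewrite /t; field; rewrite !gt_eqF.
rewrite normrM (gtr0_norm (divr_gt0 B2 NR)) -[leRHS]mul1r ler_wpM2r//.
by rewrite divr_ge0// ltW.
Qed.

End NullSets.

(** Differences of points of W avoid a cone around the direction v, which 1 + S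
    kills and 1 - S doubles. So the projection along v is injective on W with a
    Lipschitz inverse, and W is a Lipschitz graph over a part of a hyperplane:
    O(N^(m - 1)) cubes of side O(1 / N) cover it. *)
Lemma null_cone (R : realType) (m : nat) (W : set 'rV[R]_m) (S : 'M[R]_m)
    (v : 'rV[R]_m) (b : R) : v != 0 -> v *m S = - v ->
  (forall x, W x -> `|x| <= b) ->
  (forall p q, W p -> W q ->
    `|(p - q) *m (1%:M - S)| <= `|(p - q) *m (1%:M + S)|) ->
  cube_null W.
Proof.
case: m W S v => [|n] W S v v0 vS Wb Wc.
  by case/negP: v0; apply/eqP/rowP => -[].
have /rV0Pn[i0 vi0] := v0.
pose B := `|b| * (1 + (`|v ord0 i0|)^-1 * `|v|) + 1.
have B0 : 0 < B by rewrite ltr_wpDl// mulr_ge0// addr_ge0// mulr_ge0.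
(* The projection along v onto the hyperplane where the coordinate i0 is 0. *)
pose tt (x : 'rV[R]_n.+1) := x ord0 i0 / v ord0 i0.
pose pr (x : 'rV[R]_n.+1) := x - tt x *: v.
have prB x j : W x -> `|pr x ord0 j| <= B.
  move=> /Wb xb; rewrite (le_trans (mx_entry_le _ _ _))// /pr.
  have xb' : `|x| <= `|b| by rewrite (le_trans xb)// ler_norm.
  rewrite (le_trans (ler_normB _ _))// normrZ /tt normrM normfV /B mulrDr mulr1.
  rewrite (@le_trans _ _ (`|b| + `|b| * (`|v ord0 i0|^-1 * `|v|)))// ?lerDl//.
  by rewrite lerD// -mulrA ler_wpM2r ?mulr_ge0// (le_trans (mx_entry_le _ _ _)).
pose K := n.+1%:R * `|1%:M - S| + n.+1%:R * `|1%:M + S|.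
have K0 : 0 <= K by rewrite addr_ge0// mulr_ge0.
pose C := (1 + K) * (2 * B).
have C0 : 0 <= C by rewrite !mulr_ge0 ?addr_ge0// ltW.
apply: (@null_of_cells _ _ (ltn0Sn n) W n C) => // N N0.
have [k hk] := grid B0 N0.
exists (fun x => [ffun j => k (pr x ord0 (lift i0 j))]) => x y Wx Wy kxy.
have NR : 0 < N%:R :> R by rewrite ltr0n.
have prxy : `|pr x - pr y| <= 2 * B / N%:R.
  apply: mx_norm_le; first by rewrite !divr_ge0// ?mulr_ge0// ltW.
  move=> i j; rewrite ord1 mx_subE; case: (unliftP i0 j) => [j' ->|->].
    apply: hk; [exact: prB | exact: prB|].
    by have /ffunP/(_ j') := kxy; rewrite !ffunE.
  have p0 z : pr z ord0 i0 = 0 by rewrite /pr !mxE /tt divfK// subrr.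
  by rewrite !p0 subrr normr0 divr_ge0// mulr_ge0// ltW.
pose dt := tt x - tt y.
have hE : x - y = (pr x - pr y) + dt *: v.
  by rewrite /pr /dt scalerBl; apply/rowP => j; rewrite !mxE; ring.
have vm : v *m (1%:M - S) = 2 *: v.
  by rewrite mulmxBr mulmx1 vS opprK scaler_nat mulr2n.
have vp : v *m (1%:M + S) = 0 by rewrite mulmxDr mulmx1 vS subrr.
have := Wc x y Wx Wy; rewrite hE !(mulmxDl (pr x - pr y)) -!scalemxAl vm vp.
rewrite scaler0 addr0 => h.
have dtv : `|dt *: v| <= K * (2 * B / N%:R).
  have h1 : `|dt *: (2 *: v)| <= K * `|pr x - pr y|.
    rewrite -[X in `|X|](addKr ((pr x - pr y) *m (1%:M - S))).
    rewrite addrC (le_trans (ler_normB _ _))// mulrDl addrC lerD//.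
      by rewrite (le_trans (mulmx_norm_le _ _))// mulrAC.
    by rewrite (le_trans h)// (le_trans (mulmx_norm_le _ _))// mulrAC.
  rewrite (le_trans _ (le_trans h1 _))//; last by rewrite ler_wpM2l.
  rewrite scalerA mulrC -scalerA [leRHS]normrZ ger0_norm// ler_peMl//.
  by rewrite ler1n.
rewrite (le_trans (ler_normD _ _))// /C mulrDl mul1r mulrDl lerD//.
by rewrite -mulrA.
Qed.


(** * Almost every parameter *)

Section LineMeasure.
Context {R : realType}.

(** Markov's inequality for the number of sets V i that contain a point. *)
Lemma markov_count d (T : measurableType d) (mu : {measure set T -> \bar R})
    (I : finType) (V : I -> set T) (e a : R) :
  (forall i, measurable (V i)) -> (forall i, (mu (V i) <= e%:E)%E) ->
  0 < a ->
  exists M : set T, [/\ measurable M, (mu M <= (#|I|%:R * e / a)%:E)%E &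
    forall x, a <= \sum_i \1_(V i) x -> M x].
Proof.
move=> mV Ve a0.
pose g (x : T) : \bar R := (\sum_(i <- index_enum I) (\1_(V i) x)%:E)%E.
have mg1 i : measurable_fun [set: T] (EFin \o (\1_(V i) : T -> R)).
  by apply/measurable_EFinP; exact: measurable_indic.
have mg : measurable_fun [set: T] g by exact: emeasurable_sum.
have g0 x : (0 <= g x)%E by apply: sume_ge0 => i _; rewrite lee_fin.
pose M := [set x | (a%:E <= `|g x|)%E].
have mM : measurable M.
  rewrite -[M]setTI; apply: emeasurable_fun_c_infty => //.
  exact: measurableT_comp.
exists M; split => //; last first.
  by move=> x ax; rewrite /M /= gee0_abs// /g sumEFin lee_fin.
have h := le_integral_abse mu measurableT mg a0.
rewrite setTI -/M in h.
have h2 : (a%:E * mu M <= (#|I|%:R * e)%:E)%E.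
  rewrite (le_trans h)//; under eq_integral => x _ do rewrite gee0_abs//.
  rewrite ge0_integral_sum//.
  rewrite (@le_trans _ _ (\sum_(i <- index_enum I) e%:E)%E)//.
    by apply: lee_sum => i _; rewrite integral_indic// setIT.
  by rewrite sumEFin lee_fin sumr_const mulr_natl.
rewrite -(@lee_pmul2l _ a%:E) ?lte_fin//.
by rewrite (le_trans h2)// -EFinM lee_fin [leRHS]mulrC divfK// gt_eqF.
Qed.

Lemma finite_small_open (B : seq R) (e : R) : 0 < e -> exists V : set R,
  [/\ open V, (lebesgue_measure V <= e%:E)%E & forall b, b \in B -> V b].
Proof.
elim: B e => [|b B IH] e e0.
  exists set0; split => //.
  by rewrite measure0 lee_fin ltW.
have e2 : 0 < e / 2 by rewrite divr_gt0.
have e4 : 0 < e / 4 by rewrite divr_gt0.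
have [V [oV mV BV]] := IH _ e2.
exists (V `|` ball b (e / 4)); split.
- by apply: openU => //; exact: ball_open.
- have mV' : measurable V by exact: open_measurable.
  have mb : (lebesgue_measure (ball b (e / 4)) <= (e / 2)%:E)%E.
    by rewrite lebesgue_measure_ball ?(ltW e4)// lee_fin -mulr_natr; lra.
  apply: (le_trans (measureU2 lebesgue_measure mV' (measurable_ball b (e / 4)))).
  have -> : e%:E = ((e / 2)%:E + (e / 2)%:E)%E by rewrite -EFinD -splitr.
  exact: leeD.
- move=> c; rewrite inE => /orP[/eqP ->|/BV ?]; last by left.
  by right; exact: ballxx.
Qed.

Lemma negligible_of_small (A : set R) : (forall e : R, 0 < e ->
    exists M : set R, [/\ measurable M, (lebesgue_measure M <= e%:E)%E & A `<=` M]) ->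
  lebesgue_measure.-negligible A.
Proof.
move=> h; have /choice[M hM] : forall k : nat, exists M : set R,
    [/\ measurable M, (lebesgue_measure M <= (k.+1%:R^-1)%:E)%E & A `<=` M].
  by move=> k; apply: h; rewrite invr_gt0.
exists (\bigcap_k M k); split.
- by apply: bigcapT_measurable => k; have [] := hM k.
- apply/eqP; rewrite -measure_le0; apply/lee_addgt0Pr => e e0; rewrite add0e.
  have [k ke] : exists k : nat, (k.+1%:R^-1 : R) <= e.
    exists (Num.truncn (e^-1)); rewrite invf_ple ?posrE// ltW// truncnS_gt//.
  have [mMk Mk _] := hM k.
  rewrite (@le_trans _ _ (lebesgue_measure (M k)))//.
    apply: le_measure; rewrite ?inE//; last exact: bigcap_inf.
    by apply: bigcapT_measurable => i; have [] := hM i.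
  by rewrite (le_trans Mk)// lee_fin.
- by move=> x Ax k _; have [_ _] := hM k; apply.
Qed.

End LineMeasure.

Section Sections.
Context {R : realType} {m : nat}.
Hypothesis m_gt0 : (0 < m)%N.
Variables (D : set 'rV[R]_m) (P : 'rV[R]_m -> R -> Prop) (b : R).
Hypotheses (cD : compact D) (Db : forall x, D x -> `|x| <= b).
Hypothesis hP : forall x, D x -> exists B : seq R, forall d, d \notin B ->
  exists2 r : R, 0 < r & forall x' d', `|x' - x| < r -> `|d' - d| < r -> P x' d'.

(** The tube lemma: the parameters of norm at most n outside of a small open
    neighbourhood of the exceptional ones at x form a compact set. *)
Lemma tube x (n e : R) : D x -> 0 < e -> exists V : set R,
  [/\ measurable V, (lebesgue_measure V <= e%:E)%E &
   exists2 r : R, 0 < r & forall x' d, `|x' - x| < r -> `|d| <= n -> ~ V d -> P x' d].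
Proof.
move=> Dx e0; have [B hB] := hP Dx.
have [V [oV mV BV]] := finite_small_open B e0.
exists V; split => //; first exact: open_measurable.
pose K := `[- n, n]%classic `&` ~` V.
have cK : compact K.
  apply: compact_closedI; first exact: segment_compact.
  by rewrite closedC.
have near_x : \forall x' \near x, K `<=` P x'.
  apply: ((compact_near_coveringP K).1 cK _ (nbhs x) P) => d [_ Vd].
  have [|r r0 hr] := hB d; first by apply/negP => /BV.
  exists (ball d r, ball x r) => /=; first by split; exact: nbhsx_ballx.
  move=> [d' x'] [/=]; rewrite -!ball_normE /ball_ /= => h1 h2.
  by apply: hr; rewrite distrC.
have /nbhs_ballP[r /= r0 hr] := near_x.
exists r => // x' d xx dn nVd.
apply: hr; first by rewrite -ball_normE /ball_ /= distrC.
by split => //=; rewrite in_itv /= -ler_norml.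
Qed.

Let C := 2 * (`|b| + 1).

Let C0 : 0 < C. Proof. by rewrite mulr_gt0// ltr_wpDl. Qed.

(** By compactness one mesh size serves all points of D. *)
Lemma uniform_tube (n e : R) : 0 < e -> exists N, (0 < N)%N /\
  forall x, D x -> exists V : set R,
    [/\ measurable V, (lebesgue_measure V <= e%:E)%E &
     forall x' d, D x' -> `|x' - x| <= C / N%:R -> `|d| <= n -> ~ V d -> P x' d].
Proof.
move=> e0.
pose Phi (N : nat) x := exists V : set R,
    [/\ measurable V, (lebesgue_measure V <= e%:E)%E &
     forall x' d, D x' -> `|x' - x| <= C / N%:R -> `|d| <= n -> ~ V d -> P x' d].
have : \forall N \near \oo, D `<=` Phi N.
  apply: ((compact_near_coveringP D).1 cD _ _ Phi) => x Dx.
  have [V [mV Ve [r r0 hr]]] := tube n Dx e0.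
  have r2 : 0 < r / 2 by rewrite divr_gt0.
  exists (ball x (r / 2), [set N : nat | C / N%:R < r / 2]) => /=.
    split; first exact: nbhsx_ballx.
    exists (Num.truncn (C / (r / 2))).+1 => // N /= hN.
    have N0 : 0 < N%:R :> R by rewrite ltr0n (leq_trans _ hN).
    rewrite ltr_pdivrMr// mulrC -ltr_pdivrMr//.
    by rewrite (lt_le_trans (truncnS_gt _))// ler_nat.
  move=> [y N] [/=]; rewrite -ball_normE /ball_ /= => yx hN.
  exists V; split => // x' d Dx' x'y dn nV; apply: hr => //.
  have -> : x' - x = (x' - y) - (x - y) by rewrite opprB addrA subrK.
  rewrite (le_lt_trans (ler_normB _ _))// [ltRHS]splitr ltrD//.
  exact: le_lt_trans hN.
case=> N0 _ hN; exists N0.+1; split => // x Dx.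
exact: (hN N0.+1 (leqnSn _)).
Qed.

Definition small_cover (A : set 'rV[R]_m) (eta : R) :=
  exists (I : countType) (c : I -> 'rV[R]_m) (r : I -> R), [/\ forall k, 0 <= r k,
    forall x, A x -> exists k, `|x - c k| <= r k &
    forall s : seq I, uniq s -> \sum_(k <- s) (2 * r k) ^+ m <= eta].

(** Cover D by small cells; a cell contributes to the bad set of the parameter d
    only if d lies in the exceptional set V of the cell, so that by Markov's
    inequality few parameters have many bad cells. *)
Lemma few_bad_parameters (n eta : R) : 0 < eta ->
  lebesgue_measure.-negligible
    [set d | `|d| <= n /\ ~ small_cover [set x | D x /\ ~ P x d] eta].
Proof.
move=> eta0; apply: negligible_of_small => e e0.
pose Mx : R := (4 * C) ^+ m.
have M0 : 0 < Mx by rewrite exprn_gt0// mulr_gt0.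
pose e' := e * eta / Mx.
have e'0 : 0 < e' by rewrite divr_gt0// mulr_gt0.
have [N [N0 hN]] := uniform_tube n e'0.
have NR : 0 < N%:R :> R by rewrite ltr0n.
have b1 : 0 < `|b| + 1 by rewrite ltr_wpDl.
have [k hk] := grid b1 N0.
pose K (x : 'rV[R]_m) : {ffun 'I_m -> 'I_N.+1} := [ffun j => k (x ord0 j)].
have hK x y : D x -> D y -> K x = K y -> `|x - y| <= C / N%:R.
  move=> Dx Dy Kxy; apply: mx_norm_le; first by rewrite divr_ge0// ltW.
  have le z j : D z -> `|z ord0 j| <= `|b| + 1.
    move=> /Db zb; rewrite (le_trans (mx_entry_le _ _ _))// (le_trans zb)//.
    by rewrite (le_trans (ler_norm _))// lerDl.
  move=> i j; rewrite ord1 mx_subE; apply: hk; [exact: le | exact: le|].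
  by have /ffunP/(_ j) := Kxy; rewrite !ffunE.
have /choice[y hy] : forall q, exists y, (exists2 z, D z & K z = q) -> D y /\ K y = q.
  move=> q; have [[z Bz hz]|h] := pselect (exists2 z, D z & K z = q).
    by exists z.
  by exists 0 => /h.
have /choice[V hV] : forall q, exists V : set R,
    [/\ measurable V, (lebesgue_measure V <= e'%:E)%E &
     D (y q) -> forall x' d, D x' -> `|x' - y q| <= C / N%:R -> `|d| <= n -> ~ V d -> P x' d].
  move=> q; have [Dy|nD] := pselect (D (y q)).
    by have [V [mV Ve hVq]] := hN _ Dy; exists V.
  by exists set0; split => //; rewrite measure0 lee_fin ltW.
pose vol := (2 * (C / N%:R)) ^+ m.
have vol0 : 0 < vol by rewrite exprn_gt0// mulr_gt0// divr_gt0.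
have mV q : measurable (V q) by have [] := hV q.
have Ve q : (lebesgue_measure (V q) <= e'%:E)%E by have [] := hV q.
have a0 : 0 < eta / vol by rewrite divr_gt0.
have [M [mM MM hM]] :=
  @markov_count _ _ _ lebesgue_measure {ffun 'I_m -> 'I_N.+1} V e' _ mV Ve a0.
exists M; split => //.
  rewrite (le_trans MM)// lee_fin card_ffun !card_ord natrX.
  have card_vol : N.+1%:R ^+ m * vol <= Mx.
    rewrite /vol /Mx -exprMn; apply: lerXn2r; rewrite ?nnegrE ?mulr_ge0 ?divr_ge0 ?(ltW C0)//.
    rewrite (_ : N.+1%:R * (2 * (C / N%:R)) = 2 * C * (N.+1%:R / N%:R)); last ring.
    have : N.+1%:R / N%:R <= 2 :> R.
      by rewrite ler_pdivrMr// -natrM ler_nat mul2n -addnn -addn1 leq_add2l.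
    by have := C0; nra.
  have -> : N.+1%:R ^+ m * e' / (eta / vol) = N.+1%:R ^+ m * vol * e' / eta.
    by rewrite invf_div; ring.
  rewrite ler_pdivrMr// (le_trans (ler_wpM2r (ltW e'0) card_vol))// /e'.
  by rewrite mulrC divfK// gt_eqF.
move=> d [dn ncov]; apply: hM; rewrite leNgt; apply/negP => few; apply: ncov.
exists {ffun 'I_m -> 'I_N.+1}, y, (fun q => \1_(V q) d * (C / N%:R)); split.
- by move=> q; rewrite mulr_ge0// divr_ge0// ltW.
- move=> x [Dx nP]; exists (K x).
  have [Dy Ky] := hy (K x) (ex_intro2 _ _ x Dx erefl).
  have xy : `|x - y (K x)| <= C / N%:R by apply: hK.
  suff Vd : V (K x) d by rewrite indicE mem_set// mul1r.
  apply: contrapT => nV; apply: nP; have [_ _ h] := hV (K x); exact: h.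
move=> s us; rewrite (@le_trans _ _ (\sum_q (2 * (\1_(V q) d * (C / N%:R))) ^+ m))//.
  apply: sum_sub_uniq => [q|//||q _].
  - by rewrite weight_ge0// mulr_ge0// divr_ge0// ltW.
  - exact: index_enum_uniq.
  - exact: mem_index_enum.
rewrite (eq_bigr (fun q => \1_(V q) d * vol)); last first.
  move=> q _; rewrite mulrCA exprMn /vol indicE; case: (_ \in _) => /=.
    by rewrite expr1n.
  by rewrite expr0n gtn_eqF.
by rewrite -mulr_suml -ler_pdivlMr// ltW.
Qed.

(** An elementary half of Fubini's theorem: the exceptional sets for the bounds n on
    the parameter and for the accuracies 1 / (j + 1) are collected. *)
Theorem null_sections : exists2 E : set R, lebesgue_measure.-negligible E &
  forall d, ~ E d -> cube_null [set x | D x /\ ~ P x d].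
Proof.
pose En (nj : nat) := [set d : R | let: (n, j) := odflt (0, 0)%N (unpickle nj) in
  `|d| <= n%:R /\ ~ small_cover [set x | D x /\ ~ P x d] (j.+1%:R^-1)].
exists (\bigcup_nj En nj).
  apply: negligible_bigcup => nj; rewrite /En; case: (odflt _ _) => n j.
  by apply: few_bad_parameters; rewrite invr_gt0.
move=> d nE; apply: null_of_cover => // e e0.
pose n := (Num.truncn `|d|).+1; pose j := Num.truncn (e^-1).
have dn : `|d| <= n%:R by rewrite ltW// truncnS_gt.
have je : (j.+1%:R^-1 : R) <= e by rewrite invf_ple ?posrE// ltW// truncnS_gt.
have : small_cover [set x | D x /\ ~ P x d] (j.+1%:R^-1).
  apply: contrapT => h; apply: nE; exists (pickle (n, j)) => //.
  by rewrite /En /= pickleK.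
move=> [I [c [r [r0 cov sum]]]]; exists I, c, r; split => // s us.
exact: le_trans (sum s us) je.
Qed.

End Sections.

(** * Orbits trapped near a saddle point *)

Section SignOfHessian.
Context {R : realType} {n : nat}.
Implicit Types (H : 'M[R]_n).

(** The vector u = v + v S is fixed by S, so that <u A, u> = <u S A, u> >= 0,
    whereas it is an eigenvector for b < 0 or zero. *)
Lemma sgnmx_neg_eigenvector H (v : 'rV[R]_n) b : H^T = H -> H \in unitmx ->
  b < 0 -> v *m H = b *: v -> v *m sgnmx H = - v.
Proof.
move=> HT Hu b0 vH; have SS := sgnmx_sq HT Hu; have SH := sgnmx_comm HT.
set S := sgnmx H in SS SH *; pose u := v + v *m S.
have uH : u *m H = b *: u.
  by rewrite mulmxDl -mulmxA SH mulmxA vH -scalemxAl scalerDr.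
have uS : u *m S = u by rewrite mulmxDl -mulmxA SS mulmx1 addrC.
have := sgnmx_psd u HT; rewrite -/S mulmxA uS uH dotvZl => h.
have uu := dotvv_ge0 u.
have u0 : u = 0 by apply: dotvv_eq0; nra.
by apply/eqP; rewrite -subr_eq0 opprK addrC; apply/eqP.
Qed.

Lemma eigenvalues_gt0 H (Q : 'M[R]_n) (l : 'rV[R]_n) : Q *m Q^T = 1%:M ->
  H = Q^T *m diag_mx l *m Q -> H \in unitmx ->
  (forall b, b < 0 -> ~~ eigenvalue H b) -> forall i, 0 < l ord0 i.
Proof.
move=> QQ HE Hu neg i; have l0 : l ord0 i != 0.
  by move: Hu; rewrite HE => /(diag_conj_unit QQ).
rewrite lt_def l0 /= leNgt; apply/negP => li.
have /negP := neg _ li; apply; apply/eigenvalueP; exists (row i Q).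
  by rewrite HE !mulmxA -row_mul QQ row1 -rowE row_diag_mx -scalemxAl -rowE.
apply/eqP => ri; have := congr1 (fun A : 'M[R]_n => A i i) QQ.
rewrite mxE [RHS]mxE eqxx big1 => [/eqP|k _].
  by rewrite eq_sym oner_eq0.
have /rowP/(_ k) := ri; rewrite !mxE => ->; exact: mul0r.
Qed.

Lemma sgnmx_posdef H : H^T = H -> H \in unitmx ->
  (forall b, b < 0 -> ~~ eigenvalue H b) -> sgnmx H = 1%:M.
Proof.
move=> HT Hu neg; have [Q [l [QQ HE]]] := spectral HT.
have l0 := eigenvalues_gt0 QQ HE Hu neg.
rewrite (sgnmxE QQ HE) -[RHS](mulmx1C QQ) -[in RHS](mulmx1 Q^T).
congr (_ *m _ *m _); rewrite -diag_const_mx; congr diag_mx.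
by apply/rowP => i; rewrite !mxE gtr0_sg.
Qed.

Lemma posdef_coercive H : H^T = H -> H \in unitmx ->
  (forall b, b < 0 -> ~~ eigenvalue H b) ->
  exists2 c : R, 0 < c & forall x, c * (`|x| * `|x|) <= dotv (x *m H) x.
Proof.
move=> HT Hu neg; have [Q [l [QQ HE]]] := spectral HT.
have l0 := eigenvalues_gt0 QQ HE Hu neg.
have [c c0 cl] : exists2 c : R, 0 < c & forall i, c <= l ord0 i.
  exists (\big[Num.min/1]_i l ord0 i).
    by apply: lt_bigmin => // i _; exact: l0.
  by move=> i; apply: bigmin_le_cond.
exists c => // x; rewrite HE !mulmxA dotv_mulmxl; set y := x *m Q^T.
have yy : dotv y y = dotv x x.
  by rewrite /y dotv_mulmxl trmxK -mulmxA (mulmx1C QQ) mulmx1.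
apply: (@le_trans _ _ (c * dotv y y)).
  by rewrite yy ler_pM2l// norm_sqr_le_dotv.
rewrite !dotvE mulr_sumr; apply: ler_sum => i _.
rewrite mul_mx_diag [X in _ <= X * _]mxE mulrAC -!expr2 mulrC.
by rewrite ler_wpM2l ?sqr_ge0.
Qed.

End SignOfHessian.

Section LocalDynamics.
Context {R : realType} {m : nat}.
Variables (f : 'rV[R]_m -> R) (alpha : R).
Hypotheses (fC3 : Ck 3 f) (alpha_gt0 : 0 < alpha).
Variable delta : 'I_m.+1 -> R.
Let F := nqn_step f alpha delta.
Let d0 := delta ord0.

(** The selected shift is the first one near z, so the estimate for a fixed shift
    carries over to the step of the algorithm. *)
Lemma step_strict z e : gradient f z = 0 -> hessian f z \in unitmx -> 0 < e ->
  exists2 r : R, 0 < r & forall p q, `|p - z| < r -> `|q - z| < r ->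
    `|F p - F q - (p - q) *m (1%:M - sgnmx (hessian f z))| <= e * `|p - q|.
Proof.
move=> gz Hz e0.
have [r r0 hr] := critical_strict fC3 alpha_gt0 gz Hz d0 e0.
exists r; first exact: r0.
move=> p q pz qz.
have [pu h] := hr p q pz qz; have [qu _] := hr q p qz pz.
by rewrite /F (nqn_step_fixed pu) (nqn_step_fixed qu).
Qed.

Lemma step_fix z : gradient f z = 0 -> F z = z.
Proof.
move=> gz; rewrite /F /nqn_step gz !mul0mx subr0; exact: subr0.
Qed.

(** In place of the stable manifold theorem. Two orbits that stay near z never have
    their difference h in the cone |h (1 + S)| < |h (1 - S)|: the derivative 1 - S
    of the step maps h to h (1 - S), which it then doubles and which 1 + S kills,
    so the cone is invariant, and |h (1 - S)| grows at least by the factor 3/2 at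
    each step. *)
Lemma trapped_null z b : gradient f z = 0 -> hessian f z \in unitmx ->
  b < 0 -> eigenvalue (hessian f z) b ->
  exists2 r : R, 0 < r & cube_null [set x | forall k, `|iter k F x - z| < r].
Proof.
move=> gz Hz b0 /eigenvalueP[v vH v0].
have HT := hessian_tr fC3 z; set H := hessian f z in Hz vH HT.
have vS := sgnmx_neg_eigenvector HT Hz b0 vH; have SS := sgnmx_sq HT Hz.
set S := sgnmx H in vS SS.
pose K := m%:R * `|1%:M - S| + m%:R * `|1%:M + S| + 1.
have K0 : 0 < K by rewrite ltr_wpDl// addr_ge0// mulr_ge0.
have mulK (h : 'rV[R]_m) (B : 'M[R]_m) : m%:R * `|B| <= K -> `|h *m B| <= K * `|h|.
  move=> BK; rewrite (le_trans (mulmx_norm_le _ _))// mulrAC ler_wpM2r//.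
have Km : m%:R * `|1%:M - S| <= K by rewrite /K -addrA lerDl !addr_ge0// mulr_ge0.
have Kp : m%:R * `|1%:M + S| <= K.
  by rewrite /K [X in _ <= X + _]addrC -addrA lerDl !addr_ge0// mulr_ge0.
(* With this precision the error of each step, multiplied by 1 - S or by 1 + S, is
   at most half of |h (1 - S)|. *)
have e0 : 0 < (2 * K)^-1 by rewrite invr_gt0 mulr_gt0.
have [r r0 hr] := step_strict gz Hz e0.
exists r => //; set W := [set x | _].
apply: (@null_cone _ _ W S v (`|z| + r)) => //.
  move=> x /(_ 0%N) /= xz; rewrite -(subrK z x) (le_trans (ler_normD _ _))//.
  by rewrite addrC lerD2l ltW.
move=> p q Wp Wq; rewrite leNgt; apply/negP => cone.
pose h k := iter k F p - iter k F q.
pose A k := `|h k *m (1%:M - S)|; pose B k := `|h k *m (1%:M + S)|.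
have step k : B k < A k -> B k.+1 < A k.+1 /\ A k + A k / 2 <= A k.+1.
  move=> BA; have A0 : 0 < A k by apply: le_lt_trans BA; exact: normr_ge0.
  have herr : `|h k.+1 - h k *m (1%:M - S)| <= (2 * K)^-1 * `|h k|.
    exact: (hr _ _ (Wp k) (Wq k)).
  have hE : 2 *: h k = h k *m (1%:M - S) + h k *m (1%:M + S).
    by rewrite -mulmxDr addrCA subrK mulmxDr mulmx1 scaler_nat mulr2n.
  have hA : `|h k| <= A k.
    have : 2 * `|h k| <= A k + B k.
      by rewrite -[2]ger0_norm// -normrZ hE ler_normD.
    lra.
  set er := h k.+1 - _ in herr.
  have erE : h k.+1 = h k *m (1%:M - S) + er by rewrite /er addrC subrK.
  have erK (C : 'M[R]_m) : m%:R * `|C| <= K -> `|er *m C| <= A k / 2.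
    move=> CK; rewrite (le_trans (mulK _ _ CK))// mulrC -ler_pdivlMr//.
    rewrite (le_trans herr)// -[leRHS]mulrA -invfM mulrC ler_pM2r//.
  have e1 : h k.+1 *m (1%:M - S) = 2 *: (h k *m (1%:M - S)) + er *m (1%:M - S).
    rewrite erE mulmxDl; congr (_ + _); rewrite -mulmxA scalemxAr; congr (_ *m _).
    by rewrite mulmxBr mulmx1 mulmxBl mul1mx SS (opprB S 1%:M) scaler_nat mulr2n.
  have e2 : h k.+1 *m (1%:M + S) = er *m (1%:M + S).
    rewrite erE mulmxDl -mulmxA [X in h k *m X + _](_ : _ = 0) ?mulmx0 ?add0r//.
    by rewrite mulmxDr mulmx1 mulmxBl mul1mx SS addrC subrKA subrr.
  have AK1 : A k + A k / 2 <= A k.+1.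
    have := erK _ Km; have : 2 * A k <= A k.+1 + `|er *m (1%:M - S)|.
      rewrite /A -[2]ger0_norm// -normrZ.
      rewrite [X in `|X| <= _](_ : _ = h k.+1 *m (1%:M - S) - er *m (1%:M - S)).
        exact: ler_normB.
      by rewrite e1 addrK.
    lra.
  split => //; have := erK _ Kp; rewrite -e2 -/(B k.+1); lra.
have A0 : 0 < A 0%N by apply: le_lt_trans cone; exact: normr_ge0.
have grow k : B k < A k /\ A 0%N * (1 + k%:R / 2) <= A k.
  elim: k => [|k [BA IH]]; first by split => //; rewrite mul0r addr0 mulr1.
  have [BA' h1] := step k BA; split => //; rewrite (le_trans _ h1)//.
  rewrite -natr1; have k0 : 0 <= k%:R :> R by []; nra.
(* The linear growth in (3/2)^k >= 1 + k / 2 already contradicts |h| <= 2 r. *)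
pose k := (Num.truncn (K * (2 * r) * 2 / A 0%N)).+1.
have [_ gk] := grow k.
have hk : K * (2 * r) * 2 < k%:R * A 0%N by rewrite -ltr_pdivrMr//; exact: truncnS_gt.
have : A k <= K * `|h k| by exact: mulK.
have : `|h k| <= 2 * r.
  have -> : h k = (iter k F p - z) - (iter k F q - z) by rewrite opprB addrA subrK.
  apply: le_trans (ler_normB _ _) _; rewrite mulr_natl mulr2n.
  exact: lerD (ltW (Wp k)) (ltW (Wq k)).
move=> h1 h2; have h3 : K * `|h k| <= K * (2 * r) by rewrite ler_pM2l.
have := le_trans gk (le_trans h2 h3); rewrite mulrDr mulr1 mulrA [A 0%N * _]mulrC.
move: hk A0; move: (A 0%N) (K * (2 * r)) => a c; lra.
Qed.

End LocalDynamics.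

(** * Exceptional shifts and starting points *)

Section RationalBalls.
Context {R : realType} {m : nat}.
Implicit Types (x y : 'rV[R]_m).

(** The balls indexed by i form a countable base of the topology. *)
Definition rball (i : 'rV[rat]_m * nat) : set 'rV[R]_m :=
  [set y | `|y - map_mx ratr i.1| < i.2.+1%:R^-1].

Lemma rball_in x (r : R) : 0 < r ->
  exists i, rball i x /\ forall y, rball i y -> `|y - x| < r.
Proof.
move=> r0; pose n := Num.truncn (2 / r).
have nr : (n.+1%:R^-1 : R) < r / 2.
  rewrite invf_plt ?posrE ?divr_gt0// invf_div; exact: truncnS_gt.
have n0 : 0 < n.+1%:R^-1 :> R by rewrite invr_gt0.
have /choice[c hc] : forall i : 'I_m, exists q : rat,
    `|x ord0 i - ratr q| <= n.+1%:R^-1 / 2.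
  move=> i; have [|q] := @rat_in_itvoo R (x ord0 i) (x ord0 i + n.+1%:R^-1 / 2).
    by rewrite ltrDl divr_gt0.
  rewrite in_itv /= => /andP[q1 q2]; exists q.
  by rewrite distrC ger0_norm ?subr_ge0 1?lerBlDl ltW.
have xc : `|x - map_mx ratr (\row_i c i)| <= n.+1%:R^-1 / 2.
  apply: mx_norm_le; first by rewrite ltW// divr_gt0.
  by move=> i j; rewrite mx_subE [map_mx _ _ _ _]mxE [X in ratr X]mxE ord1; exact: hc.
exists (\row_i c i, n); rewrite /rball /=; move: (map_mx _ _) xc => w xc; split.
  by apply: le_lt_trans xc _; rewrite ltr_pdivrMr// ltr_pMr// ltr1n.
move=> y yc.
have -> : y - x = (y - w) - (x - w) by rewrite opprB addrA subrK.
apply: le_lt_trans (ler_normB _ _) _.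
have -> : r = r / 2 + r / 2 by field.
apply: ltrD; first exact: lt_trans yc nr.
by apply: le_lt_trans xc _; apply: lt_trans nr; rewrite ltr_pdivrMr// ltr_pMr// ltr1n.
Qed.

End RationalBalls.

Section ExceptionalSets.
Context {R : realType} {m : nat}.
Hypothesis m_gt0 : (0 < m)%N.
Variables (f : 'rV[R]_m -> R) (alpha : R).
Hypotheses (fC3 : Ck 3 f) (alpha_gt0 : 0 < alpha).
Implicit Types (x z : 'rV[R]_m) (d : R).

(** The step for the shift d is locally injective at x with a Lipschitz inverse. *)
Definition expanding_at x d := exists r k : R, [/\ 0 < r, 0 < k &
  forall p q, `|p - x| < r -> `|q - x| < r ->
    shifted_hessian f alpha d p \in unitmx /\
    k * `|p - q| <= `|nqn_fixed f alpha d p - nqn_fixed f alpha d q|].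

Lemma good_expanding x d : good_shift f alpha x d ->
  exists2 r : R, 0 < r & forall x' d', `|x' - x| < r -> `|d' - d| < r ->
    expanding_at x' d'.
Proof.
move=> [r [c [r0 c0 h]]]; exists (r / 2); first by rewrite divr_gt0.
move=> x' d' xx dd; exists (r / 2), c; split; [by rewrite divr_gt0 | exact: c0 | ].
have near_x p : `|p - x'| < r / 2 -> `|p - x| < r.
  move=> px; rewrite -(subrKA x' p) (le_lt_trans (ler_normD _ _))//.
  by rewrite -[ltRHS](@divfK _ 2)// mulr_natr mulr2n ltrD.
move=> p q px qx; apply: (h p q d' (near_x p px) (near_x q qx)).
by apply: lt_trans dd _; rewrite ltr_pdivrMr// ltr_pMr// ltr1n.
Qed.

(* The noncritical points are the union of these compact sets. *)
Let shell (N : nat) : set 'rV[R]_m :=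
  [set x | `|x| <= N%:R /\ N.+1%:R^-1 <= dotv (gradient f x) (gradient f x)].

Let compact_shell N : compact (shell N).
Proof.
apply: bounded_closed_compact.
  by exists N%:R; split => // M NM x [/le_trans + _]; apply; exact: ltW.
apply: closedI.
  have -> : (fun x : 'rV[R]_m => is_true (`|x| <= N%:R)) =
      (fun x : 'rV[R]_m => `|x|) @^-1` [set t : R | t <= N%:R] by [].
  by apply: closed_comp => [x _|]; [exact: norm_continuous | exact: closed_le].
have -> : (fun x : 'rV[R]_m => is_true (N.+1%:R^-1 <= dotv (gradient f x) (gradient f x))) =
    (fun x : 'rV[R]_m => \sum_(i < m) partial f i x * partial f i x) @^-1`
      [set t : R | N.+1%:R^-1 <= t].
  apply/funext => x; congr (is_true (_ <= _)); rewrite dotvE.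
  by apply: eq_bigr => i _; rewrite mxE.
apply: closed_comp => [x _|]; last exact: closed_ge.
move: x; apply: continuous_sumr => i x.
have c : {for x, continuous (partial f i)}.
  exact: (CkS_continuous (CkS_partial i fC3)).
exact: (@cvgM _ _ (nbhs x) _ _ _ _ _ c c).
Qed.

(** On each shell, which is compact, this is Fubini's theorem for the finite
    exceptional sets at the points; null sets add up over the shells. *)
Lemma exceptional_parameters : exists2 E : set R, lebesgue_measure.-negligible E &
  forall d, ~ E d -> cube_null [set x | gradient f x != 0 /\ ~ expanding_at x d].
Proof.
have /choice[E hE] : forall N, exists E : set R, lebesgue_measure.-negligible E /\
    forall d, ~ E d -> cube_null [set x | shell N x /\ ~ expanding_at x d].
  move=> N; have [||E E0 hE] := @null_sections R m m_gt0 (shell N) expanding_at N%:R (@compact_shell N).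
  - by move=> x [].
  - move=> x [_ gx]; have gx0 : gradient f x != 0.
      apply: contraTneq gx => ->; rewrite dotv0l -ltNge invr_gt0//.
    have [B hB] := generic_good fC3 alpha_gt0 gx0.
    by exists B => d /hB; exact: good_expanding.
  by exists E; split.
exists (\bigcup_N E N); first by apply: negligible_bigcup => N; have [] := hE N.
move=> d nE; apply: null_sub (null_bigcup m_gt0 (A := fun N x => shell N x /\ ~ expanding_at x d) _); last first.
  by move=> N; have [_] := hE N; apply => EN; apply: nE; exists N.
move=> x [gx nx]; have g0 := dotvv_gt0 gx.
pose n1 := (Num.truncn `|x|).+1; pose n2 := (Num.truncn (dotv (gradient f x) (gradient f x))^-1).+1.
have h1 : `|x| < n1%:R by exact: truncnS_gt.
have h2 : (dotv (gradient f x) (gradient f x))^-1 < n2%:R by exact: truncnS_gt.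
exists (n1 + n2)%N; split=> //; split.
  by apply: le_trans (ltW h1) _; rewrite ler_nat leq_addr.
rewrite invf_ple ?posrE//; apply: le_trans (ltW h2) _.
by rewrite ler_nat -addnS addnC leqW// leq_addr.
Qed.

Variable delta : 'I_m.+1 -> R.
Let F := nqn_step f alpha delta.
Hypothesis generic :
  cube_null [set x | gradient f x != 0 /\ ~ expanding_at x (delta ord0)].

(** The critical points in the preimage are in A, being fixed by the step; near
    almost every other point the step has a Lipschitz inverse. Countably many
    rational balls and constants suffice. *)
Lemma null_step_preimage A : cube_null A -> cube_null [set x | A (F x)].
Proof.
move=> A0.
pose Ex (j : 'rV[rat]_m * nat * nat) : set 'rV[R]_m := [set x | rball j.1 x /\
  forall p q, rball j.1 p -> rball j.1 q -> j.2.+1%:R^-1 * `|p - q| <= `|F p - F q|].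
have U := cube_nullU m_gt0 A0 (cube_nullU m_gt0 generic (null_bigcup m_gt0
  (A := fun j => [set x | Ex j x /\ A (F x)]) _)).
apply: null_sub (U _); last first.
  move=> j; have k0 : 0 < j.2.+1%:R^-1 :> R by rewrite invr_gt0.
  refine (@null_preimage R m F A (Ex j) _ k0 _ A0).
  by move=> p q [Bp h] [Bq _]; exact: h.
move=> x AFx; have [gx|gx] := eqVneq (gradient f x) 0.
  by left; move: AFx; rewrite /= /F (step_fix _ _ gx).
right; have [ex|ex] := pselect (expanding_at x (delta ord0)); last by left.
right; have [r [k [r0 k0 h]]] := ex.
have [i [ix hi]] := rball_in x r0.
pose n := Num.truncn k^-1.
have nk : (n.+1%:R^-1 : R) <= k by rewrite invf_ple ?posrE// ltW// truncnS_gt.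
exists (i, n); split=> //; split=> // p q /= pi qi.
have [pu hpq] := h p q (hi p pi) (hi q qi).
have [qu _] := h q p (hi q qi) (hi p pi).
rewrite /F (nqn_step_fixed pu) (nqn_step_fixed qu); apply: le_trans hpq.
by rewrite ler_wpM2r.
Qed.

Lemma null_iter_preimage k A : cube_null A -> cube_null [set x | A (iter k F x)].
Proof.
elim: k => [|k IH] A0; first exact: A0.
apply: null_sub (null_step_preimage (IH A0)) => x /=.
by rewrite -iterS iterSr.
Qed.

Let confined i : set 'rV[R]_m := [set x | forall k, rball i (iter k F x)].
(** The orbit ends up in a rational ball where only a null set of points is confined
    to the ball for ever. *)
Definition bad_start : set 'rV[R]_m :=
  [set x | exists j : nat * ('rV[rat]_m * nat),
    cube_null (confined j.2) /\ confined j.2 (iter j.1 F x)].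

Lemma bad_start_null : cube_null bad_start.
Proof.
apply: (null_bigcup m_gt0 (A := fun j => [set x | cube_null (confined j.2)
  /\ confined j.2 (iter j.1 F x)])) => -[N i] /=.
have [c0|nc] := pselect (cube_null (confined i)).
  by apply: null_sub (null_iter_preimage N c0) => x [].
apply: null_sub (null_bigcup m_gt0 (J := void) (A := fun=> setT) _); last by case.
by move=> x [].
Qed.

Lemma bad_start_saddle x z b : gradient f z = 0 -> hessian f z \in unitmx ->
  b < 0 -> eigenvalue (hessian f z) b ->
  iter n F x @[n --> \oo] --> z -> bad_start x.
Proof.
move=> gz Hz b0 eb cv.
have [r r0 W0] := trapped_null fC3 alpha_gt0 delta gz Hz b0 eb.
have [i [iz hi]] := rball_in z r0.
have e0 : 0 < i.2.+1%:R^-1 - `|z - map_mx ratr i.1| by rewrite subr_gt0.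
have /cvgrPdist_lt/(_ _ e0)[N _ hN] := cv.
exists (N, i); split => /=.
  by apply: null_sub W0 => y cy k; apply: hi; exact: cy.
move=> k; rewrite -iterD; have := hN (k + N)%N (leq_addl _ _).
rewrite ltrBrDr /rball /=; apply: le_lt_trans.
by rewrite (distrC z (iter _ _ _)) -(subrKA z (iter _ _ _)); exact: ler_normD.
Qed.

End ExceptionalSets.

(** * Estimates near a limit point *)

Lemma norm_le_close (R : realType) m n (A B : 'M[R]_(m, n)) e :
  `|A - B| <= e -> `|A| <= `|B| + e.
Proof.
move=> AB; rewrite -{1}(subrK B A); apply: le_trans (ler_normD _ _) _.
by rewrite addrC lerD2l.
Qed.

Section LocalEstimates.
Context {R : realType} {m : nat}.
Variables (f : 'rV[R]_m -> R) (alpha : R).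
Hypotheses (fC3 : Ck 3 f) (alpha_gt0 : 0 < alpha).
Implicit Types (p q x z h : 'rV[R]_m) (d : R).

Let self (V : normedModType R) (a : V) (r : R) : 0 < r -> `|a - a| < r.
Proof. by rewrite subrr normr0. Qed.

Lemma shifted_close x d e : 0 < e -> exists2 r : R, 0 < r & forall p, `|p - x| < r ->
  `|shifted_hessian f alpha d p - shifted_hessian f alpha d x| <= e.
Proof.
move=> e0.
have v1 := shifted_vanish1 fC3 alpha_gt0 x d.
have [r r0 hr] := @pair_filter_ball _ _ x d (fun t => `|shifted_hessian f alpha t.2 t.1.1
    - shifted_hessian f alpha d x| <= e * 1) (v1 e e0).
exists r; first exact: r0.
by move=> p px; have := hr p p d px px (self d r0); rewrite /= mulr1.
Qed.

Lemma shifted_inv_bounded x d : shifted_hessian f alpha d x \in unitmx ->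
  exists C r : R, [/\ 0 < C, 0 < r & forall p, `|p - x| < r ->
    `|invmx (shifted_hessian f alpha d p)| <= C].
Proof.
move=> Du.
have v1 : lilo (nbhs x) one_ (fun p => shifted_hessian f alpha d p
    - shifted_hessian f alpha d x).
  move=> e e0; have [r r0 hr] := shifted_close x d e0.
  apply/nbhs_ballP; exists r => //= p; rewrite -ball_normE /ball_ /= distrC => px.
  by rewrite mulr1; exact: hr p px.
have v2 := vanish_invmx (FF := nbhs_filter x) Du v1.
have /nbhs_ballP[r /= r0 hr] := v2 1 ltr01.
exists (`|invmx (shifted_hessian f alpha d x)| + 1), r; split=> [||p px].
- by rewrite ltr_wpDl.
- exact: r0.
have xp : ball x r p by rewrite -ball_normE /ball_ /= distrC.
apply: norm_le_close; have := hr p xp; rewrite /= mulr1; exact.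
Qed.

Lemma shifted_lipschitz x d : exists C r : R, [/\ 0 < C, 0 < r & forall p,
  `|p - x| < r ->
  `|shifted_hessian f alpha d p - shifted_hessian f alpha d x| <= C * `|p - x|].
Proof.
have [C C0 hC] := lilo_congr_bigo (shifted_diff fC3 alpha_gt0 x d)
  (dshifted_bigo f alpha x d).
have [r r0 hr] := @pair_filter_ball _ _ x d (fun t =>
  `|shifted_hessian f alpha t.2 t.1.1 - shifted_hessian f alpha t.2 t.1.2|
  <= C * dist2 t) hC.
exists C, r; split; [exact: C0 | exact: r0 | ].
by move=> p px; exact: (hr p x d px (self x r0) (self d r0)).
Qed.

Lemma shifted0 p : shifted_hessian f alpha 0 p = hessian f p.
Proof. by rewrite /shifted_hessian mul0r raddf0 addr0. Qed.

(** The bound is uniform in d because the shifted Hessian is affine in d: its values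
    at d = 0 and d = 1 determine it. *)
Lemma shifted_bounded x : exists C r : R, [/\ 0 <= C, 0 < r & forall p d,
  `|p - x| < r -> `|shifted_hessian f alpha d p| <= (1 + 2 * `|d|) * C].
Proof.
have [r0 r00 h0] := shifted_close x 0 ltr01.
have [r1 r10 h1] := shifted_close x 1 ltr01.
pose C := `|shifted_hessian f alpha 0 x| + `|shifted_hessian f alpha 1 x| + 1.
exists C, (Num.min r0 r1); split; [by rewrite !addr_ge0 | by rewrite lt_min r00 | move=> p d].
rewrite lt_min => /andP[p0 p1].
have b0 : `|shifted_hessian f alpha 0 p| <= C.
  apply: le_trans (norm_le_close (h0 p p0)) _.
  by rewrite /C lerD2r lerDl.
have b1 : `|shifted_hessian f alpha 1 p| <= C.
  apply: le_trans (norm_le_close (h1 p p1)) _.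
  by rewrite /C lerD2r lerDr.
have -> : shifted_hessian f alpha d p = (1 - d) *: shifted_hessian f alpha 0 p
    + d *: shifted_hessian f alpha 1 p.
  rewrite shifted0 /shifted_hessian; move: (hessian f p) (enorm _ `^ _) => H s.
  apply/matrixP => i j; rewrite !mxE.
  by case: (i == j); rewrite ?mulr1n ?mulr0n; ring.
apply: le_trans (ler_normD _ _) _; rewrite !normrZ.
have -> : (1 + 2 * `|d|) * C = (1 + `|d|) * C + `|d| * C by ring.
apply: lerD; last by rewrite ler_wpM2l.
apply: ler_pM => //; apply: le_trans (ler_normB _ _) _.
by rewrite normr1.
Qed.

Lemma gradient_close x e : 0 < e -> exists2 r : R, 0 < r & forall p,
  `|p - x| < r -> `|gradient f p - gradient f x| <= e.
Proof.
move=> e0.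
have [r r0 hr] := @pair_filter_ball _ _ x 0 (fun t =>
  `|gradient f t.1.1 - gradient f x| <= e * 1) (gradient_vanish1 fC3 x 0 e0).
exists r; first exact: r0.
by move=> p px; have := hr p p 0 px px (self 0 r0); rewrite /= mulr1.
Qed.

Section AtCritical.
Variable z : 'rV[R]_m.
Hypothesis gz : gradient f z = 0.

Lemma gradient_strict e : 0 < e -> exists2 r : R, 0 < r & forall p,
  `|p - z| < r -> `|gradient f p - (p - z) *m hessian f z| <= e * `|p - z|.
Proof.
move=> e0.
have [r r0 hr] := @pair_filter_ball _ _ z 0 (fun t =>
  `|gradient f t.1.1 - gradient f t.1.2 - (t.1.1 - t.1.2) *m hessian f z|
  <= e * dist2 t) (gradient_diff fC3 z 0 e0).
exists r; first exact: r0.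
by move=> p px; have := hr p z 0 px (self z r0) (self 0 r0); rewrite /= gz subr0.
Qed.

(** Taylor's formula with an intermediate point z + t h; both sides carry the factor
    t, which is enough to determine the sign of the increment. *)
Lemma taylor2 e : 0 < e -> exists2 r : R, 0 < r & forall h, `|h| < r ->
  exists2 t : R, 0 < t & `|f (z + h) - f z - t * dotv (h *m hessian f z) h|
    <= t * (e * (`|h| * `|h|)).
Proof.
move=> e0; pose e' := e / (m%:R + 1).
have m0 : 0 < m%:R + 1 :> R by rewrite ltr_wpDl.
have e'0 : 0 < e' by rewrite divr_gt0.
have [r r0 hr] := gradient_strict e'0.
exists r; first exact: r0.
move=> h hh; have [t /andP[t0 t1]] := MVT_line z h (CkS_differentiable fC3).
rewrite (_ : \sum_i _ = dotv (gradient f (z + t *: h)) h); last first.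
  by rewrite dotvE; apply: eq_bigr => i _; rewrite [gradient _ _ _ _]mxE mulrC.
move=> ->; exists t; first exact: t0.
have zt : z + t *: h - z = t *: h by rewrite addrAC subrr add0r.
have th : `|t *: h| <= t * `|h| by rewrite normrZ gtr0_norm.
have tr : `|t *: h| < r.
  by apply: le_lt_trans th _; apply: le_lt_trans hh; rewrite ler_piMl// ltW.
have := hr (z + t *: h); rewrite zt => /(_ tr).
move: (gradient f (z + t *: h)) => g hg.
rewrite -dotvZl scalemxAl -dotvNl -dotvDl.
apply: le_trans (dotv_norm_le _ _) _.
have := le_trans hg (ler_wpM2l (ltW e'0) th).
move: `|g - _| => a ha.
apply: (@le_trans _ _ (m%:R * (e' * (t * `|h|)) * `|h|)).
  by rewrite ler_wpM2r// ler_wpM2l.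
have -> : m%:R * (e' * (t * `|h|)) * `|h| = t * (m%:R * e' * (`|h| * `|h|)) by ring.
rewrite ler_wpM2l ?(ltW t0)// ler_wpM2r ?mulr_ge0//.
rewrite /e' mulrCA ler_piMr ?(ltW e0)// ler_pdivrMr// mul1r lerDl//.
Qed.

Lemma posdef_local_min : hessian f z \in unitmx ->
  (forall b, b < 0 -> ~~ eigenvalue (hessian f z) b) -> local_min f z.
Proof.
move=> Hz neg; have [c c0 hc] := posdef_coercive (hessian_tr fC3 z) Hz neg.
have [r r0 hr] := taylor2 c0.
apply/nbhs_ballP; exists r => //= p; rewrite -ball_normE /ball_ /= distrC => pz.
have [t t0] := hr (p - z) pz; rewrite (addrC z) subrK.
have := ler_wpM2l (ltW t0) (hc (p - z)).
move: (dotv _ _) (c * _) => a b ab h.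
have /ler_normlP[h1 h2] := h; move: h1 h2 ab; move: (f p) (f z) (t * a) (t * b).
move=> *; lra.
Qed.

Lemma local_min_eigenvalue b : local_min f z -> b < 0 -> ~~ eigenvalue (hessian f z) b.
Proof.
move=> /nbhs_ballP[r1 /= r10 zmin] b0; apply/negP => /eigenvalueP[v vH v0].
have nv : 0 < `|v| by rewrite normr_gt0.
have e0 : 0 < - b / 2 by rewrite divr_gt0// oppr_gt0.
have [r r0 hr] := taylor2 e0.
pose a := Num.min r1 r / (2 * `|v|).
have mr : 0 < Num.min r1 r by rewrite lt_min r10.
have a0 : 0 < a by rewrite divr_gt0// mulr_gt0.
have hv : `|a *: v| < Num.min r1 r.
  by rewrite normrZ gtr0_norm// /a invfM mulrA divfK ?gt_eqF// ltr_pdivrMr// ltr_pMr// ltr1n.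
move: hv; rewrite lt_min => /andP[v1 v2].
have bv : ball z r1 (z + a *: v).
  by rewrite -ball_normE /ball_ /= opprD addrA subrr sub0r normrN.
have := zmin _ bv; rewrite /=.
have [t t0 ht] := hr (a *: v) v2.
have hH : dotv ((a *: v) *m hessian f z) (a *: v) = b * dotv (a *: v) (a *: v).
  by rewrite -scalemxAl vH scalerA mulrC -scalerA dotvZl.
move: ht; rewrite hH.
have : 0 < `|a *: v| * `|a *: v| by rewrite mulr_gt0// normr_gt0 scaler_eq0 gt_eqF.
have := norm_sqr_le_dotv (a *: v).
move: (f (z + _)) (f z) (dotv _ _) (`|_| * `|_|) => y y0 n2 n1 h1 h2 /ler_normlP[_ h3] h4.
have h5 : t * (b * n2) <= t * (b * n1) by rewrite ler_pM2l// ler_nM2l.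
have h6 : t * (b * n1) + t * (- b / 2 * n1) < 0.
  by rewrite -mulrDr pmulr_rlt0// -mulrDl pmulr_llt0//; lra.
move: h3 h4 h5 h6; move: (t * (b * n2)) (t * (b * n1)) (t * (_ * n1)) => *; lra.
Qed.

End AtCritical.
End LocalEstimates.

(** * Convergence *)

Section Convergence.
Context {R : realType} {m : nat}.
Variables (f : 'rV[R]_m -> R) (alpha : R).
Hypotheses (fC3 : Ck 3 f) (alpha_gt0 : 0 < alpha).
Variable delta : 'I_m.+1 -> R.
Hypothesis delta_inj : injective delta.
Implicit Types (p q x z h : 'rV[R]_m).
Let F := nqn_step f alpha delta.

(** A shift that fails equals - l i / s for an eigenvalue l i of the Hessian and
    s = |g|^(1 + alpha): at most m values, for m + 1 distinct shifts. *)
Lemma some_shift_unit x : gradient f x != 0 ->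
  exists j, shifted_hessian f alpha (delta j) x \in unitmx.
Proof.
move=> gx; apply: contrapT => nex.
have [Q [l [QQ HE]]] := spectral (hessian_tr fC3 x).
have s0 : enorm (gradient f x) `^ (1 + alpha) != 0 by rewrite gt_eqF// powR_gt0// enorm_gt0.
have /choice[k hk] : forall j, exists i,
    l ord0 i + delta j * enorm (gradient f x) `^ (1 + alpha) = 0.
  move=> j; apply: contrapT => nz; apply: nex; exists j.
  rewrite (shifted_spectral alpha QQ HE) !unitmx_mul unitmx_tr.
  have -> /= : Q \in unitmx by case: (mulmx1_unit QQ).
  rewrite andbT unitmxE det_diag unitfE; apply/prodf_neq0 => i _.
  by rewrite mxE; apply/eqP => li; apply: nz; exists i.
have kinj : injective k.
  move=> j j' kj; apply: delta_inj; apply: (mulIf s0).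
  by apply: (@addrI _ (l ord0 (k j))); rewrite hk kj hk.
by have := leq_card k kinj; rewrite !card_ord ltnn.
Qed.

Let A x := shifted_hessian f alpha (nqn_delta f alpha delta x) x.

Lemma nqn_shift_unit x : gradient f x != 0 -> A x \in unitmx.
Proof.
move=> gx; rewrite /A /nqn_delta (negPf gx).
have [j ju] := some_shift_unit gx.
rewrite /arg_min /extremum; case: pickP => [i /andP[]//|none].
have [i iu imin] := @arg_minnP _ j
  (fun i => shifted_hessian f alpha (delta i) x \in unitmx) (fun i => i : nat) ju.
have /negP[] := negbT (none i); rewrite /= iu /=.
by apply/forallP => k; apply/implyP; exact: imin.
Qed.

(** The step x - F x = g A^-1 S solved for g, since S S = 1. *)
Lemma nqn_step_gradient x : gradient f x = (x - F x) *m sgnmx (A x) *m A x.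
Proof.
have wE : x - F x = gradient f x *m invmx (A x) *m sgnmx (A x).
  by rewrite /F /nqn_step -/(A x) opprB addrC subrK /sgnmx mulmxBr.
have [gx|gx] := eqVneq (gradient f x) 0; first by rewrite wE gx !mul0mx.
have Au := nqn_shift_unit gx.
have AT : (A x)^T = A x by exact: shifted_hessian_tr.
rewrite wE -(mulmxA _ (sgnmx _) (sgnmx _)) (sgnmx_sq AT Au) mulmx1.
by rewrite mulmxKV.
Qed.

Lemma nqn_shift_le x : `|nqn_delta f alpha delta x| <= \sum_j `|delta j|.
Proof.
have le_sum j : `|delta j| <= \sum_i `|delta i|.
  by rewrite (bigD1 j)//= lerDl sumr_ge0.
by rewrite /nqn_delta; case: ifP => _; exact: le_sum.
Qed.

(** The steps x_n - x_(n + 1) tend to 0, and the gradient at x_n is the step times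
    S A, where |S| <= 1 because S is orthogonal, and A is bounded. *)
Lemma limit_critical x z : iter n F x @[n --> \oo] --> z -> gradient f z = 0.
Proof.
move=> cv; pose L := \sum_j `|delta j|.
have L0 : 0 <= L by apply: sumr_ge0.
have [C [r [C0 r0 hC]]] := shifted_bounded fC3 alpha_gt0 z.
pose K := m%:R * (m%:R * 1) * ((1 + 2 * L) * C) + 1.
have B0 : 0 <= (1 + 2 * L) * C by rewrite mulr_ge0// addr_ge0// mulr_ge0.
have K0 : 0 < K by rewrite ltr_wpDl// mulr_ge0// !mulr_ge0.
have grad_le p : `|p - z| < r -> `|gradient f p| <= K * `|p - F p|.
  move=> pz; have [->|gp] := eqVneq (gradient f p) 0.
    by rewrite normr0 mulr_ge0// ltW.
  have Au := nqn_shift_unit gp.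
  have AT : (A p)^T = A p by exact: shifted_hessian_tr.
  have S1 : `|sgnmx (A p)| <= 1.
    by apply: orthogonal_norm_le; rewrite (sgnmx_tr AT) (sgnmx_sq AT Au).
  have A1 : `|A p| <= (1 + 2 * L) * C.
    apply: le_trans (hC p (nqn_delta f alpha delta p) pz) _.
    by rewrite ler_wpM2r// lerD2l ler_wpM2l// nqn_shift_le.
  rewrite (nqn_step_gradient p); move: (sgnmx (A p)) (A p) (p - F p) S1 A1 => S B w S1 B1.
  apply: le_trans (mulmx_norm_le _ _) _.
  apply: (@le_trans _ _ (m%:R * (m%:R * `|w| * 1) * ((1 + 2 * L) * C))).
    apply: ler_pM => //; rewrite ?mulr_ge0// ler_wpM2l//.
    apply: le_trans (mulmx_norm_le _ _) _.
    by rewrite ler_wpM2l// mulr_ge0.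
  have -> : m%:R * (m%:R * `|w| * 1) * ((1 + 2 * L) * C) =
    m%:R * (m%:R * 1) * ((1 + 2 * L) * C) * `|w| by ring.
  by rewrite ler_wpM2r// lerDl.
apply/normr0_eq0/eqP; rewrite eq_le normr_ge0 andbT; apply/ler_addgt0Pr => e e0.
rewrite add0r.
have [r1 r10 h1] := gradient_close fC3 z (divr_gt0 e0 (ltr0n _ 2)).
pose eta := Num.min r (Num.min r1 (e / 4 / K)).
have eta0 : 0 < eta by rewrite !lt_min r0 r10 !divr_gt0.
have /cvgrPdist_lt/(_ _ eta0)[N _ hN] := cv.
have close k : (N <= k)%N -> [/\ `|iter k F x - z| < r, `|iter k F x - z| < r1
    & `|iter k F x - z| < e / 4 / K].
  by move=> /hN; rewrite /= distrC !lt_min => /and3P[].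
have [a1 a2 a3] := close N (leqnn _).
have [_ _ b3] := close N.+1 (leqnSn _).
have g1 := grad_le _ a1.
have g2 := h1 _ a2.
have g3 : `|iter N F x - F (iter N F x)| <= e / 4 / K + e / 4 / K.
  have -> : iter N F x - F (iter N F x) = (iter N F x - z) - (iter N.+1 F x - z).
    by rewrite (opprB (iter N.+1 F x) z) addrA subrK.
  by apply: le_trans (ler_normB _ _) _; exact: lerD (ltW a3) (ltW b3).
have g4 : K * `|iter N F x - F (iter N F x)| <= e / 2.
  have -> : e / 2 = K * (e / 4 / K + e / 4 / K) by field; rewrite gt_eqF.
  by rewrite ler_pM2l.
move: g2; rewrite distrC => /norm_le_close/le_trans; apply.
rewrite [leRHS](_ : e = e / 2 + e / 2); last by field.
by rewrite lerD2r; exact: le_trans g1 g4.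
Qed.

Section AtCritical.
Variable z : 'rV[R]_m.
Hypotheses (gz : gradient f z = 0) (Hz : hessian f z \in unitmx).

Lemma step_lipschitz : exists C r : R, [/\ 0 < C, 0 < r & forall p,
  `|p - z| < r -> `|F p - z| <= C * `|p - z|].
Proof.
have [r r0 hr] := step_strict fC3 alpha_gt0 delta gz Hz ltr01.
exists (m%:R * `|1%:M - sgnmx (hessian f z)| + 1), r; split; first by rewrite ltr_wpDl// mulr_ge0.
  exact: r0.
move=> p pz; have zz : `|z - z| < r by rewrite subrr normr0.
have := hr p z pz zz; rewrite (step_fix alpha delta gz) -/F mul1r => h.
apply: le_trans (norm_le_close h) _; rewrite mulrDl mul1r lerD2r.
by apply: le_trans (mulmx_norm_le _ _) _; rewrite mulrAC.
Qed.

Hypothesis S1 : sgnmx (hessian f z) = 1%:M.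

Lemma step_contraction : exists2 r : R, 0 < r & forall p,
  `|p - z| < r -> `|F p - z| <= 2^-1 * `|p - z|.
Proof.
have e0 : 0 < 2^-1 :> R by rewrite invr_gt0.
have [r r0 hr] := step_strict fC3 alpha_gt0 delta gz Hz e0.
exists r; first exact: r0.
move=> p pz; have zz : `|z - z| < r by rewrite subrr normr0.
have := hr p z pz zz; rewrite (step_fix alpha delta gz) -/F S1 subrr mulmx0 subr0.
exact.
Qed.

(** Newton's classical computation: F p - z equals ((p - z) S A - g(p)) A^-1 S,
    where A and S are taken at p. As S = 1 at z, the difference S A - H(z) is of
    order |p - z|, and (p - z) H(z) - g(p) is of order |p - z|^2 because the
    Hessian is Lipschitz at z. *)
Lemma step_quadratic : exists C r : R, [/\ 0 < C, 0 < r & forall p,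
  `|p - z| < r -> `|F p - z| <= C * (`|p - z| * `|p - z|)].
Proof.
pose d0 := delta ord0; pose H := hessian f z.
have Az : shifted_hessian f alpha d0 z = H by exact: shifted_critical.
have HT : H^T = H by exact: hessian_tr.
have [Q [l [QQ HE]]] := spectral HT.
have [C1 C10 hC1] := sgnmx_close QQ HE Hz.
have [r1 r10 h1] := critical_strict fC3 alpha_gt0 gz Hz d0 ltr01.
have [C2 [r2 [C20 r20 h2]]] := shifted_lipschitz fC3 alpha_gt0 z d0.
have [C3 [r3 [C30 r30 h3]]] := shifted_lipschitz fC3 alpha_gt0 z 0.
have Azu : shifted_hessian f alpha d0 z \in unitmx by rewrite Az.
have [C4 [r4 [C40 r40 h4]]] := shifted_inv_bounded fC3 alpha_gt0 Azu.
have [C5 [r5 [C50 r50 h5]]] := shifted_bounded fC3 alpha_gt0 z.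
pose M := m%:R : R; have M0 : 0 <= M by [].
pose B := (1 + 2 * `|d0|) * C5.
have B0 : 0 <= B by rewrite mulr_ge0// addr_ge0// mulr_ge0.
pose K := M * (M * (M * (M * (C1 * C2) * B + C2) + M * C3) * C4) + 1.
have K0 : 0 < K.
  by rewrite ltr_wpDl// !(mulr_ge0, addr_ge0)// ltW.
exists K, (Num.min r1 (Num.min r2 (Num.min r3 (Num.min r4 r5)))); split.
- exact: K0.
- by rewrite !lt_min r10 r20 r30 r40 r50.
move=> p; rewrite !lt_min => /and5P[p1 p2 p3 p4 p5].
have [pu _] := h1 p p p1 p1.
have a2 := h2 p p2; have a4 := h4 p p4; have a5 := h5 p d0 p5.
rewrite Az in a2.
have AT : (shifted_hessian f alpha d0 p)^T = shifted_hessian f alpha d0 p.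
  exact: shifted_hessian_tr.
have a1 := hC1 _ AT pu; rewrite S1 in a1.
have SS := sgnmx_sq AT pu; have ST := sgnmx_tr AT.
have Sle : `|sgnmx (shifted_hessian f alpha d0 p)| <= 1.
  by apply: orthogonal_norm_le; rewrite ST SS.
have gle : `|(p - z) *m H - gradient f p| <= M * C3 * (`|p - z| * `|p - z|).
  apply: mx_norm_le => [|i j]; first by rewrite !mulr_ge0// ltW.
  have [t /andP[t0 t1]] := MVT_line z (p - z) (CkS_differentiable (CkS_partial j fC3)).
  rewrite (addrC z (p - z)) subrK => E.
  have tz : z + t *: (p - z) - z = t *: (p - z) by rewrite addrAC subrr add0r.
  have tn : `|t *: (p - z)| <= `|p - z|.
    by rewrite normrZ gtr0_norm// ler_piMl// ltW.
  have Hle := h3 (z + t *: (p - z)); rewrite tz !shifted0 in Hle.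
  have {}Hle := Hle (le_lt_trans tn p3).
  have gzj : partial f j z = 0.
    by have := congr1 (fun u : 'rV[R]_m => u ord0 j) gz; rewrite !mxE.
  have -> : ((p - z) *m H - gradient f p) i j =
     \sum_k (p - z) ord0 k * - ((hessian f (z + t *: (p - z)) - H) j k).
    rewrite ord1 mx_subE [gradient _ _ _ _]mxE -(subr0 (partial f j p)) -[X in _ - (_ - X)]gzj E.
    rewrite mxE -sumrB; apply: eq_bigr => k _.
    have Hkj : H k j = H j k by rewrite -{1}HT mxE.
    rewrite -mulrBr Hkj (mx_subE (hessian f (z + t *: (p - z))) H) opprB.
    by congr (_ * (_ - _)); rewrite mxE.
  apply: le_trans (ler_norm_sum _ _ _) _.
  have -> : M * C3 * (`|p - z| * `|p - z|) = \sum_(k < m) (`|p - z| * (C3 * `|p - z|)).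
    by rewrite sumr_const card_ord -mulr_natl /M; ring.
  apply: ler_sum => k _; rewrite normrM normrN; apply: ler_pM => //.
    exact: mx_entry_le.
  apply: le_trans (mx_entry_le _ _ _) _; apply: le_trans Hle _.
  by rewrite ler_pM2l.
have FE : F p - z = ((p - z) *m sgnmx (shifted_hessian f alpha d0 p)
     *m shifted_hessian f alpha d0 p - gradient f p)
     *m invmx (shifted_hessian f alpha d0 p) *m sgnmx (shifted_hessian f alpha d0 p).
  rewrite /F (nqn_step_fixed pu) /nqn_fixed /nqn_dir -/d0.
  move: (gradient f p) pu SS; move: (shifted_hessian f alpha d0 p) => D g Du SS.
  rewrite (mulmxBl _ g) mulmxK// (mulmxBl _ (g *m _)) -(mulmxA (p - z)) SS mulmx1.
  by rewrite addrAC.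
rewrite FE; move: a1 a2 a4 a5 Sle gle; move: (gradient f p) (sgnmx _) (invmx _).
move: (shifted_hessian f alpha d0 p) => D g S D' a1 a2 a4 a5 Sle gle.
move: (p - z) a2 gle => u a2 gle.
have n0 : 0 <= `|u| by [].
have e1 : `|S - 1%:M| <= C1 * C2 * `|u|.
  by apply: le_trans a1 _; rewrite -mulrA ler_pM2l.
have e2 : `|S *m D - H| <= (M * (C1 * C2) * B + C2) * `|u|.
  have -> : S *m D - H = (S - 1%:M) *m D + (D - H).
    by rewrite mulmxBl mul1mx addrA subrK.
  apply: le_trans (ler_normD _ _) _; rewrite mulrDl; apply: lerD => //.
  apply: le_trans (mulmx_norm_le _ _) _.
  have -> : M * (C1 * C2) * B * `|u| = M * (C1 * C2 * `|u|) * B by ring.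
  by apply: ler_pM => //; rewrite ?mulr_ge0// ler_wpM2l.
have e3 : `|u *m S *m D - g| <=
    (M * (M * (C1 * C2) * B + C2) + M * C3) * (`|u| * `|u|).
  have -> : u *m S *m D - g = u *m (S *m D - H) + (u *m H - g).
    by rewrite mulmxBr mulmxA addrA subrK.
  apply: le_trans (ler_normD _ _) _; rewrite mulrDl; apply: lerD => //.
  apply: le_trans (mulmx_norm_le _ _) _.
  have -> : M * (M * (C1 * C2) * B + C2) * (`|u| * `|u|) =
     M * `|u| * ((M * (C1 * C2) * B + C2) * `|u|) by ring.
  by rewrite ler_wpM2l// mulr_ge0.
apply: le_trans (mulmx_norm_le _ _) _.
set G := M * _ + M * C3 in e3.
have G0 : 0 <= G by rewrite /G !(mulr_ge0, addr_ge0)// ltW.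
apply: (@le_trans _ _ (M * (M * (G * (`|u| * `|u|)) * C4) * 1)).
  apply: ler_pM; rewrite ?mulr_ge0//; apply: ler_wpM2l => //.
  apply: le_trans (mulmx_norm_le _ _) _.
  by apply: ler_pM => //; rewrite ?mulr_ge0//; apply: ler_wpM2l.
have -> : M * (M * (G * (`|u| * `|u|)) * C4) * 1 = M * (M * G * C4) * (`|u| * `|u|) by ring.
by rewrite ler_wpM2r ?mulr_ge0// /K lerDl.
Qed.

End AtCritical.

Lemma contraction_converges z r : 0 < r ->
  (forall p, `|p - z| < r -> `|F p - z| <= 2^-1 * `|p - z|) ->
  forall x, `|x - z| < r -> iter n F x @[n --> \oo] --> z.
Proof.
move=> r0 hr x xz.
have le_geom n : `|iter n F x - z| <= 2^-1 ^+ n * `|x - z|.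
  elim: n => [|n IH]; first by rewrite expr0 mul1r.
  have inb : `|iter n F x - z| < r.
    apply: le_lt_trans IH _; apply: le_lt_trans xz.
    by rewrite ler_piMl// exprn_ile1// invf_le1// ler1n.
  rewrite exprS -mulrA; apply: le_trans (hr _ inb) _.
  by rewrite ler_pM2l// invr_gt0.
apply/cvgrPdist_le => e e0.
have c : (fun n => 2^-1 ^+ n : R) @ \oo --> (0 : R).
  by apply: cvg_expr; rewrite ger0_norm ?invf_lt1 ?invr_ge0// ltr1n.
have er : 0 < e / r by rewrite divr_gt0.
have /cvgrPdist_le/(_ _ er)[N _ hN] := c.
exists N => // n /= Nn; have h0 : 0 <= 2^-1 ^+ n :> R by rewrite exprn_ge0// invr_ge0.
have := hN n Nn; rewrite /= sub0r normrN ger0_norm// => h.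
rewrite distrC; apply: le_trans (le_geom n) _.
rewrite -(divfK (lt0r_neq0 r0) e); by apply: ler_pM => //; exact: ltW.
Qed.

(** In O-estimates along a convergent sequence the Euclidean norm may be
    replaced by the sup norm. *)
Lemma enorm_bigO (x : nat -> 'rV[R]_m) z C r k : 0 < C -> 0 < r ->
  (forall p, `|p - z| < r -> `|F p - z| <= C * `|p - z| ^+ k) ->
  (forall n, x n.+1 = F (x n)) -> x n @[n --> \oo] --> z ->
  (fun n => enorm (x n.+1 - z)) =O_\oo (fun n => enorm (x n - z) ^+ k).
Proof.
move=> C0 r0 h xS cv.
have M0 : 0 < m%:R + 1 :> R by rewrite ltr_wpDl.
apply/eqO_exP; exists ((m%:R + 1) * C); first by rewrite mulr_gt0.
have /cvgrPdist_lt/(_ _ r0)[N _ hN] := cv.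
exists N => // n /= Nn; have xz : `|x n - z| < r by rewrite distrC; exact: hN.
rewrite [X in X <= _]ger0_norm ?enorm_ge0// [X in _ <= _ * X]ger0_norm ?exprn_ge0 ?enorm_ge0//.
rewrite xS; apply: le_trans (enorm_le_norm _) _.
rewrite -mulrA ler_pM2l//; apply: le_trans (h _ xz) _.
by rewrite ler_pM2l// lerXn2r ?nnegrE ?enorm_ge0// norm_le_enorm.
Qed.

End Convergence.

(** * Limits of the method *)

Theorem theorem1p1 (R : realType) (m : nat) (f : 'rV[R]_m -> R) (alpha : R)
    (m_gt0 : (0 < m)%N) (fC3 : Ck 3 f) (alpha_gt0 : 0 < alpha) :
  [/\ (* part 1 *)
      forall delta : 'I_m.+1 -> R, injective delta ->
      forall x0 xoo : 'rV[R]_m,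
        nqn_seq f alpha delta x0 n @[n --> \oo] --> xoo ->
        gradient f xoo = 0,
      (* parts 2 and 3 *)
      exists2 E : set R, lebesgue_measure.-negligible E &
      forall delta : 'I_m.+1 -> R, injective delta ->
        (forall j, ~ E (delta j)) ->
      exists2 A : set 'rV[R]_m, lebesgue_null A &
      forall x0 xoo : 'rV[R]_m,
        nqn_seq f alpha delta x0 n @[n --> \oo] --> xoo ->
        ~ A x0 ->
        ~ saddle_point f xoo /\
        (hessian f xoo \in unitmx ->
         local_min f xoo /\
         (fun n => enorm (nqn_seq f alpha delta x0 n.+1 - xoo)) =O_\oo
         (fun n => enorm (nqn_seq f alpha delta x0 n - xoo) ^+ 2)),
      (* part 4 *)
      forall delta : 'I_m.+1 -> R, injective delta ->
      forall x0 xoo : 'rV[R]_m,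
        nqn_seq f alpha delta x0 n @[n --> \oo] --> xoo ->
        hessian f xoo \in unitmx ->
        (fun n => enorm (nqn_seq f alpha delta x0 n.+1 - xoo)) =O_\oo
        (fun n => enorm (nqn_seq f alpha delta x0 n - xoo))
    & (* part 5 *)
      forall delta : 'I_m.+1 -> R, injective delta ->
      forall xoo : 'rV[R]_m,
        local_min f xoo -> nondegenerate_critical f xoo ->
        \forall x0 \near xoo,
          nqn_seq f alpha delta x0 n @[n --> \oo] --> xoo].
Proof.
have seqS delta x0 n : nqn_seq f alpha delta x0 n.+1 =
    nqn_step f alpha delta (nqn_seq f alpha delta x0 n) by [].
have part1 delta : injective delta -> forall x0 xoo : 'rV[R]_m,
    nqn_seq f alpha delta x0 n @[n --> \oo] --> xoo -> gradient f xoo = 0.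
  by move=> inj x0 xoo; exact: (limit_critical fC3 alpha_gt0 inj).
split.
- exact: part1.
- have [E E0 hE] := exceptional_parameters m_gt0 fC3 alpha_gt0.
  exists E; first exact: E0.
  move=> delta inj nE.
  have generic := hE (delta ord0) (nE ord0).
  exists (bad_start f alpha delta).
    by apply: null_lebesgue => //; exact: bad_start_null generic.
  move=> x0 xoo cv nA.
  have gz := part1 delta inj x0 xoo cv.
  have neg : hessian f xoo \in unitmx -> forall b, b < 0 ->
      ~~ eigenvalue (hessian f xoo) b.
    move=> Hz b b0; apply/negP => eb; apply: nA.
    exact: bad_start_saddle gz Hz b0 eb cv.
  split.
    by move=> [_ Hz _ [b b0 eb]]; have := neg Hz b b0; rewrite eb.
  move=> Hz; split; first exact: posdef_local_min gz Hz (neg Hz).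
  have S1 := sgnmx_posdef (hessian_tr fC3 xoo) Hz (neg Hz).
  have [C [r [C0 r0 hC]]] := step_quadratic fC3 alpha_gt0 delta gz Hz S1.
  apply: (enorm_bigO (f := f) (alpha := alpha) (delta := delta) (k := 2) C0 r0) cv.
    by move=> p pz; rewrite expr2; exact: hC.
  exact: seqS.
- move=> delta inj x0 xoo cv Hz.
  have gz := part1 delta inj x0 xoo cv.
  have [C [r [C0 r0 hC]]] := step_lipschitz fC3 alpha_gt0 delta gz Hz.
  apply: (enorm_bigO (f := f) (alpha := alpha) (delta := delta) (k := 1) C0 r0) cv.
    by move=> p pz; exact: hC.
  exact: seqS.
- move=> delta inj xoo lm [gz Hz].
  have neg b : b < 0 -> ~~ eigenvalue (hessian f xoo) b.
    exact: (local_min_eigenvalue fC3 gz lm).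
  have S1 := sgnmx_posdef (hessian_tr fC3 xoo) Hz neg.
  have [r r0 hr] := step_contraction fC3 alpha_gt0 delta gz Hz S1.
  apply/nbhs_ballP; exists r => //= x0; rewrite -ball_normE /ball_ /= distrC.
  exact: contraction_converges r0 hr x0.
Qed.
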